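(* Let $0<\delta<1$ and $\varphi(r)=(\log^+r)^{1+\delta}$, $r\ge0$, extended to $\mathbb{C}$ by $\varphi(z)=\varphi(|z|)$. For $n\ge0$ let $w_n=\log\|z^n\|_\varphi^2$, and let $r_0=0$ and $r_n=\exp[(w_{n+1}-w_{n-1})/4]$ for $n\ge1$. Let $\lambda_n=r_ne^{i\theta_n}$, $n\ge 0$, with arbitrary real $\theta_n$. Then $\{\Bbbk_{\lambda_n}\}_{n\ge0}$ is a Riesz basis in $\mathcal{F}_\varphi$.
   Context: $\log^+r=\max(\log r,0)$ (with $\log^+0=0$). $\mathcal{F}_\varphi$ is the Hilbert space of entire functions $f$ with $\|f\|_\varphi^2=\int_{\mathbb{C}}|f(z)|^2e^{-2\varphi(z)}\,dm(z)<\infty$, where $dm$ is area Lebesgue measure, with the corresponding inner product $\langle\cdot,\cdot\rangle_\varphi$. In particular $\|z^n\|_\varphi^2=\int_{\mathbb{C}}|z|^{2n}e^{-2\varphi(z)}\,dm(z)$. Point evaluations are bounded on $\mathcal{F}_\varphi$; $\mathbf{k}_\lambda\in\mathcal{F}_\varphi$ denotes the reproducing kernel at $\lambda$, $f(\lambda)=\langle f,\mathbf{k}_\lambda\rangle_\varphi$ for all $f\in\mathcal{F}_\varphi$, and $\Bbbk_\lambda=\mathbf{k}_\lambda/\|\mathbf{k}_\lambda\|_\varphi$ is the normalized reproducing kernel. The system $\{\Bbbk_{\lambda_n}\}_{n\ge0}$ is a Riesz basis in $\mathcal{F}_\varphi$ if it is complete (its linear span is dense) and there are $c,C>0$ with $c\sum|a_n|^2\le\|\sum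 a_n\Bbbk_{\lambda_n}\|_\varphi^2\le C\sum|a_n|^2$ for every finite sequence $\{a_n\}\subset\mathbb{C}$. *)

(* Defs.v *)
From mathcomp Require Import all_boot all_order all_algebra.
From mathcomp Require Import all_classical all_reals all_analysis.
From mathcomp Require Import complex.

Set Implicit Arguments.
Unset Strict Implicit.
Unset Printing Implicit Defensive.

Import Order.TTheory GRing.Theory Num.Theory.
Import numFieldNormedType.Exports.

Local Open Scope classical_set_scope.
Local Open Scope complex_scope.
Local Open Scope ring_scope.

(* [R[i]^o] is [R[i]] as a normed space over itself, so [derivable] refers to
   the limit of the difference quotient over complex increments. *)
Definition entire (R : realType) (f : R[i] -> R[i]) : Prop :=
  forall z : R[i], derivable (f : R[i]^o -> R[i]^o) z 1.

Definition area (R : realType) :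
    {measure set (measurableTypeR R * measurableTypeR R) -> \bar R} :=
  (@lebesgue_measure R \x @lebesgue_measure R)%E.
Arguments area : clear implicits.

Definition complex_of_pair (R : realType) (p : R * R) : R[i] := p.1 +i* p.2.

(* The modulus as an element of [R]; the library norm [`|z|] lives in [R[i]]. *)
Definition cabs (R : realType) (z : R[i]) : R := complex.Re `|z|.

Section FockSpace.
Context {R : realType}.
Variable phi : R[i] -> R.
Implicit Types f g : R[i] -> R[i].

Definition fock_normsq f : \bar R :=
  (\int[area R]_p
     (cabs (f (complex_of_pair p)) ^+ 2
      * expR (- 2 * phi (complex_of_pair p)))%:E)%E.

Definition fock f : Prop := entire f /\ (fock_normsq f < +oo)%E.

Definition fock_norm f : R := Num.sqrt (fine (fock_normsq f)).

Definition fock_inner f g : R[i] :=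
  let h p := f (complex_of_pair p) * conjc (g (complex_of_pair p))
             * (expR (- 2 * phi (complex_of_pair p)))%:C in
  Rintegral (area R) setT (fun p => complex.Re (h p))
    +i* Rintegral (area R) setT (fun p => complex.Im (h p)).

Definition is_reproducing_kernel (lam : R[i]) (k : R[i] -> R[i]) : Prop :=
  fock k /\ forall f, fock f -> f lam = fock_inner f k.

Definition fock_normalized (k : R[i] -> R[i]) : R[i] -> R[i] :=
  fun z => k z / (fock_norm k)%:C.

(* Finite sequences are represented by the first [N] terms of [a]. *)
Definition lincomb (e : nat -> R[i] -> R[i]) (N : nat) (a : nat -> R[i]) :
    R[i] -> R[i] :=
  fun z => \sum_(n < N) a n * e n z.

Definition complete_system (e : nat -> R[i] -> R[i]) : Prop :=
  forall f, fock f -> forall eps : R, 0 < eps ->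
  exists (N : nat) (a : nat -> R[i]),
    (fock_normsq (fun z => f z - lincomb e N a z)%R < (eps ^+ 2)%:E)%E.

Definition riesz_basis (e : nat -> R[i] -> R[i]) : Prop :=
  [/\ forall n, fock (e n),
      complete_system e &
      exists c C : R, [/\ 0 < c, 0 < C &
        forall (N : nat) (a : nat -> R[i]),
          ((c * \sum_(n < N) cabs (a n) ^+ 2)%:E <= fock_normsq (lincomb e N a)
           <= (C * \sum_(n < N) cabs (a n) ^+ 2)%:E)%E]].

Definition log_moment (n : nat) : R :=
  ln (fine (fock_normsq (fun z => z ^+ n))).

Definition fock_radius (n : nat) : R :=
  if n is m.+1 then expR ((log_moment m.+2 - log_moment m) / 4) else 0.

End FockSpace.

(* [ln 0 = 0] in the library, which agrees with the convention log^+ 0 = 0. *)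
Definition logplus (R : realType) (r : R) : R := Num.max (ln r) 0.

Definition log_weight (R : realType) (delta : R) (z : R[i]) : R :=
  logplus (cabs z) `^ (1 + delta).

Definition cpolar (R : realType) (r t : R) : R[i] := (r * cos t) +i* (r * sin t).

(* Main.v *)
From HB Require Import structures.
Require Import Defs.
From mathcomp Require Import all_boot all_order all_algebra.
From mathcomp Require Import all_classical all_reals all_analysis.
From mathcomp Require Import measurable_realfun complex ring lra zify.

Set Implicit Arguments.
Unset Strict Implicit.
Unset Printing Implicit Defensive.

Import Order.TTheory GRing.Theory Num.Theory.
Import numFieldNormedType.Exports.

Local Open Scope complex_scope.
Local Open Scope ring_scope.

(** The monomials are orthogonal in the space, because the weight is radial, and
    the theorem becomes a statement on an infinite matrix. Write
    [h_n = ||z^n||^2] and [alpha_n = sqrt h_n]. The normalized kernel at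
    [lambda_n] has, in the orthonormal basis [z^m / alpha_m], coordinates
    [v_(n,m) = conj lambda_n ^ m / (alpha_m nu_n)], where [nu_n] is the norm of the
    kernel. For fixed [n] the modulus of [v_(n,m)] is largest at [m = n], by the
    choice [r_n^4 = h_(n+1) / h_(n-1)] of the radii, and the point is that it
    decays geometrically, as [q^|n - m|], away from the diagonal.

    This decay comes from the strict log-convexity
    [h_(n+1) h_(n-1) >= e^(1 - delta) h_n^2] of the moments
    ([hmoment_log_convex]). Compared with the Cauchy-Schwarz inequality, the gain
    is found by dilating the two integrals on the left by [e^(1/2)] and
    [e^(-1/2)]: the powers of [z] contribute a factor [e^2], and the weight loses at
    most [e^-(1 + delta)], because the second difference of
    [t |-> max(t, 0)^(1 + delta)] with step [1/2] is at most [(1 + delta) / 2]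
    ([lphi_second_difference]); this is where [delta < 1] is used.

    The inverses of the leading [N] by [N] blocks of [v] are explicit: up to
    scaling, [v] is a Vandermonde matrix, and its inverse consists of the
    coefficients of the Lagrange polynomials of the nodes. As the radii grow at
    least geometrically, every factor in these coefficients is governed by its
    larger term, and the inverses decay geometrically off the diagonal as well,
    with constants independent of [N] ([lagrange_coef_decay]). Schur's test for
    [v] and for the inverses then gives the two inequalities of a Riesz basis
    ([kernel_matrix_upper], [kernel_matrix_lower]). For completeness, the leading
    block is inverted on a truncation of the coefficient sequence of [f], and the
    decay makes the overflow beyond [N] small ([kernel_matrix_finite_section]).

    To pass between functions and coefficients one needs that an entire function
    is the sum of a power series ([entire_power_series]), obtained from complex
    differentiability alone by Goursat's bisection argument, applied to
    homotheties of a circle, and Parseval's identity for radial weights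
    ([wnormsq_psum_le], [wnormsq_le_psum]), obtained from the invariance of area
    under rotations by averaging over roots of unity. Parseval's identity also
    gives, by polarization, the coefficients [conj lambda ^ m / h_m] of the kernel
    at [lambda] ([kernel_power_series]). *)

(** * Modulus and topology of the complex numbers *)

Section ComplexModulus.
Context {R : realType}.
Implicit Types z w : R[i].

Lemma normC_cabs z : `|z| = (cabs z)%:C.
Proof. by rewrite /cabs normc_def. Qed.

Lemma cabsE z : cabs z = Num.sqrt (complex.Re z ^+ 2 + complex.Im z ^+ 2).
Proof. by rewrite /cabs normc_def. Qed.

Lemma sqr_cabs z : cabs z ^+ 2 = complex.Re z ^+ 2 + complex.Im z ^+ 2.
Proof. by rewrite cabsE sqr_sqrtr// addr_ge0 ?sqr_ge0. Qed.

Lemma cabs_ge0 z : 0 <= cabs z.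
Proof. by rewrite cabsE sqrtr_ge0. Qed.

Lemma cabsM z w : cabs (z * w) = cabs z * cabs w.
Proof. by apply: complexI; rewrite rmorphM /= -!normC_cabs normrM. Qed.

Lemma cabsD z w : cabs (z + w) <= cabs z + cabs w.
Proof. by rewrite -lecR rmorphD /= -!normC_cabs ler_normD. Qed.

Lemma cabsN z : cabs (- z) = cabs z.
Proof. by apply: complexI; rewrite -!normC_cabs normrN. Qed.

Lemma cabsB z w : cabs (z - w) <= cabs z + cabs w.
Proof. by rewrite -[cabs w]cabsN cabsD. Qed.

Lemma cabs_distC z w : cabs (z - w) = cabs (w - z).
Proof. by rewrite -cabsN opprB. Qed.

Lemma cabs0 : cabs (0 : R[i]) = 0.
Proof. by apply: complexI; rewrite -normC_cabs normr0. Qed.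

Lemma cabs1 : cabs (1 : R[i]) = 1.
Proof. by apply: complexI; rewrite -normC_cabs normr1. Qed.

Lemma cabsV z : cabs z^-1 = (cabs z)^-1.
Proof.
apply: complexI; rewrite -normC_cabs normfV normC_cabs.
exact/esym/(fmorphV (real_complex R)).
Qed.

Lemma cabsX z n : cabs (z ^+ n) = cabs z ^+ n.
Proof.
elim: n => [|n IH]; first by rewrite !expr0 cabs1.
by rewrite !exprS cabsM IH.
Qed.

Lemma cabs_eq0 z : (cabs z == 0) = (z == 0).
Proof. by rewrite -[z == 0]normr_eq0 normC_cabs -(inj_eq (@complexI R)). Qed.

Lemma cabs_gt0 z : (0 < cabs z) = (z != 0).
Proof. by rewrite lt_def cabs_eq0 cabs_ge0 andbT. Qed.

Lemma cabs_real (x : R) : cabs x%:C = `|x|.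
Proof. by rewrite cabsE /= expr0n addr0 sqrtr_sqr. Qed.

Lemma cabs_conj z : cabs (conjc z) = cabs z.
Proof. by rewrite !cabsE; case: z => x y /=; rewrite sqrrN. Qed.

Lemma cabs_prod (I : Type) (s : seq I) (P : pred I) (F : I -> R[i]) :
  cabs (\prod_(i <- s | P i) F i) = \prod_(i <- s | P i) cabs (F i).
Proof. exact: (big_morph _ cabsM cabs1). Qed.

Lemma cabs_sum (I : Type) (s : seq I) (P : pred I) (F : I -> R[i]) :
  cabs (\sum_(i <- s | P i) F i) <= \sum_(i <- s | P i) cabs (F i).
Proof.
elim/big_rec2: _ => [|i x y _ H]; first by rewrite cabs0.
by apply: (le_trans (cabsD _ _)); rewrite lerD2l.
Qed.

Lemma ler_Re_cabs z : `|complex.Re z| <= cabs z.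
Proof. by rewrite cabsE -sqrtr_sqr ler_wsqrtr// lerDl sqr_ge0. Qed.

Lemma ler_Im_cabs z : `|complex.Im z| <= cabs z.
Proof. by rewrite cabsE -sqrtr_sqr ler_wsqrtr// lerDr sqr_ge0. Qed.

Lemma ler_cabs_ReIm z : cabs z <= `|complex.Re z| + `|complex.Im z|.
Proof.
rewrite -ler_sqr ?nnegrE ?addr_ge0 ?cabs_ge0//.
by rewrite sqr_cabs sqrrD !real_normK ?num_real// lerD2r lerDl mulrn_wge0 ?mulr_ge0.
Qed.

Lemma cabs_dist z w : `|cabs z - cabs w| <= cabs (z - w).
Proof.
rewrite ler_distl; apply/andP; split.
  by rewrite lerBlDr -cabs_distC; apply: le_trans (cabsD _ _); rewrite addrC subrK.
by rewrite -lerBlDl lerBlDr; apply: le_trans (cabsD _ _); rewrite subrK.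
Qed.

End ComplexModulus.

Section ComplexTopology.
Context {R : realType}.
Local Open Scope classical_set_scope.
Local Notation C := (R[i]^o).

Lemma cvg_cabsP (T : Type) (F : set_system T) (FF : Filter F) (f : T -> C)
    (l : C) :
  f @ F --> l <-> forall e : R, 0 < e -> \forall x \near F, cabs (l - f x) < e.
Proof.
split=> [/cvgrPdist_lt H e e0|H].
  have := H e%:C; rewrite ltcR => /(_ e0); apply: filterS => x.
  by rewrite normC_cabs ltcR.
apply/cvgrPdist_lt => -[e1 e2]; rewrite ltcE /= => /andP[/eqP -> e0].
by apply: filterS (H _ e0) => x; rewrite normC_cabs ltcR.
Qed.

Lemma continuous_real_complex : continuous (fun x : R => x%:C : C).
Proof.
move=> x; apply/cvg_cabsP => e e0.
have /cvgrPdist_lt/(_ e e0) := @cvg_id _ (nbhs x).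
by apply: filterS => y; rewrite -rmorphB /= cabs_real.
Qed.

Lemma continuous_Re : continuous (@complex.Re R : C -> R).
Proof.
move=> z; apply/(@cvgrPdist_lt _ _ _ (nbhs z) (nbhs_filter z)) => e e0.
have := (cvg_cabsP (nbhs_filter (z : C)) id (z : C)).1 cvg_id e e0.
apply: filterS => w; apply: le_lt_trans.
by rewrite -raddfB; exact: (ler_Re_cabs (z - w)).
Qed.

Lemma continuous_Im : continuous (@complex.Im R : C -> R).
Proof.
move=> z; apply/(@cvgrPdist_lt _ _ _ (nbhs z) (nbhs_filter z)) => e e0.
have := (cvg_cabsP (nbhs_filter (z : C)) id (z : C)).1 cvg_id e e0.
apply: filterS => w; apply: le_lt_trans.
by rewrite -raddfB; exact: (ler_Im_cabs (z - w)).
Qed.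

Lemma continuous_cabs : continuous (@cabs R : C -> R).
Proof.
move=> z; apply/(@cvgrPdist_lt _ _ _ (nbhs z) (nbhs_filter z)) => e e0.
have := (cvg_cabsP (nbhs_filter (z : C)) id (z : C)).1 cvg_id e e0.
by apply: filterS => w; apply: le_lt_trans; exact: cabs_dist.
Qed.

Lemma cvg_cabs (T : Type) (F : set_system T) (FF : Filter F) (f : T -> C) (l : C) :
  f @ F --> l -> cabs (f x) @[x --> F] --> cabs l.
Proof. by move=> fl; exact: (cvg_comp _ _ fl (@continuous_cabs l)). Qed.

End ComplexTopology.

(** Sealed: unfolded, it quantifies over points and over neighborhoods in two
    normed spaces, whereas all uses go through the closure lemmas below. *)
HB.lock Definition continuousC (R : realType) (f : R -> R[i]) : Prop :=
  continuous (f : R -> R[i]^o).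

Section ContinuousC.
Context {R : realType}.
Local Open Scope classical_set_scope.
Local Notation C := (R[i]^o).
Implicit Types f g : R -> R[i].

Lemma continuousCP f : continuousC f <-> continuous (f : R -> C).
Proof. by rewrite continuousC.unlock. Qed.

Lemma continuousC_cst k : continuousC (fun _ : R => k).
Proof. by apply/continuousCP => x; exact: cvg_cst. Qed.

Lemma continuousC_D f g :
  continuousC f -> continuousC g -> continuousC (fun x => f x + g x).
Proof.
move=> /continuousCP cf /continuousCP cg.
by apply/continuousCP => x; exact: (cvgD (cf x) (cg x)).
Qed.

Lemma continuousC_M f g :
  continuousC f -> continuousC g -> continuousC (fun x => f x * g x).
Proof.
move=> /continuousCP cf /continuousCP cg.
by apply/continuousCP => x; exact: (cvgM (cf x) (cg x)).
Qed.

Lemma continuousC_B f g :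
  continuousC f -> continuousC g -> continuousC (fun x => f x - g x).
Proof.
move=> cf cg; under eq_fun do rewrite -mulN1r.
by apply: continuousC_D => //; apply: continuousC_M => //; exact: continuousC_cst.
Qed.

Lemma continuousC_V f : (forall x, f x != 0) ->
  continuousC f -> continuousC (fun x => (f x)^-1).
Proof.
move=> f0 /continuousCP cf.
by apply/continuousCP => x; exact: (cvgV (f0 x) (cf x)).
Qed.

Lemma continuousC_X f n : continuousC f -> continuousC (fun x => f x ^+ n).
Proof.
move=> cf; elim: n => [|n IH]; first exact: continuousC_cst.
by under eq_fun do rewrite exprS; exact: continuousC_M.
Qed.

Lemma continuousC_sum n (f_ : nat -> R -> R[i]) :
  (forall i, continuousC (f_ i)) -> continuousC (fun x => \sum_(i < n) f_ i x).
Proof.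
move=> cf; elim: n => [|n IH].
  by under eq_fun do rewrite big_ord0; exact: continuousC_cst.
by under eq_fun do rewrite big_ord_recr /=; exact: continuousC_D.
Qed.

Lemma continuousC_real (u : R -> R) :
  continuous u -> continuousC (fun x => (u x)%:C).
Proof.
move=> cu; apply/continuousCP => x; apply: continuous_comp (cu x) _.
exact: continuous_real_complex.
Qed.

Lemma continuousC_complex (u v : R -> R) : continuous u -> continuous v ->
  continuousC (fun x => u x +i* v x).
Proof.
move=> /continuousC_real cu /continuousC_real cv.
under eq_fun do rewrite [_ +i* _]complexE /=.
apply: continuousC_D => //.
by apply: continuousC_M => //; exact: continuousC_cst.
Qed.

Lemma continuousC_Re f :
  continuousC f -> continuous (fun x => complex.Re (f x) : R).
Proof.
move=> /continuousCP cf x; apply: continuous_comp (cf x) _; exact: continuous_Re.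
Qed.

Lemma continuousC_Im f :
  continuousC f -> continuous (fun x => complex.Im (f x) : R).
Proof.
move=> /continuousCP cf x; apply: continuous_comp (cf x) _; exact: continuous_Im.
Qed.

Lemma continuousC_cabs f :
  continuousC f -> continuous (fun x => cabs (f x) : R).
Proof.
move=> /continuousCP cf x; apply: continuous_comp (cf x) _; exact: continuous_cabs.
Qed.

End ContinuousC.

(** * Integrals over intervals *)

Section RealIntegral.
Context {R : realType}.
Local Notation mu := (@lebesgue_measure R).
Local Open Scope classical_set_scope.
Implicit Types (f g : R -> R) (a b c : R).

Definition rint f a b : R := \int[mu]_(x in `[a, b]) f x.

Lemma continuous_integrable_itv f a b :
  continuous f -> mu.-integrable `[a, b] (EFin \o f).
Proof.
move=> cf; apply: continuous_compact_integrable; first exact: segment_compact.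
exact: continuous_subspaceT.
Qed.

Lemma rint_cat f a b c : continuous f -> a <= b -> b <= c ->
  rint f a c = rint f a b + rint f b c.
Proof.
move=> cf ab bc.
have := @Rintegral_itvB R f (BLeft a) (BRight c) b.
rewrite !bnd_simp => /(_ (continuous_integrable_itv a c cf) ab bc).
rewrite Rintegral_itv_obnd_cbnd; last first.
  by apply: integrableS (continuous_integrable_itv b c cf) => //;
    apply: subset_itvr; rewrite bnd_simp.
by rewrite /rint => <-; rewrite addrC subrK.
Qed.

Lemma rintD f g a b : continuous f -> continuous g ->
  rint (fun x => f x + g x) a b = rint f a b + rint g a b.
Proof. by move=> cf cg; apply: RintegralD => //; exact: continuous_integrable_itv. Qed.

Lemma rintB f g a b : continuous f -> continuous g ->
  rint (fun x => f x - g x) a b = rint f a b - rint g a b.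
Proof. by move=> cf cg; apply: RintegralB => //; exact: continuous_integrable_itv. Qed.

Lemma rintZ k f a b : continuous f ->
  rint (fun x => k * f x) a b = k * rint f a b.
Proof. by move=> cf; apply: RintegralZl => //; exact: continuous_integrable_itv. Qed.

Lemma rint_bound f a b (M : R) : continuous f -> a <= b ->
  (forall x, a <= x <= b -> `|f x| <= M) -> `|rint f a b| <= M * (b - a).
Proof.
move=> cf ab fM; apply: (le_trans (le_normr_Rintegral _ _)) => //.
  exact: continuous_integrable_itv.
have -> : M * (b - a) = \int[mu]_(x in `[a, b]) M.
  rewrite Rintegral_cst//; congr (_ * _); apply/esym.
  apply: etrans (_ : fine (lebesgue_measure (`[a, b] : set R)) = _) => //.
  rewrite lebesgue_measure_itv /= lte_fin.
  case: ltrP => //= ba; have -> : a = b by apply/eqP; rewrite eq_le ab ba.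
  by rewrite subrr.
apply: le_Rintegral => //.
- apply: continuous_integrable_itv => x; apply: continuous_comp (cf x) _.
  exact: norm_continuous.
- by apply: continuous_integrable_itv => x; exact: cst_continuous.
Qed.

Lemma rint_derive (F f : R -> R) a b : a < b -> continuous f ->
  (forall x : R, is_derive x 1 F (f x)) -> rint f a b = F b - F a.
Proof.
move=> ab cf dF; rewrite /rint /Rintegral (@continuous_FTC2 _ f F a b)//.
- exact: continuous_subspaceT.
- have cF x : {for x, continuous F}.
    by apply: differentiable_continuous; apply/derivable1_diffP; exact: ex_derive.
  split.
  + by move=> x _; exact: ex_derive.
  + by apply: cvg_at_right_filter; exact: cF.
  + by apply: cvg_at_left_filter; exact: cF.
- by move=> x _; rewrite derive1E; exact: derive_val.
Qed.

End RealIntegral.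

HB.lock Definition cint (R : realType) (f : R -> R[i]) (a b : R) : R[i] :=
  rint (fun x => complex.Re (f x)) a b +i* rint (fun x => complex.Im (f x)) a b.

Section ComplexIntegral.
Context {R : realType}.
Local Open Scope classical_set_scope.
Implicit Types (f g : R -> R[i]) (a b c : R).

Lemma cint_cat f a b c : continuousC f -> a <= b -> b <= c ->
  cint f a c = cint f a b + cint f b c.
Proof.
move=> cf ab bc; rewrite cint.unlock (rint_cat (continuousC_Re cf) ab bc).
by rewrite (rint_cat (continuousC_Im cf) ab bc).
Qed.

Lemma eq_cint f g a b : f =1 g -> cint f a b = cint g a b.
Proof. by move=> /funext ->. Qed.

Lemma cintD f g a b : continuousC f -> continuousC g ->
  cint (fun x => f x + g x) a b = cint f a b + cint g a b.
Proof.
move=> cf cg; rewrite cint.unlock.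
under eq_fun do rewrite raddfD; under [X in _ +i* rint X _ _]eq_fun do rewrite raddfD.
rewrite (rintD a b (continuousC_Re cf) (continuousC_Re cg)).
by rewrite (rintD a b (continuousC_Im cf) (continuousC_Im cg)).
Qed.

Lemma cintZ (k : R[i]) f a b : continuousC f ->
  cint (fun x => k * f x) a b = k * cint f a b.
Proof.
move=> cf; have cR := continuousC_Re cf; have cI := continuousC_Im cf.
case: k => p q; rewrite cint.unlock.
have E x : (p +i* q) * f x =
  (p * complex.Re (f x) - q * complex.Im (f x)) +i*
  (p * complex.Im (f x) + q * complex.Re (f x)).
  by case: (f x).
under eq_fun do rewrite E /=; under [X in _ +i* rint X _ _]eq_fun do rewrite E /=.
have cZ (t : R) (u : R -> R) : continuous u -> continuous (fun x => t * u x).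
  by move=> cu x; apply: continuousM (cu x); exact: cst_continuous.
rewrite rintB ?rintD ?rintZ//; try exact: cZ.
Qed.

Lemma cintB f g a b : continuousC f -> continuousC g ->
  cint (fun x => f x - g x) a b = cint f a b - cint g a b.
Proof.
move=> cf cg; rewrite -[- cint g a b]mulN1r -(cintZ _ _ _ cg) -cintD//.
  by apply: eq_cint => x; rewrite mulN1r.
by apply: continuousC_M => //; exact: continuousC_cst.
Qed.

Lemma cint_sum (f_ : nat -> R -> R[i]) n a b : (forall i, continuousC (f_ i)) ->
  cint (fun x => \sum_(i < n) f_ i x) a b = \sum_(i < n) cint (f_ i) a b.
Proof.
move=> cf; elim: n => [|n IH].
  rewrite big_ord0 (_ : (fun x => _) = fun x => 0 * (f_ 0%N x)); last first.
    by apply/funext => x; rewrite big_ord0 mul0r.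
  by rewrite cintZ// mul0r.
rewrite big_ord_recr /= -IH -cintD//.
  by apply: eq_cint => x; rewrite big_ord_recr.
exact: continuousC_sum.
Qed.

(** The factor 2 comes from bounding the real and imaginary parts separately. *)
Lemma cint_bound f a b (M : R) : continuousC f -> a <= b ->
  (forall x, a <= x <= b -> cabs (f x) <= M) ->
  cabs (cint f a b) <= M * (b - a) * 2.
Proof.
move=> cf ab fM; apply: (le_trans (ler_cabs_ReIm _)); rewrite cint.unlock /=.
rewrite mulr_natr mulr2n lerD//; apply: rint_bound => //.
- exact: continuousC_Re.
- by move=> x /fM; apply: le_trans; exact: ler_Re_cabs.
- exact: continuousC_Im.
- by move=> x /fM; apply: le_trans; exact: ler_Im_cabs.
Qed.

Lemma cint_derive (F f : R -> R[i]) a b : a < b -> continuousC f ->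
  (forall x : R, is_derive x 1 (fun x => complex.Re (F x)) (complex.Re (f x))) ->
  (forall x : R, is_derive x 1 (fun x => complex.Im (F x)) (complex.Im (f x))) ->
  cint f a b = F b - F a.
Proof.
move=> ab cf dR dI; rewrite cint.unlock.
rewrite (rint_derive ab (continuousC_Re cf) dR).
rewrite (rint_derive ab (continuousC_Im cf) dI).
by case: (F b) (F a) => ? ? [].
Qed.

End ComplexIntegral.

(** * Bisection of squares *)

Section Bisection.
Context {R : realType}.
Variable K : R -> R -> R -> R.
Hypothesis Ksplit : forall x y l, 0 < l ->
  K x y l = K x y (l / 2) + K (x + l / 2) y (l / 2)
          + K x (y + l / 2) (l / 2) + K (x + l / 2) (y + l / 2) (l / 2).
Hypothesis Ksmall : forall p q e, 0 < e -> exists2 d, 0 < d &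
  forall x y l, 0 < l < d -> x <= p <= x + l -> y <= q <= y + l ->
    `|K x y l| <= e * l ^+ 2.

(** If [K 0 0 1] were not zero, one of the four quarters would carry at least a
    quarter of its absolute value, and so on; the nested squares shrink to a
    point [(p, q)] at which the bound [Ksmall], with half the initial ratio of
    value to area, is violated. *)
Lemma bisection_eq0 : K 0 0 1 = 0.
Proof.
apply/eqP; apply/negPn/negP; rewrite -normr_gt0; set e0 := `|_| => e0_gt0.
(* [e0] is the initial ratio of value to area, which every retained quarter
   keeps. *)
pose big x y l := e0 * l ^+ 2 <= `|K x y l|.
pose next (p : R * R * R) : R * R * R :=
  let: (x, y, l) := p in
  if big x y (l / 2) then (x, y, l / 2)
  else if big (x + l / 2) y (l / 2) then (x + l / 2, y, l / 2)
  else if big x (y + l / 2) (l / 2) then (x, y + l / 2, l / 2)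
  else (x + l / 2, y + l / 2, l / 2).
pose s n := iter n next (0, 0, 1).
have nextP x y l : 0 < l -> big x y l ->
    let: (x', y', l') := next (x, y, l) in
    [/\ l' = l / 2, x <= x' & x' + l' <= x + l] /\
    [/\ y <= y', y' + l' <= y + l & big x' y' l'].
  move=> l0 B; rewrite /next.
  do ! case: ifPn => ?; do ! split => //; rewrite ?lerDl; try lra.
  rewrite /big leNgt; apply/negP => B4; move: B; rewrite /big Ksplit//.
  rewrite leNgt => /negP; apply.
  apply: le_lt_trans (ler_normD _ _) _.
  apply: le_lt_trans (lerD (ler_normD _ _) (lexx _)) _.
  apply: le_lt_trans (lerD (lerD (ler_normD _ _) (lexx _)) (lexx _)) _.
  rewrite (_ : e0 * l ^+ 2 = e0 * (l / 2) ^+ 2 + e0 * (l / 2) ^+ 2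
    + e0 * (l / 2) ^+ 2 + e0 * (l / 2) ^+ 2); last by field.
  by do ! apply: ltrD => //; rewrite ltNge.
have sP n : [/\ (s n).2 = 2^-1 ^+ n, 0 < (s n).2 & big (s n).1.1 (s n).1.2 (s n).2].
  elim: n => [|n [E l0 B]]; first by split => //; rewrite /big expr1n mulr1.
  have := nextP _ _ _ l0 B; rewrite /s iterS -/(s n).
  rewrite -surjective_pairing -surjective_pairing.
  case: (next (s n)) => -[x y] l [[-> _ _] [_ _ B']] /=; split => //.
    by rewrite E exprSr.
  by rewrite divr_gt0.
have mono n m : (n <= m)%N ->
   [/\ (s n).1.1 <= (s m).1.1, (s m).1.1 + (s m).2 <= (s n).1.1 + (s n).2,
    (s n).1.2 <= (s m).1.2 & (s m).1.2 + (s m).2 <= (s n).1.2 + (s n).2].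
  elim: m => [|m IH]; first by rewrite leqn0 => /eqP ->.
  rewrite leq_eqVlt => /orP[/eqP <- //|]; rewrite ltnS => /IH[a b c d].
  have [_ l0 B] := sP m.
  have := nextP _ _ _ l0 B.
  rewrite -surjective_pairing -surjective_pairing -[next (s m)]/(s m.+1).
  case: (s m.+1) => -[x y] l [[_ A' B'] [C' D' _]] /=; split.
  - exact: le_trans A'.
  - exact: le_trans b.
  - exact: le_trans C'.
  - exact: le_trans d.
have pinch (u : nat -> R) : (forall n m, (n <= m)%N -> u n <= u m) ->
    (forall n m, (n <= m)%N -> u m + (s m).2 <= u n + (s n).2) ->
    exists p, forall n, u n <= p <= u n + (s n).2.
  move=> up dn; exists (sup [set u n | n in setT]).
  move=> n; apply/andP; split.
    apply: sup_upper_bound; last by exists n.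
    split; first by exists (u 0%N), 0%N.
    exists (u 0%N + (s 0%N).2) => _ [m _ <-].
    by apply: le_trans (dn _ _ (leq0n m)); rewrite lerDl; case: (sP m) => _ /ltW.
  apply: sup_le_ub; first by exists (u 0%N), 0%N.
  move=> _ [m _ <-]; have [nm|/ltnW mn] := leqP n m.
    by apply: le_trans (dn _ _ nm); rewrite lerDl; case: (sP m) => _ /ltW.
  by apply: le_trans (up _ _ mn) _; rewrite lerDl; case: (sP n) => _ /ltW.
have [p pP] := pinch (fun n => (s n).1.1) (fun n m nm => let: And4 a _ _ _ := mono n m nm in a)
  (fun n m nm => let: And4 _ a _ _ := mono n m nm in a).
have [q qP] := pinch (fun n => (s n).1.2) (fun n m nm => let: And4 _ _ a _ := mono n m nm in a)
  (fun n m nm => let: And4 _ _ _ a := mono n m nm in a).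
have [d d0 dP] := Ksmall p q (divr_gt0 e0_gt0 (ltr0n R 2)).
have [n ln] : exists n, (s n).2 < d.
  have /cvgrPdist_lt/(_ d d0)[n _ /(_ n (leqnn n))] :=
    @cvg_expr R 2^-1 (ltac:(rewrite ger0_norm; lra)).
  rewrite sub0r normrN /= => H; exists n; case: (sP n) => -> _ _.
  by apply: le_lt_trans H; exact: ler_norm.
have [_ l0 B] := sP n.
have := dP _ _ _ _ (pP n) (qP n); rewrite l0 ln => /(_ isT) /(le_trans B).
rewrite ler_pM2r ?exprn_gt0//; lra.
Qed.

End Bisection.

(** * Goursat's theorem for a contracting curve *)

Section ClosedForm.
Context {R : realType}.
Local Open Scope classical_set_scope.

(** Complex differentiability with derivative [D], with the modulus and real
    tolerances, so that it can be used in estimates of integrals. *)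
Definition cdifferentiable_at (g : R[i] -> R[i]) (w D : R[i]) : Prop :=
  forall e : R, 0 < e -> exists2 d, 0 < d & forall w', cabs (w' - w) < d ->
    cabs (g w' - g w - D * (w' - w)) <= e * cabs (w' - w).

Lemma cdifferentiable_comp_continuousC (g : R[i] -> R[i]) (u : R -> R[i]) :
  (forall t, exists D, cdifferentiable_at g (u t) D) -> continuousC u ->
  continuousC (fun t => g (u t)).
Proof.
move=> gd /continuousCP cu; apply/continuousCP => t.
suff cg : {for u t, continuous (g : R[i]^o -> R[i]^o)}.
  exact: (continuous_comp (cu t) cg).
have [D Dw] := gd t; move: Dw; set w := u t => Dw.
apply/(cvg_cabsP (nbhs_filter (w : R[i]^o))) => e e0.
have [d d0 dP] := Dw 1 ltr01.
pose M := 1 + cabs D.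
have M0 : 0 < M by rewrite ltr_wpDr ?cabs_ge0.
have m0 : 0 < Num.min d (e / M) by rewrite lt_min d0 divr_gt0.
have := (cvg_cabsP (nbhs_filter (w : R[i]^o)) id (w : R[i]^o)).1 cvg_id _ m0.
apply: filterS => w'; rewrite cabs_distC lt_min => /andP[wd we].
rewrite cabs_distC -(subrK (D * (w' - w)) (g w' - g w)).
apply: le_lt_trans (cabsD _ _) _.
apply: le_lt_trans (lerD (dP _ wd) (lexx _)) _.
by rewrite cabsM -mulrDl mulrC -ltr_pdivlMr.
Qed.

(** The integral of the form [h ds + h kappa dt] along the boundary of the
    rectangle with lower left corner [(s, t)] and sides [u], [v]. *)
Definition boundary_int (kappa : R -> R[i]) (h : R -> R -> R[i]) (s t u v : R) : R[i] :=
  cint (h^~ t) s (s + u) - cint (h^~ (t + v)) s (s + u)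
  + cint (fun y => h (s + u) y * kappa y) t (t + v)
  - cint (fun y => h s y * kappa y) t (t + v).

Section BoundaryInt.
Variable kappa : R -> R[i].
Hypothesis ckappa : continuousC kappa.

(** Integrals are only taken along the sides of rectangles, so that continuity
    in each variable is enough. *)
Definition sep_continuous (h : R -> R -> R[i]) :=
  (forall t, continuousC (h^~ t)) /\ (forall s, continuousC (h s)).

Lemma boundary_int_split (h : R -> R -> R[i]) s t u v :
  sep_continuous h -> 0 <= u -> 0 <= v ->
  boundary_int kappa h s t (u + u) (v + v) =
  boundary_int kappa h s t u v + boundary_int kappa h (s + u) t u v
  + boundary_int kappa h s (t + v) u v
  + boundary_int kappa h (s + u) (t + v) u v.
Proof.
move=> [c1 c2] u0 v0; rewrite /boundary_int !addrA.
have A y : cint (h^~ y) s (s + u + u) =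
    cint (h^~ y) s (s + u) + cint (h^~ y) (s + u) (s + u + u).
  by apply: cint_cat; [exact: c1|rewrite lerDl|rewrite lerDl].
have B x : cint (fun y => h x y * kappa y) t (t + v + v) =
    cint (fun y => h x y * kappa y) t (t + v) +
    cint (fun y => h x y * kappa y) (t + v) (t + v + v).
  apply: cint_cat; [|by rewrite lerDl|by rewrite lerDl].
  apply: continuousC_M; [exact: c2|exact: ckappa].
rewrite !A !B; ring.
Qed.

Lemma boundary_intD h1 h2 s t u v : sep_continuous h1 -> sep_continuous h2 ->
  boundary_int kappa (fun x y => h1 x y + h2 x y) s t u v =
  boundary_int kappa h1 s t u v + boundary_int kappa h2 s t u v.
Proof.
move=> [a1 b1] [a2 b2]; rewrite /boundary_int !cintD//.
have E x : cint (fun y => (h1 x y + h2 x y) * kappa y) t (t + v) =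
    cint (fun y => h1 x y * kappa y) t (t + v) +
    cint (fun y => h2 x y * kappa y) t (t + v).
  rewrite -cintD; try exact: continuousC_M.
  by apply: eq_cint => y; rewrite mulrDl.
rewrite !E; ring.
Qed.

Lemma boundary_intZ k h s t u v : sep_continuous h ->
  boundary_int kappa (fun x y => k * h x y) s t u v =
  k * boundary_int kappa h s t u v.
Proof.
move=> [a1 b1]; rewrite /boundary_int !cintZ//.
have E x : cint (fun y => k * h x y * kappa y) t (t + v) =
    k * cint (fun y => h x y * kappa y) t (t + v).
  rewrite -cintZ; last exact: continuousC_M.
  by apply: eq_cint => y; rewrite mulrA.
rewrite !E; ring.
Qed.

Lemma boundary_int_cst s t u v : boundary_int kappa (fun _ _ => 1) s t u v = 0.
Proof. by rewrite /boundary_int subrr add0r subrr. Qed.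

Lemma boundary_int_bound h s t u v (B M : R) : sep_continuous h ->
  0 <= u -> 0 <= v -> 0 <= B -> (forall y, cabs (kappa y) <= B) ->
  (forall x y, s <= x <= s + u -> t <= y <= t + v -> cabs (h x y) <= M) ->
  cabs (boundary_int kappa h s t u v) <= 4 * M * (u + B * v).
Proof.
move=> [a1 b1] u0 v0 B0 kB hM; rewrite /boundary_int.
have su : s <= s <= s + u by rewrite lexx lerDl.
have su' : s <= s + u <= s + u by rewrite lexx lerDl u0.
have tv : t <= t <= t + v by rewrite lexx lerDl.
have tv' : t <= t + v <= t + v by rewrite lexx lerDl v0.
have ub y : t <= y <= t + v -> cabs (cint (h^~ y) s (s + u)) <= M * u * 2.
  move=> ty; apply: le_trans (cint_bound (M := M) _ _ _) _ => //.
  - by rewrite lerDl.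
  - by move=> x sx; exact: hM.
  - by rewrite [s + u]addrC addrK.
have vb x : s <= x <= s + u ->
    cabs (cint (fun y => h x y * kappa y) t (t + v)) <= M * B * v * 2.
  move=> sx; apply: le_trans (cint_bound (M := M * B) _ _ _) _ => //.
  - exact: continuousC_M.
  - by rewrite lerDl.
  - move=> y ty; rewrite cabsM; apply: ler_pM; rewrite ?cabs_ge0//.
    exact: hM.
  - by rewrite [t + v]addrC addrK.
apply: le_trans (cabsB _ _) _.
apply: le_trans (lerD (cabsD _ _) (lexx _)) _.
apply: le_trans (lerD (lerD (cabsB _ _) (lexx _)) (lexx _)) _.
have := ub _ tv; have := ub _ tv'; have := vb _ su; have := vb _ su'.
lra.
Qed.

End BoundaryInt.

Lemma sep_continuous_mul h1 h2 : sep_continuous h1 -> sep_continuous h2 ->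
  sep_continuous (fun x y => h1 x y * h2 x y).
Proof. by move=> [a b] [c d]; split => ?; apply: continuousC_M. Qed.

Lemma sep_continuous_add h1 h2 : sep_continuous h1 -> sep_continuous h2 ->
  sep_continuous (fun x y => h1 x y + h2 x y).
Proof. by move=> [a b] [c d]; split => ?; apply: continuousC_D. Qed.

Lemma sep_continuous_cst k : sep_continuous (fun _ _ => k).
Proof. by split => ?; apply: continuousC_cst. Qed.

End ClosedForm.

(** The form [g w / (w - a) dw] is pulled back by the map
    [W s t = a + e^s * zeta t], which deforms the curve [a + zeta] to the point
    [a] as [s] tends to [-oo]. It becomes [G ds + G kappa dt] with [G = g \o W],
    which Goursat's argument shows to be closed where [g] is
    differentiable. *)
Section Goursat.
Context {R : realType}.
Local Open Scope classical_set_scope.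
Variables (a : R[i]) (g : R[i] -> R[i]).
Hypothesis gdiff : forall w, w != a -> exists D, cdifferentiable_at g w D.
Variables (zeta zeta' : R -> R[i]) (L B : R).
Hypothesis zeta0 : forall t, zeta t != 0.
Hypothesis dRe : forall t : R,
  is_derive t 1 (fun t => complex.Re (zeta t)) (complex.Re (zeta' t)).
Hypothesis dIm : forall t : R,
  is_derive t 1 (fun t => complex.Im (zeta t)) (complex.Im (zeta' t)).
Hypothesis czeta : continuousC zeta.
Hypothesis czeta' : continuousC zeta'.
Hypothesis zeta_bound : forall t, cabs (zeta t) <= L.
Hypothesis zeta_lip : forall t t', cabs (zeta t - zeta t') <= L * `|t - t'|.
Let kappa t : R[i] := zeta' t / zeta t.
Hypothesis kappa_bound : forall t, cabs (kappa t) <= B.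

Let W s t : R[i] := a + (expR s)%:C * zeta t.
Let G s t : R[i] := g (W s t).

Let L0 : 0 <= L. Proof. exact: le_trans (cabs_ge0 _) (zeta_bound 0). Qed.
Let B0 : 0 <= B. Proof. exact: le_trans (cabs_ge0 _) (kappa_bound 0). Qed.

Let ckappa : continuousC (kappa : R -> R[i]).
Proof. exact: (continuousC_M czeta' (continuousC_V zeta0 czeta)). Qed.

Let cexp : continuousC (fun s : R => (expR s)%:C).
Proof. by apply: continuousC_real; exact: continuous_expR. Qed.

Let cW : sep_continuous W.
Proof.
apply: sep_continuous_add; first exact: sep_continuous_cst.
by apply: sep_continuous_mul; split => s;
  [exact: cexp|exact: continuousC_cst|exact: continuousC_cst|exact: czeta].
Qed.

Let W_neq s t : W s t != a.
Proof.
rewrite /W -subr_eq0 addrC addKr mulf_neq0// eq_complex /= negb_and.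
by rewrite gt_eqF// expR_gt0.
Qed.

Let cG : sep_continuous G.
Proof.
have [c1 c2] := cW; split.
  by move=> t; apply: cdifferentiable_comp_continuousC (c1 t) => s; exact: gdiff.
by move=> s; apply: cdifferentiable_comp_continuousC (c2 s) => t; exact: gdiff.
Qed.

(** The form is exact here: its primitive is [e^s * zeta t]. *)
Lemma boundary_int_exact s t u v : 0 < u -> 0 < v ->
  boundary_int kappa (fun x y => (expR x)%:C * zeta y) s t u v = 0.
Proof.
move=> u0 v0; rewrite /boundary_int.
have E y : cint (fun x => (expR x)%:C * zeta y) s (s + u) =
    ((expR (s + u))%:C - (expR s)%:C) * zeta y.
  under eq_cint do rewrite mulrC.
  rewrite cintZ// mulrC; congr (_ * _).
  apply: (@cint_derive R (fun x => (expR x)%:C)) => //.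
  - by rewrite ltrDl.
  - by move=> x /=; exact: is_derive_cst.
have F x : cint (fun y => (expR x)%:C * zeta y * kappa y) t (t + v) =
    (expR x)%:C * (zeta (t + v) - zeta t).
  rewrite (@eq_cint _ _ (fun y => (expR x)%:C * zeta' y)); last first.
    by move=> y; rewrite -mulrA /kappa [zeta y * _]mulrC divfK.
  by rewrite cintZ//; congr (_ * _); apply: cint_derive => //; rewrite ltrDl.
rewrite !E !F; ring.
Qed.

Let expR_lip (M x y : R) : x <= M -> y <= M ->
  `|expR x - expR y| <= expR M * `|x - y|.
Proof.
wlog xy : x y / y <= x.
  move=> H xM yM; have [|/ltW] := leP y x; first by move=> /H; apply.
  by rewrite distrC [`|x - y|]distrC => /H; apply.
move=> xM yM; rewrite !ger0_norm ?subr_ge0 ?ler_expR//.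
apply: (@le_trans _ _ (expR x * (x - y))); last first.
  by rewrite ler_wpM2r ?subr_ge0// ler_expR.
have := expR_ge1Dx (y - x).
rewrite -(ler_pM2l (expR_gt0 x)) -expRD [x + _]addrC subrK; lra.
Qed.

(** To first order at [(p, q)], [G] is a constant plus a multiple of
    [e^s * zeta t], and the boundary integrals of both vanish. What is left is
    the remainder of the derivative, which is [o(l)] on a boundary of length
    [O(l)]. *)
Lemma goursat_small p q U V e : 0 < U -> 0 < V -> 0 < e ->
  exists2 d, 0 < d & forall x y l, 0 < l < d ->
    x <= p <= x + U * l -> y <= q <= y + V * l ->
    cabs (boundary_int kappa G x y (U * l) (V * l)) <= e * l ^+ 2.
Proof.
move=> U0 V0 e0; have [D DP] := gdiff (W_neq p q).
pose E := expR (p + U).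
have E0 : 0 < E by exact: expR_gt0.
pose M := 1 + E * L * (U + V).
have M0 : 0 < M by rewrite ltr_pwDl// mulr_ge0 ?addr_ge0 ?mulr_ge0 ?(ltW E0) ?(ltW U0) ?(ltW V0).
pose N := 4 * M * (U + B * V).
have N0 : 0 < N by rewrite mulr_gt0 ?mulr_gt0// ltr_pwDl// mulr_ge0 ?(ltW V0).
have [d d0 dP] := DP (e / N) (divr_gt0 e0 N0).
exists (Num.min 1 (d / M)); first by rewrite lt_min ltr01 divr_gt0.
move=> x y l /andP[l0]; rewrite lt_min => /andP[l1 ld] xp yq.
pose A := G p q - D * W p q + D * a.
pose h1 (x y : R) : R[i] := A * 1.
pose h2 (x y : R) : R[i] := D * ((expR x)%:C * zeta y).
pose rho (x y : R) : R[i] := G x y - G p q - D * (W x y - W p q).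
have GE : G = (fun x y => (h1 x y + h2 x y) + rho x y).
  apply/funext => s; apply/funext => t.
  rewrite /rho /h1 /h2 /A (_ : W s t = a + (expR s)%:C * zeta t)//.
  by rewrite -[W p q]/(W p q); ring.
have ce : sep_continuous (fun x y => (expR x)%:C * zeta y).
  by apply: sep_continuous_mul; split => s;
  [exact: cexp|exact: continuousC_cst|exact: continuousC_cst|exact: czeta].
have c1 : sep_continuous h1 by exact: sep_continuous_cst.
have c2 : sep_continuous h2.
  by apply: sep_continuous_mul ce; exact: sep_continuous_cst.
have c3 : sep_continuous rho.
  apply: sep_continuous_add; first by apply: sep_continuous_add => //; exact: sep_continuous_cst.
  rewrite (_ : (fun x y => _) = (fun x y => - D * (W x y + - W p q))); last first.
    by apply/funext => s; apply/funext => t; rewrite mulNr.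
  apply: sep_continuous_mul; first exact: sep_continuous_cst.
  by apply: sep_continuous_add => //; exact: sep_continuous_cst.
rewrite GE (boundary_intD ckappa)//; last exact: sep_continuous_add.
rewrite (boundary_intD ckappa)// (boundary_intZ ckappa); last exact: sep_continuous_cst.
rewrite boundary_int_cst (boundary_intZ ckappa)// boundary_int_exact ?mulr_gt0//.
rewrite !mulr0 addr0 add0r.
apply: le_trans (boundary_int_bound ckappa (B := B) (M := e / N * (M * l)) _ _ _ _ _ _) _ => //.
- by rewrite mulr_ge0// ltW.
- by rewrite mulr_ge0// ltW.
- move=> s t xs yt.
  have lU : U * l <= U by rewrite ler_piMr// ltW.
  have ds : `|s - p| <= U * l by rewrite ler_norml; lra.
  have dt : `|t - q| <= V * l by rewrite ler_norml; lra.
  have WM : cabs (W s t - W p q) <= M * l.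
    rewrite /W [a + _]addrC addrKA.
    rewrite (_ : _ - _ = ((expR s)%:C - (expR p)%:C) * zeta t +
      (expR p)%:C * (zeta t - zeta q)); last by ring.
    apply: le_trans (cabsD _ _) _; rewrite !cabsM -rmorphB /= !cabs_real.
    rewrite (ger0_norm (expR_ge0 p)).
    have H1 : `|expR s - expR p| * cabs (zeta t) <= E * (U * l) * L.
      apply: ler_pM => //; rewrite ?cabs_ge0//.
      have := @expR_lip (p + U) s p; move=> H; apply: le_trans (H _ _) _.
      - lra.
      - lra.
      - by rewrite ler_wpM2l// ltW.
    have H2 : expR p * cabs (zeta t - zeta q) <= E * (L * (V * l)).
      apply: ler_pM => //; rewrite ?expR_ge0 ?cabs_ge0//.
        by rewrite ler_expR lerDl ltW.
      by apply: le_trans (zeta_lip _ _) _; rewrite ler_wpM2l.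
    apply: le_trans (lerD H1 H2) _; rewrite /M.
    rewrite (_ : E * (U * l) * L + E * (L * (V * l)) = E * L * (U + V) * l); last by ring.
    by rewrite mulrDl mul1r lerDr ltW.
  apply: le_trans (dP _ _) _.
    by apply: le_lt_trans WM _; rewrite mulrC -ltr_pdivlMr.
  by rewrite ler_wpM2l// divr_ge0 ?ltW.
- rewrite le_eqVlt; apply/orP; left; apply/eqP.
  have N0' : N != 0 by rewrite gt_eqF.
  rewrite (_ : 4 * _ * _ = e * l ^+ 2 * (N / N)); first by rewrite divff// mulr1.
  by rewrite /N; ring.
Qed.

(** Bisection is applied to the real and to the imaginary part, after scaling
    the rectangle to the unit square. *)
Lemma goursat s t u v : 0 < u -> 0 < v -> boundary_int kappa G s t u v = 0.
Proof.
move=> u0 v0.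
pose K (c : R[i] -> R) x y l :=
  c (boundary_int kappa G (s + u * x) (t + v * y) (u * l) (v * l)).
have KE (c : R[i] -> R) : (forall z w, c (z + w) = c z + c w) ->
    (forall z, `|c z| <= cabs z) -> c (boundary_int kappa G s t u v) = 0.
  move=> cD cb; have := @bisection_eq0 R (K c); rewrite /K !mulr0 !mulr1 !addr0.
  apply.
  - move=> x y l l0.
    have Ell w : w * l = w * (l / 2) + w * (l / 2) by field.
    rewrite Ell [v * l]Ell boundary_int_split ?mulr_ge0 ?divr_ge0 ?ltW//.
    by rewrite !cD !mulrDr !addrA.
  - move=> p q e e0.
    have [d d0 dP] := goursat_small (s + u * p) (t + v * q) u0 v0 e0.
    exists d => // x y l ld /andP[xp px] /andP[yq qy].
    apply: le_trans (cb _) _; apply: dP => //.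
    + by rewrite -addrA -mulrDr !lerD2l !ler_pM2l ?xp.
    + by rewrite -addrA -mulrDr !lerD2l !ler_pM2l ?yq.
apply/eqP; rewrite eq_complex /=; apply/andP; split; apply/eqP; apply: KE.
- by move=> z w; rewrite raddfD.
- exact: ler_Re_cabs.
- by move=> z w; rewrite raddfD.
- exact: ler_Im_cabs.
Qed.

(** The two horizontal sides cancel because the curve is closed. *)
Lemma closed_curve_int_const (t0 t1 s0 s1 : R) : t0 < t1 -> zeta t0 = zeta t1 ->
  cint (fun t => G s0 t * kappa t) t0 t1 =
  cint (fun t => G s1 t * kappa t) t0 t1.
Proof.
move=> t01 per; wlog s01 : s0 s1 / s0 < s1.
  by move=> H; have [/H//|/H//|->//] := ltgtP s0 s1.
have := @goursat s0 t0 (s1 - s0) (t1 - t0); rewrite !subr_gt0 => /(_ s01 t01).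
rewrite /boundary_int ![_ + (_ - _)]addrC !subrK.
have -> : cint (G^~ t1) s0 s1 = cint (G^~ t0) s0 s1.
  by apply: eq_cint => x; rewrite /G /W per.
by rewrite subrr add0r => /eqP; rewrite subr_eq0 => /eqP.
Qed.

End Goursat.

(** * Cauchy's formula by homotheties of a circle *)

Section Circle.
Context {R : realType}.
Implicit Types (r t s : R) (a : R[i]).

Lemma cpolarE r t : cpolar r t = r%:C * cpolar 1 t.
Proof. by rewrite /cpolar !mul1r; apply/eqP; rewrite eq_complex /= !mul0r subr0 addr0 !eqxx. Qed.

Lemma cabs_cpolar r t : 0 <= r -> cabs (cpolar r t) = r.
Proof.
move=> r0; rewrite cabsE /= !exprMn -mulrDr cos2Dsin2 mulr1 sqrtr_sqr.
exact: ger0_norm.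
Qed.

Lemma continuousC_cpolar r : continuousC (cpolar r).
Proof.
by apply: continuousC_complex => t; apply: continuousM; try exact: cst_continuous;
  [exact: continuous_cos|exact: continuous_sin].
Qed.

Lemma is_derive_Re_cpolar r a t : is_derive t 1
  (fun t => complex.Re (cpolar r t - a)) (complex.Re ('i%C * cpolar r t)).
Proof.
case: a => x y /=; rewrite mul0r mul1r sub0r.
have H1 : is_derive t 1 (fun t : R => r * cos t - x) (r *: (- sin t) - 0).
  by apply: is_deriveB.
by rewrite subr0 scalerN in H1.
Qed.

Lemma is_derive_Im_cpolar r a t : is_derive t 1
  (fun t => complex.Im (cpolar r t - a)) (complex.Im ('i%C * cpolar r t)).
Proof.
case: a => x y /=; rewrite mul0r mul1r add0r.
have H1 : is_derive t 1 (fun t : R => r * sin t - y) (r *: cos t - 0).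
  by apply: is_deriveB.
by rewrite subr0 in H1.
Qed.

Lemma cpolar_lip r t t' : 0 <= r ->
  cabs (cpolar r t - cpolar r t') <= r * 2 * `|t - t'|.
Proof.
move=> r0; wlog tt : t t' / t' <= t.
  move=> H; have [|/ltW] := leP t' t; first exact: H.
  by rewrite cabs_distC distrC; exact: H.
move: tt; rewrite le_eqVlt => /predU1P[->|tt]; first by rewrite !subrr cabs0 normr0 mulr0.
have cd : continuousC (fun t => 'i%C * cpolar r t).
  by apply: continuousC_M; [exact: continuousC_cst|exact: continuousC_cpolar].
have := @cint_derive R (fun t => cpolar r t - 0) _ t' t tt cd
  (is_derive_Re_cpolar r 0) (is_derive_Im_cpolar r 0).
rewrite !subr0 => <-.
apply: le_trans (cint_bound (M := r) cd (ltW tt) _) _.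
  move=> x _; rewrite cabsM cabs_cpolar// cabsE /= expr0n expr1n add0r sqrtr1.
  by rewrite mul1r.
by rewrite ger0_norm ?subr_ge0 ?(ltW tt)// mulrAC.
Qed.

(** The integral of [g w / (w - a) dw] along the image of the circle of radius
    [r] around 0 under the homothety of center [a] and ratio [e^s]; in this
    parametrization the factor [dw / (w - a)] does not depend on [s]. *)
Definition homothetic_cint (g : R[i] -> R[i]) a r s : R[i] :=
  cint (fun t => g (a + (expR s)%:C * (cpolar r t - a)) *
                 ('i%C * cpolar r t / (cpolar r t - a))) 0 (pi *+ 2).

Lemma circle_kernel_bound a r t : cabs a < r ->
  cabs ('i%C * cpolar r t / (cpolar r t - a)) <= r / (r - cabs a).
Proof.
move=> ar; have r0 : 0 <= r by apply: le_trans (ltW ar); exact: cabs_ge0.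
rewrite !cabsM cabsV cabs_cpolar// [cabs 'i%C]cabsE /= expr0n expr1n add0r sqrtr1 mul1r.
rewrite ler_wpM2l// lef_pV2 ?posrE ?subr_gt0//.
  by rewrite lerBlDr -{1}(cabs_cpolar t r0) -{1}(subrK a (cpolar r t)) cabsD.
rewrite cabs_gt0 subr_eq0; apply/eqP => E.
by move: ar; rewrite -E cabs_cpolar// ltxx.
Qed.

Lemma cpolar_neq a r t : cabs a < r -> cpolar r t - a != 0.
Proof.
move=> ar; rewrite subr_eq0; apply/eqP => E; move: (ar); rewrite -E cabs_cpolar ?ltxx//.
by apply: le_trans (ltW ar); exact: cabs_ge0.
Qed.

Lemma homothetic_cint_const (g : R[i] -> R[i]) a r s s' : cabs a < r ->
  (forall w, w != a -> exists D, cdifferentiable_at g w D) ->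
  homothetic_cint g a r s = homothetic_cint g a r s'.
Proof.
move=> ar gd; have r0 : 0 <= r by apply: le_trans (ltW ar); exact: cabs_ge0.
apply: (@closed_curve_int_const R a g gd (fun t => cpolar r t - a)
  (fun t => 'i%C * cpolar r t) (r * 2 + cabs a) (r / (r - cabs a))).
- by move=> t; exact: cpolar_neq.
- by move=> t; exact: is_derive_Re_cpolar.
- by move=> t; exact: is_derive_Im_cpolar.
- by apply: continuousC_B; [exact: continuousC_cpolar|exact: continuousC_cst].
- by apply: continuousC_M; [exact: continuousC_cst|exact: continuousC_cpolar].
- move=> t; apply: le_trans (cabsB _ _) _; rewrite lerD2r cabs_cpolar//; lra.
- move=> t t'; rewrite opprB addrA subrK.
  apply: le_trans (cpolar_lip _ _ r0) _; rewrite ler_wpM2r// lerDl cabs_ge0//.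
- by move=> t; exact: circle_kernel_bound.
- by rewrite pmulrn_lgt0// pi_gt0.
- by rewrite /cpolar sin2pi cos2pi sin0 cos0.
Qed.

End Circle.

Lemma le0_arbitrarily_small (R : realType) (x K : R) :
  (forall e, 0 < e -> x <= e * K) -> x <= 0.
Proof.
move=> H; apply/ler_addgt0Pl => e e0; rewrite addr0.
have K0 : 0 < `|K| + 1 by rewrite ltr_wpDl.
apply: le_trans (H (e / (`|K| + 1)) (divr_gt0 e0 K0)) _.
rewrite mulrAC ler_pdivrMr// ler_pM2l//.
by apply: le_trans (ler_norm _) _; rewrite lerDl.
Qed.

Section Taylor.
Context {R : realType}.
Local Open Scope classical_set_scope.
Local Notation C := (R[i]^o).

Lemma derivable_cdifferentiable (f : C -> C) (w : R[i]) :
  derivable f w 1 -> exists D, cdifferentiable_at f w D.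
Proof.
move=> /cvg_ex[D /= /(cvg_cabsP _) H]; exists D => e e0.
have [d /= d0 dP] := H e e0.
have dE : d = (complex.Re d)%:C.
  by have := ltW d0; case: (d) => x y; rewrite lecE /= => /andP[/eqP -> _].
move: d0; rewrite dE ltcR => d0.
exists (complex.Re d) => // w' ww'.
have [->|nw] := eqVneq w' w; first by rewrite !subrr mulr0 subr0 cabs0 mulr0.
have h0 : w' - w != 0 by rewrite subr_eq0.
have := dP (w' - w); rewrite /ball_ /= sub0r normrN normC_cabs dE ltcR.
move=> /(_ ww' h0); rewrite cabs_distC [_ *: 1]mulr1 subrK => /ltW.
rewrite -(ler_pM2r (_ : 0 < cabs (w' - w))) ?cabs_gt0// -cabsM.
congr (cabs _ <= _); rewrite mulrBl; congr (_ - _).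
by rewrite -[_ *: _]/(_ * _) mulrAC mulVf// mul1r.
Qed.

(** The integral does not change when the circle is contracted to [a], where
    [f] is close to [f a]. *)
Lemma cauchy_homothety (f : R[i] -> R[i]) a r : cabs a < r ->
  (forall w, exists D, cdifferentiable_at f w D) ->
  homothetic_cint f a r 0 =
  f a * cint (fun t => 'i%C * cpolar r t / (cpolar r t - a)) 0 (pi *+ 2).
Proof.
move=> ar fd; have r0 : 0 <= r by apply: le_trans (ltW ar); exact: cabs_ge0.
have cz : continuousC (fun t => cpolar r t - a).
  by apply: continuousC_B; [exact: continuousC_cpolar|exact: continuousC_cst].
have ck : continuousC (fun t => 'i%C * cpolar r t / (cpolar r t - a)).
  apply: continuousC_M.
    by apply: continuousC_M; [exact: continuousC_cst|exact: continuousC_cpolar].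
  by apply: continuousC_V cz => t; exact: cpolar_neq.
set B := r / (r - cabs a).
have B0 : 0 <= B by rewrite divr_ge0// subr_ge0 ltW.
apply/eqP; rewrite -subr_eq0 -cabs_eq0 eq_le cabs_ge0 andbT.
apply: (@le0_arbitrarily_small _ _ (B * (pi *+ 2 - 0) * 2)) => e e0.
have pi2 : (0 : R) <= pi *+ 2 by rewrite mulrn_wge0// pi_ge0.
have [D DP] := fd a; have [d d0 dP] := DP 1 ltr01.
pose M := 1 + cabs D.
have M0 : 0 < M by rewrite ltr_pwDl// cabs_ge0.
pose r2 := r * 2 + 1.
have r20 : 0 < r2 by rewrite ltr_wpDl// mulr_ge0.
pose eta := Num.min (d / 2) (e / M).
have eta0 : 0 < eta by rewrite lt_min !divr_gt0.
pose s := ln (eta / r2).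
rewrite (homothetic_cint_const 0 s ar) => [|w _]; last exact: fd.
rewrite /homothetic_cint -cintZ// -cintB; last 2 first.
- apply: continuousC_M ck.
  apply: (@cdifferentiable_comp_continuousC _ f
    (fun t => a + (expR s)%:C * (cpolar r t - a))) => //.
  apply: continuousC_D; first exact: continuousC_cst.
  by apply: continuousC_M => //; exact: continuousC_cst.
- by apply: continuousC_M => //; exact: continuousC_cst.
apply: le_trans (cint_bound (M := e * B) _ _ _) _ => //.
- apply: continuousC_B; last by apply: continuousC_M => //; exact: continuousC_cst.
  apply: continuousC_M ck.
  apply: (@cdifferentiable_comp_continuousC _ f
    (fun t => a + (expR s)%:C * (cpolar r t - a))) => //.
  apply: continuousC_D; first exact: continuousC_cst.
  by apply: continuousC_M => //; exact: continuousC_cst.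
- move=> t _; rewrite -mulrBl cabsM.
  apply: ler_pM; rewrite ?cabs_ge0//; last exact: circle_kernel_bound.
  set w := a + _.
  have wE : cabs (w - a) <= eta.
    rewrite /w addrC addKr cabsM cabs_real ger0_norm ?expR_ge0//.
    rewrite lnK ?posrE ?divr_gt0// mulrAC ler_pdivrMr// ler_pM2l//.
    apply: le_trans (cabsB _ _) _; rewrite cabs_cpolar// /r2.
    by apply: le_trans (lerD (lexx _) (ltW ar)) _; lra.
  have wd : cabs (w - a) < d.
    apply: le_lt_trans wE _; rewrite gt_min; apply/orP; left; lra.
  rewrite -(subrK (D * (w - a)) (f w - f a)).
  apply: le_trans (cabsD _ _) _.
  apply: le_trans (lerD (dP _ wd) (lexx _)) _.
  rewrite cabsM -mulrDl mulrC -ler_pdivlMr//.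
  by apply: le_trans wE _; rewrite ge_min lexx orbT.
- by rewrite !mulrA.
Qed.

End Taylor.

(** * Power series of entire functions *)

Section TaylorSeries.
Context {R : realType}.
Local Open Scope classical_set_scope.
Local Notation twopi := (pi *+ 2 : R).
Implicit Types (a : R[i]) (r : R).

Let twopi_gt0 : 0 < twopi. Proof. by rewrite pmulrn_lgt0// pi_gt0. Qed.

Lemma complexi_neq0 : 'i%C != 0 :> R[i].
Proof. by rewrite eq_complex /= negb_and oner_neq0 orbT. Qed.

Lemma cdifferentiable_expNn n (w : R[i]) : w != 0 ->
  exists D, cdifferentiable_at (fun w => w ^- n) w D.
Proof.
move=> w0; apply: derivable_cdifferentiable.
apply: (@derivableV _ _ (fun y : R[i]^o => (y ^+ n : R[i]))).
  by rewrite expf_neq0.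
exact: exprn_derivable.
Qed.

Lemma cdifferentiableM (f g : R[i] -> R[i]) (w : R[i]) :
  derivable (f : R[i]^o -> R[i]^o) w 1 -> derivable (g : R[i]^o -> R[i]^o) w 1 ->
  exists D, cdifferentiable_at (fun w => f w * g w) w D.
Proof.
move=> df dg; have H := @derivableM R[i] R[i]^o f g w 1 df dg.
by have [D HD] := derivable_cdifferentiable H; exists D; exact: HD.
Qed.

(** Dilating the circle by [e] multiplies the integral of [z^-(n+1) dz / z] by
    [e^-(n+1)], yet leaves it unchanged. *)
Lemma cint_cpolar_expN n r : 0 < r ->
  cint (fun t => (cpolar r t) ^- n.+1) 0 twopi = 0.
Proof.
move=> r0; pose g w : R[i] := w ^- n.+1.
have r0' : cabs (0 : R[i]) < r by rewrite cabs0.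
have z0 t : cpolar r t != 0 by have := cpolar_neq t r0'; rewrite subr0.
have cz : continuousC (fun t => cpolar r t ^- n.+1).
  apply: continuousC_V; first by move=> t; rewrite expf_neq0.
  by apply: continuousC_X; exact: continuousC_cpolar.
have hE s : homothetic_cint g 0 r s = (expR s)%:C ^- n.+1 *
    ('i%C * cint (fun t => (cpolar r t) ^- n.+1) 0 twopi).
  rewrite /homothetic_cint -!cintZ//; last first.
    by apply: continuousC_M => //; exact: continuousC_cst.
  apply: eq_cint => t; rewrite add0r subr0 mulfK// /g exprMn invfM -!mulrA.
  by congr (_ * _); rewrite mulrC.
have := homothetic_cint_const 0 1 r0' (cdifferentiable_expNn n.+1).
rewrite -/g !hE expR0 expr1n invr1 mul1r => /eqP.
rewrite -subr_eq0 -{1}[_ * cint _ _ _]mul1r -mulrBl mulf_eq0 => /orP[|].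
  rewrite subr_eq0 eq_sym invr_eq1 => /eqP /(congr1 (@cabs R)).
  rewrite cabsX cabs1 cabs_real ger0_norm ?expR_ge0// => /eqP.
  by rewrite pexprn_eq1 ?expR_ge0//= gt_eqF// expR_gt1.
by rewrite mulf_eq0 (negPf complexi_neq0) => /eqP.
Qed.

(** Homotheties with center 0 change the radius: Cauchy's coefficient formula
    gives the same value for all of them. *)
Lemma cint_cpolar_expN_radius (f : R[i] -> R[i]) n r : entire f -> 0 < r ->
  cint (fun t => f (cpolar r t) * (cpolar r t) ^- n) 0 twopi =
  cint (fun t => f (cpolar 1 t) * (cpolar 1 t) ^- n) 0 twopi.
Proof.
move=> fe r0; pose g w : R[i] := f w * w ^- n.
have r1 : cabs (0 : R[i]) < 1 by rewrite cabs0.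
have z0 r' t : 0 < r' -> cpolar r' t != 0.
  by move=> r'0; have := @cpolar_neq _ 0 r' t; rewrite subr0 cabs0; apply.
have fd w : exists D, cdifferentiable_at f w D.
  by apply: derivable_cdifferentiable; exact: fe.
have cF r' : 0 < r' -> continuousC (fun t => f (cpolar r' t) * (cpolar r' t) ^- n).
  move=> r'0; apply: continuousC_M.
    apply: (@cdifferentiable_comp_continuousC _ f (cpolar r')) => //.
    exact: continuousC_cpolar.
  apply: continuousC_V; first by move=> t; rewrite expf_neq0// z0.
  by apply: continuousC_X; exact: continuousC_cpolar.
have hE r' : 0 < r' -> homothetic_cint g 0 1 (ln r') =
    'i%C * cint (fun t => f (cpolar r' t) * (cpolar r' t) ^- n) 0 twopi.
  move=> r'0; rewrite /homothetic_cint -!cintZ//; last exact: cF.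
  apply: eq_cint => t; rewrite add0r subr0 mulfK ?z0// lnK ?posrE//.
  by rewrite -cpolarE /g mulrC.
apply: (mulfI complexi_neq0); rewrite -(hE r r0) -(hE 1 ltr01).
apply: homothetic_cint_const r1 _.
move=> w w0; apply: cdifferentiableM; first exact: fe.
apply: (@derivableV _ _ (fun y : R[i]^o => (y ^+ n : R[i]))).
  by rewrite expf_neq0.
exact: exprn_derivable.
Qed.

(** The partial sums of the geometric series of Cauchy's kernel, with their
    remainder. *)
Lemma kernel_geometric (z a : R[i]) N : z != 0 -> z - a != 0 ->
  'i%C * z / (z - a) =
  \sum_(n < N) 'i%C * a ^+ n * z ^- n + (a / z) ^+ N * ('i%C * z / (z - a)).
Proof.
move=> z0 za; elim: N => [|N IH]; first by rewrite big_ord0 add0r expr0 mul1r.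
have K : 'i%C * z / (z - a) = 'i%C + a / z * ('i%C * z / (z - a)).
  by field; rewrite z0 za.
rewrite {1}IH big_ord_recr /= -addrA; congr (_ + _).
rewrite {1}K mulrDr exprSr; congr (_ + _); last by rewrite mulrA.
by rewrite expr_div_n mulrC mulrA.
Qed.

Lemma continuousC_bounded (F : R -> R[i]) (x y : R) : continuousC F -> x <= y ->
  exists M, forall t, x <= t <= y -> cabs (F t) <= M.
Proof.
move=> cF xy.
have [c _ H] := EVT_max xy (continuous_subspaceT (continuousC_cabs cF)).
by exists (cabs (F c)) => t txy; apply: H; rewrite in_itv.
Qed.

Lemma cvg_kernel_geometric (F : R -> R[i]) a r : continuousC F -> cabs a < r ->
  (fun N => \sum_(n < N) 'i%C * a ^+ n * cint (fun t => F t * cpolar r t ^- n) 0 twopi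
     : R[i]^o) @ \oo -->
  (cint (fun t => F t * ('i%C * cpolar r t / (cpolar r t - a))) 0 twopi : R[i]^o).
Proof.
move=> cF ar; have r0 : 0 < r by apply: le_lt_trans ar; exact: cabs_ge0.
have z0 t : cpolar r t != 0.
  by have := @cpolar_neq _ 0 r t; rewrite subr0 cabs0; apply.
have ck : continuousC (fun t => 'i%C * cpolar r t / (cpolar r t - a)).
  apply: continuousC_M.
    by apply: continuousC_M; [exact: continuousC_cst|exact: continuousC_cpolar].
  apply: continuousC_V; first by move=> t; exact: cpolar_neq.
  by apply: continuousC_B; [exact: continuousC_cpolar|exact: continuousC_cst].
have cV n : continuousC (fun t => cpolar r t ^- n).
  apply: continuousC_V; first by move=> t; rewrite expf_neq0.
  by apply: continuousC_X; exact: continuousC_cpolar.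
have [M FM] := continuousC_bounded cF (ltW twopi_gt0).
have M0 : 0 <= M by apply: le_trans (cabs_ge0 (F 0)) (FM 0 _); rewrite lexx ltW.
set B := r / (r - cabs a).
have x1 : `|cabs a / r| < 1.
  by rewrite ger0_norm ?divr_ge0 ?cabs_ge0 ?ltW// ltr_pdivrMr// mul1r.
apply/cvg_cabsP => e e0.
have K0 : 0 < M * B * twopi * 2 + 1.
  have B0 : 0 <= B by rewrite divr_ge0 ?subr_ge0 ?(ltW ar) ?(ltW r0).
  by rewrite ltr_wpDl// mulr_ge0// mulr_ge0 ?(ltW twopi_gt0)// mulr_ge0.
have /cvgrPdist_lt/(_ _ (divr_gt0 e0 K0)) := cvg_expr x1.
apply: filterS => N; rewrite sub0r normrN normrX => xN.
have -> : cint (fun t => F t * ('i%C * cpolar r t / (cpolar r t - a))) 0 twopi =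
    \sum_(n < N) 'i%C * a ^+ n * cint (fun t => F t * cpolar r t ^- n) 0 twopi +
    cint (fun t => (a / cpolar r t) ^+ N *
            (F t * ('i%C * cpolar r t / (cpolar r t - a)))) 0 twopi.
  pose P (n : nat) t := 'i%C * a ^+ n * (F t * cpolar r t ^- n).
  have cP n : continuousC (P n).
    by apply: continuousC_M; [exact: continuousC_cst|exact: continuousC_M].
  transitivity (cint (fun t => \sum_(n < N) P n t +
      (a / cpolar r t) ^+ N * (F t * ('i%C * cpolar r t / (cpolar r t - a)))) 0 twopi).
    apply: eq_cint => t; rewrite {1}(@kernel_geometric _ a N)//; last exact: cpolar_neq.
    rewrite mulrDr mulr_sumr [F t * (_ ^+ N * _)]mulrCA; congr (_ + _).
    by apply: eq_bigr => n _; rewrite mulrCA.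
  rewrite cintD; last 2 first.
  - exact: (continuousC_sum N cP).
  - apply: continuousC_M; last exact: continuousC_M.
    apply: continuousC_X; apply: continuousC_M; first exact: continuousC_cst.
    by apply: continuousC_V => //; exact: continuousC_cpolar.
  rewrite (cint_sum N _ _ cP).
  congr (_ + _); apply: eq_bigr => n _; rewrite cintZ//; exact: continuousC_M.
rewrite addrC addKr.
apply: le_lt_trans (cint_bound (M := `|cabs a / r| ^+ N * (M * B)) _ _ _) _.
- apply: continuousC_M; last exact: continuousC_M.
  apply: continuousC_X; apply: continuousC_M; first exact: continuousC_cst.
  by apply: continuousC_V => //; exact: continuousC_cpolar.
- exact: ltW.
- move=> t tI; rewrite cabsM cabsX cabsM cabsV cabs_cpolar ?(ltW r0)//.
  rewrite [`|_|]ger0_norm ?divr_ge0 ?cabs_ge0 ?(ltW r0)// ler_wpM2l//.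
    by rewrite exprn_ge0// divr_ge0 ?cabs_ge0 ?(ltW r0).
  by rewrite cabsM; apply: ler_pM; rewrite ?cabs_ge0//; [exact: FM|exact: circle_kernel_bound].
move: xN; rewrite ltr_pdivlMr// subr0 -!mulrA.
by apply: le_lt_trans; rewrite ler_wpM2l ?exprn_ge0// !mulrA lerDl.
Qed.

Lemma cvg_C_unique (u : nat -> R[i]) (l l' : R[i]) :
  (u n : R[i]^o) @[n --> \oo] --> (l : R[i]^o) ->
  (u n : R[i]^o) @[n --> \oo] --> (l' : R[i]^o) -> l = l'.
Proof.
move=> /(cvg_cabsP eventually_filter) ul /(cvg_cabsP eventually_filter) ul'.
apply/eqP; rewrite -subr_eq0 -cabs_eq0 eq_le cabs_ge0 andbT.
apply: (@le0_arbitrarily_small _ _ 2) => e e0.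
have [n [n1 n2]] := filter_ex (filterI (ul e e0) (ul' e e0)).
rewrite -(subrK (u n) l) -addrA; apply: le_trans (cabsD _ _) _.
by rewrite mulr_natr mulr2n lerD// ?ltW// cabs_distC.
Qed.

(** The convergence is pointwise on the whole plane, which forces an infinite
    radius of convergence. *)
Definition power_series (f : R[i] -> R[i]) (c : nat -> R[i]) : Prop :=
  forall z, (\sum_(n < N) c n * z ^+ n : R[i]^o) @[N --> \oo] --> (f z : R[i]^o).

(** Cauchy's formula on a circle around 0 that encloses [a], with its kernel
    expanded in a geometric series. The coefficients do not depend on the
    circle, hence not on [a]. The total mass of the kernel is obtained from the
    same expansion of the constant function 1. *)
Lemma entire_power_series (f : R[i] -> R[i]) :
  entire f -> exists c, power_series f c.
Proof.
move=> fe; pose I n := cint (fun t => f (cpolar 1 t) * (cpolar 1 t) ^- n) 0 twopi.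
exists (fun n => I n / twopi%:C) => a.
have [r ar] : exists r, cabs a < r by exists (cabs a + 1); rewrite ltrDl.
have r0 : 0 < r by apply: le_lt_trans ar; exact: cabs_ge0.
have fd w : exists D, cdifferentiable_at f w D.
  by apply: derivable_cdifferentiable; exact: fe.
have c1 : continuousC (fun _ : R => 1 : R[i]) by exact: continuousC_cst.
have cf : continuousC (fun t => f (cpolar r t)).
  apply: (@cdifferentiable_comp_continuousC _ f (cpolar r)) => //.
  exact: continuousC_cpolar.
have H1 := cvg_kernel_geometric c1 ar.
have Hf := cvg_kernel_geometric cf ar.
have two0 : twopi%:C != 0 by rewrite eq_complex /= negb_and gt_eqF.
have K1 : cint (fun t => 'i%C * cpolar r t / (cpolar r t - a)) 0 twopi = 'i%C * twopi%:C.
  apply: (@cvg_C_unique (fun N => \sum_(n < N.+1) 'i%C * a ^+ n *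
     cint (fun t => 1 * cpolar r t ^- n) 0 twopi)).
    move: H1; rewrite -cvg_shiftS.
    by rewrite (@eq_cint _ _ (fun t => 'i%C * cpolar r t / (cpolar r t - a))) => [|t];
      rewrite ?mul1r.
  rewrite (_ : (fun N => _) = (fun=> 'i%C * twopi%:C)); first exact: cvg_cst.
  apply/funext => N; rewrite big_ord_recl /= big1 ?addr0 ?expr0 ?mulr1.
    congr (_ * _); rewrite -[RHS]subr0 -[0 in RHS]/(0%:C).
    under eq_cint do rewrite invr1 mulr1.
    apply: (@cint_derive R (fun t => t%:C)) => //.
    by move=> t /=; exact: is_derive_cst.
  move=> n _; rewrite (@eq_cint _ _ (fun t => cpolar r t ^- n.+1)) => [|t]; last by rewrite mul1r.
  by rewrite cint_cpolar_expN// mulr0.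
have K2 : cint (fun t => f (cpolar r t) * ('i%C * cpolar r t / (cpolar r t - a))) 0 twopi =
    f a * ('i%C * twopi%:C).
  rewrite -K1 -(cauchy_homothety ar fd) /homothetic_cint.
  by apply: eq_cint => t; rewrite expR0 mul1r [a + _]addrC subrK.
move: Hf; rewrite K2 => Hf.
have i0 : 'i%C * twopi%:C != 0 :> R[i].
  by rewrite mulf_neq0// complexi_neq0.
have -> : f a = f a * ('i%C * twopi%:C) * ('i%C * twopi%:C)^-1 by rewrite mulfK.
rewrite (_ : (fun N => _) = (fun N => (\sum_(n < N) 'i%C * a ^+ n *
    cint (fun t => f (cpolar r t) * cpolar r t ^- n) 0 twopi) * ('i%C * twopi%:C)^-1)).
  exact: (@cvgM R[i] nat \oo _ _ _ _ _ Hf (cvg_cst _)).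
apply/funext => N; rewrite mulr_suml; apply: eq_bigr => n _.
rewrite (cint_cpolar_expN_radius n fe r0) -/(I n) -['i%C * _ * _]mulrA -mulf_div.
by rewrite divff ?complexi_neq0// mul1r mulrAC [I n * _]mulrC.
Qed.

End TaylorSeries.

(** * Invariance of area under rotations and dilations *)

Section AffineSubstitution.
Context {R : realType}.
Local Open Scope classical_set_scope.
Local Open Scope ereal_scope.
Local Notation mu := (@lebesgue_measure R).
Variables (s c : R).
Hypothesis s0 : (0 < s)%R.

Let phi (x : measurableTypeR R) : measurableTypeR R := (s * x + c)%R.

Let mphi : measurable_fun setT phi.
Proof.
by apply: measurable_funD => //; apply: measurable_funM.
Qed.

Let pushforward_phi : {measure set (measurableTypeR R) -> \bar R}.
Proof. by refine (pushforward mu phi); exact: mphi. Defined.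

Let nu := mscale (NngNum (ltW s0)) pushforward_phi.

(** The measure [s] times the image of Lebesgue measure under [phi] agrees with
    Lebesgue measure on intervals. *)
Let nuE A : measurable A -> mu A = nu A.
Proof.
apply: lebesgue_measure_unique => _ [[a b]] _ <- /=.
rewrite -[RHS]/(s%:E * mu (phi @^-1` `]a, b])).
have -> : phi @^-1` `]a, b] = `]((a - c) / s)%R, ((b - c) / s)%R].
  apply/seteqP; split => x /=; rewrite !in_itv /= /phi.
    by rewrite ltr_pdivrMr// ler_pdivlMr// ltrBlDr lerBrDr [(x * s)%R]mulrC.
  by rewrite ltr_pdivrMr// ler_pdivlMr// ltrBlDr lerBrDr [(x * s)%R]mulrC.
rewrite !lebesgue_measure_itv /= !lte_fin ltr_pM2r ?invr_gt0// ltrD2r.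
case: ifPn => _; last by rewrite mule0.
rewrite -!EFinB -EFinM; congr (_%:E); field; exact: lt0r_neq0.
Qed.

Lemma ge0_integral_affine (f : measurableTypeR R -> \bar R) :
  measurable_fun setT f -> (forall x, 0 <= f x) ->
  \int[mu]_x f (s * x + c)%R = (s^-1)%:E * \int[mu]_x f x.
Proof.
move=> mf f0.
have -> : \int[mu]_x f x = s%:E * \int[mu]_x f (s * x + c)%R.
  rewrite (eq_measure_integral nu) => [|A mA _]; last exact: nuE.
  rewrite ge0_integral_mscale//; congr (_ * _).
  by rewrite (ge0_integral_pushforward mphi)// => x _; exact: f0.
by rewrite muleA -EFinM mulVf ?mul1e// lt0r_neq0.
Qed.

End AffineSubstitution.

Section AreaSubstitution.
Context {R : realType}.
Local Open Scope classical_set_scope.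
Local Open Scope ereal_scope.
Local Notation mu := (@lebesgue_measure R).
Local Notation T := (measurableTypeR R * measurableTypeR R)%type.
Implicit Types F : T -> \bar R.

Lemma area_tonelli1 F : measurable_fun setT F -> (forall p, 0 <= F p) ->
  \int[area R]_p F p = \int[mu]_x \int[mu]_y F (x, y).
Proof. by move=> mF F0; rewrite /area fubini_tonelli1. Qed.

Lemma area_tonelli2 F : measurable_fun setT F -> (forall p, 0 <= F p) ->
  \int[area R]_p F p = \int[mu]_y \int[mu]_x F (x, y).
Proof. by move=> mF F0; rewrite /area -fubini_tonelli// fubini_tonelli1. Qed.

Definition shear1 (c : R) (p : T) : T := (p.1 + c * p.2, p.2)%R.
Definition shear2 (c : R) (p : T) : T := (p.1, p.2 + c * p.1)%R.

Lemma measurable_shear1 c : measurable_fun setT (shear1 c).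
Proof.
apply: measurable_fun_pair; last exact: measurable_snd.
apply: measurable_funD; first exact: measurable_fst.
by apply: measurable_funM => //; exact: measurable_snd.
Qed.

Lemma measurable_shear2 c : measurable_fun setT (shear2 c).
Proof.
apply: measurable_fun_pair; first exact: measurable_fst.
apply: measurable_funD; first exact: measurable_snd.
by apply: measurable_funM => //; exact: measurable_fst.
Qed.

Lemma ge0_integral_shear1 c F : measurable_fun setT F -> (forall p, 0 <= F p) ->
  \int[area R]_p F (shear1 c p) = \int[area R]_p F p.
Proof.
move=> mF F0; rewrite !area_tonelli2//; last first.
  by apply: measurableT_comp => //; exact: measurable_shear1.
apply: eq_integral => y _; rewrite /shear1 /=.
under eq_integral do rewrite -[X in (X + _)%R]mul1r.
rewrite (@ge0_integral_affine R 1 (c * y) ltr01 (fun x => F (x, y)))//.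
  by rewrite invr1 mul1e.
by apply: measurableT_comp => //; exact: measurable_fun_pair1.
Qed.

Lemma ge0_integral_shear2 c F : measurable_fun setT F -> (forall p, 0 <= F p) ->
  \int[area R]_p F (shear2 c p) = \int[area R]_p F p.
Proof.
move=> mF F0; rewrite !area_tonelli1//; last first.
  by apply: measurableT_comp => //; exact: measurable_shear2.
apply: eq_integral => x _; rewrite /shear2 /=.
under eq_integral do rewrite -[X in (X + _)%R]mul1r.
rewrite (@ge0_integral_affine R 1 (c * x) ltr01 (fun y => F (x, y)))//.
  by rewrite invr1 mul1e.
by apply: measurableT_comp => //; exact: measurable_fun_pair2.
Qed.

Definition rot (u : R[i]) (p : T) : T :=
  let z := (u * complex_of_pair p)%R in (complex.Re z, complex.Im z).

Lemma measurable_rot u : measurable_fun setT (rot u).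
Proof.
have m1 := @measurable_fst _ _ (measurableTypeR R) (measurableTypeR R).
have m2 := @measurable_snd _ _ (measurableTypeR R) (measurableTypeR R).
case: u => a b; apply: measurable_fun_pair => /=.
  by apply: measurable_funB; apply: measurable_funM.
by apply: measurable_funD; apply: measurable_funM.
Qed.

Lemma rotM u v p : rot (u * v)%R p = rot u (rot v p).
Proof.
rewrite /rot -mulrA.
by have -> (w : R[i]) : complex_of_pair (complex.Re w, complex.Im w) = w by case: w.
Qed.

(** A rotation by an angle other than [pi] is a product of three shears, with
    [t] the tangent of half the angle, and shears preserve area by Tonelli's
    theorem and translation invariance. *)
Let rot_shear u : cabs u = 1%R -> u != (-1)%R ->
  rot u =1 fun p => let t := (complex.Im u / (1 + complex.Re u))%R in
   shear1 (- t) (shear2 (complex.Im u) (shear1 (- t) p)).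
Proof.
move=> u1 un1 [x y].
have : (complex.Re u ^+ 2 + complex.Im u ^+ 2 = 1)%R by rewrite -sqr_cabs u1 expr1n.
case: u un1 {u1} => a b /= un1 ab.
have a1 : (1 + a != 0)%R.
  apply: contra_neq un1 => a1; have aE : a = (-1)%R by lra.
  have : (b ^+ 2 = 0)%R by move: ab; rewrite aE sqrrN expr1n; lra.
  move/eqP; rewrite sqrf_eq0 => /eqP b0.
  by apply/eqP; rewrite eq_complex /= aE b0 oppr0 !eqxx.
have bE : (b * b = (1 - a) * (1 + a))%R by move: ab; rewrite !expr2; lra.
have tE : (b / (1 + a) * b = 1 - a)%R by rewrite mulrAC bE mulfK.
rewrite /rot /shear1 /shear2 /complex_of_pair /=.
have H1 : (x + - (b / (1 + a)) * y + - (b / (1 + a)) *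
    (y + b * (x + - (b / (1 + a)) * y)) = a * x - b * y)%R.
  rewrite (_ : (_ = _)%R = (x - (b / (1 + a)) * y - (b / (1 + a)) * y -
    (b / (1 + a) * b) * (x - b / (1 + a) * y) = a * x - b * y)%R); last first.
    by congr (_ = _); ring.
  by rewrite tE; field.
have H2 : (y + b * (x + - (b / (1 + a)) * y) = a * y + b * x)%R.
  rewrite (_ : (y + _)%R = (y + b * x - (b / (1 + a) * b) * y)%R); last by ring.
  by rewrite tE; ring.
by rewrite H1 H2.
Qed.

Lemma ge0_integral_rot u F : cabs u = 1%R ->
  measurable_fun setT F -> (forall p, 0 <= F p) ->
  \int[area R]_p F (rot u p) = \int[area R]_p F p.
Proof.
move=> u1 mF F0.
have main v : cabs v = 1%R -> v != (-1)%R -> forall G, measurable_fun setT G ->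
    (forall p, 0 <= G p) -> \int[area R]_p G (rot v p) = \int[area R]_p G p.
  move=> v1 vn1 G mG G0; under eq_integral do rewrite rot_shear//.
  set t := (_ / _)%R; set b := complex.Im v.
  have mG1 : measurable_fun setT (fun p => G (shear1 (- t) p)).
    by apply: measurableT_comp mG _; exact: measurable_shear1.
  have mG2 : measurable_fun setT (fun p => G (shear1 (- t) (shear2 b p))).
    by apply: measurableT_comp mG1 _; exact: measurable_shear2.
  rewrite (@ge0_integral_shear1 (- t) (fun p => G (shear1 (- t) (shear2 b p))))//.
  rewrite (@ge0_integral_shear2 b (fun p => G (shear1 (- t) p)))//.
  exact: ge0_integral_shear1.
(* The half-turn is the square of the quarter-turn. *)
have [->|un1] := eqVneq u (-1)%R; last exact: main.
have i1 : cabs ('i%C : R[i]) = 1%R by rewrite cabsE /= expr0n expr1n add0r sqrtr1.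
have in1 : 'i%C != (-1)%R :> R[i] by rewrite eq_complex /= negb_and oppr0 oner_neq0 orbT.
under eq_integral do rewrite -sqr_i expr2 rotM.
rewrite (main 'i%C i1 in1 (fun p => F (rot 'i%C p)))//; first exact: main.
by apply: measurableT_comp mF _; exact: measurable_rot.
Qed.

Lemma ge0_integral_dilate (s : R) F : (0 < s)%R ->
  measurable_fun setT F -> (forall p, 0 <= F p) ->
  \int[area R]_p F (s * p.1, s * p.2)%R = (s ^- 2)%:E * \int[area R]_p F p.
Proof.
move=> s0 mF F0.
have mG : measurable_fun setT (fun p : T => F (s * p.1, s * p.2)%R).
  apply: measurableT_comp mF _; apply: measurable_fun_pair => /=.
    by apply: measurable_funM => //; exact: measurable_fst.
  by apply: measurable_funM => //; exact: measurable_snd.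
rewrite !area_tonelli1//.
transitivity (\int[mu]_x ((s^-1)%:E * \int[mu]_y F (s * x, y)%R)).
  apply: eq_integral => x _ /=.
  under eq_integral do rewrite -[X in (_, X)]addr0.
  rewrite (@ge0_integral_affine R s 0 s0 (fun y => F (s * x, y)%R))//.
  by apply: measurableT_comp => //; exact: measurable_fun_pair2.
have mI : measurable_fun setT (fun x => \int[mu]_y F (x, y)).
  exact: (measurable_fun_fubini_tonelli_F _ mF).
have ms : measurable_fun setT (fun x : measurableTypeR R => (s * x)%R : measurableTypeR R).
  exact: measurable_funM.
rewrite ge0_integralZl//; [|exact: (measurableT_comp mI ms)| |].
- rewrite exprSr expr1 invfM EFinM -muleA; congr (_ * _).
  under eq_integral do rewrite -[(s * _)%R]addr0.
  rewrite (@ge0_integral_affine R s 0 s0 (fun x => \int[mu]_y F (x, y)))// => x.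
  by apply: integral_ge0 => y _; exact: F0.
- by move=> x _; apply: integral_ge0 => y _; exact: F0.
- by rewrite lee_fin invr_ge0 ltW.
Qed.

End AreaSubstitution.

(** * Averages over roots of unity *)

Section RootsOfUnity.
Context {R : realType}.
Implicit Types (t : R) (N n m j : nat).

Lemma cpolar1D s t : cpolar 1 (s + t) = cpolar 1 s * cpolar 1 t :> R[i].
Proof.
rewrite /cpolar !mul1r cosD sinD; apply/eqP; rewrite eq_complex /=.
by rewrite eqxx /= addrC.
Qed.

Lemma cpolar1X t n : cpolar 1 t ^+ n = cpolar 1 (n%:R * t) :> R[i].
Proof.
elim: n => [|n IH]; first by rewrite expr0 mul0r /cpolar cos0 sin0 mulr1 mulr0.
by rewrite exprS IH -cpolar1D -natr1 mulrDl mul1r addrC.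
Qed.

Lemma exists_unit_root N : (0 < N)%N ->
  exists2 w : R[i], w ^+ N = 1 &
    forall n m, (n < N)%N -> (m < N)%N -> w ^+ n = w ^+ m -> n = m.
Proof.
move=> N0; have NR : 0 < N%:R :> R by rewrite ltr0n.
pose w := cpolar 1 (pi *+ 2 / N%:R) : R[i].
have wN : w ^+ N = 1.
  by rewrite cpolar1X mulrC divfK ?gt_eqF// /cpolar cos2pi sin2pi mulr1 mulr0.
have w1 j : (0 < j)%N -> (j < N)%N -> w ^+ j != 1.
  move=> j0 jN; rewrite cpolar1X; apply/eqP => /(congr1 (@complex.Re R)) /=.
  pose x : R := pi * (j%:R / N%:R).
  have x0 : 0 < sin x.
    apply: sin_gt0_pi; rewrite mulr_gt0 ?pi_gt0 ?divr_gt0 ?ltr0n//=.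
    by rewrite gtr_pMr ?pi_gt0// ltr_pdivrMr// mul1r ltr_nat.
  rewrite (_ : j%:R * _ = x + x); last by rewrite /x; field; rewrite gt_eqF.
  rewrite mul1r cosD -!expr2 => E; have := cos2Dsin2 x.
  have : 0 < sin x ^+ 2 by rewrite exprn_gt0.
  lra.
exists w => // n m; wlog nm : n m / (n <= m)%N.
  move=> H nN mN E; have [/H|/ltnW/H] := leqP n m; first by apply.
  by move=> /(_ mN nN) ->.
move=> nN mN E; apply/eqP; rewrite eqn_leq nm leqNgt; apply/negP => lt_nm.
have w0 : w != 0.
  by apply/eqP => w0; move: wN; rewrite w0 expr0n gtn_eqF//= => /eqP; rewrite eq_sym oner_eq0.
have := @w1 (m - n)%N; rewrite subn_gt0 lt_nm => /(_ isT (leq_ltn_trans (leq_subr _ _) mN)).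
move/eqP; apply; apply: (mulfI (expf_neq0 n w0)).
by rewrite -exprD subnKC// mulr1.
Qed.

Lemma sqr_cabsC (z : R[i]) : (cabs z ^+ 2)%:C = z * conjc z.
Proof. by rewrite -sqr_normc normC_cabs rmorphXn. Qed.

(** The powers of [w] are the [N]-th roots of unity, and the characters
    [j |-> w^(j n)] are orthogonal. *)
Lemma discrete_parseval N (w : R[i]) (a : nat -> R[i]) : (0 < N)%N ->
  w ^+ N = 1 ->
  (forall n m, (n < N)%N -> (m < N)%N -> w ^+ n = w ^+ m -> n = m) ->
  \sum_(j < N) cabs (\sum_(n < N) a n * (w ^+ j) ^+ n) ^+ 2 =
  N%:R * \sum_(n < N) cabs (a n) ^+ 2.
Proof.
move=> N0 wN winj; apply: complexI; rewrite rmorphM !rmorph_sum /= rmorph_nat.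
have cw : w * conjc w = 1.
  have : cabs w ^+ N = 1 by rewrite -cabsX wN cabs1.
  move/eqP; rewrite pexprn_eq1 ?cabs_ge0// gtn_eqF//= => /eqP w1.
  by rewrite -sqr_cabsC w1 expr1n.
have orth (n m : 'I_N) : \sum_(j < N) (w ^+ n * conjc w ^+ m) ^+ j =
    if n == m then N%:R else 0.
  case: eqP => [->|nm].
    rewrite -exprMn cw expr1n.
    by under eq_bigr do rewrite expr1n; rewrite sumr_const card_ord.
  set x := _ * _; have x1 : x - 1 != 0.
    rewrite subr_eq0; apply/eqP => x1; apply: nm; apply/val_inj => /=.
    apply: winj => //; move: x1; rewrite /x => /(congr1 (fun y => y * w ^+ m)).
    by rewrite mul1r -mulrA -exprMn mulrC [conjc w * w]mulrC cw expr1n mul1r.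
  apply: (mulfI x1); rewrite -subrX1 mulr0 /x exprMn -!exprM ![(_ * N)%N]mulnC.
  by rewrite !exprM wN -[conjc w ^+ N]rmorphXn wN rmorph1 !expr1n mulr1 subrr.
transitivity (\sum_(j < N) \sum_(n < N) \sum_(m < N)
    (a n * conjc (a m)) * (w ^+ n * conjc w ^+ m) ^+ j).
  apply: eq_bigr => j _; rewrite sqr_cabsC rmorph_sum /= mulr_suml.
  apply: eq_bigr => n _; rewrite mulr_sumr; apply: eq_bigr => m _.
  by rewrite rmorphM /= mulrACA !rmorphXn /= exprMn -!exprM ![(j * _)%N]mulnC.
rewrite exchange_big /= mulr_sumr; apply: eq_bigr => n _.
rewrite exchange_big /= (bigD1 n)//= [X in _ + X]big1 ?addr0 => [|m mn].
  by rewrite -mulr_sumr orth eqxx sqr_cabsC mulrC.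
by rewrite -mulr_sumr orth eq_sym (negPf mn) mulr0.
Qed.

End RootsOfUnity.

(** * Measurable complex functions *)

Section ComplexMeasurable.
Context {R : realType}.
Local Open Scope classical_set_scope.
Local Notation T := (measurableTypeR R * measurableTypeR R)%type.
Implicit Types f g : T -> R[i].

Definition measurableC f : Prop :=
  measurable_fun setT (fun p => complex.Re (f p) : measurableTypeR R) /\
  measurable_fun setT (fun p => complex.Im (f p) : measurableTypeR R).

Lemma measurableC_cst k : measurableC (fun=> k).
Proof. by split; exact: measurable_cst. Qed.

Lemma measurableC_D f g : measurableC f -> measurableC g ->
  measurableC (fun p => f p + g p).
Proof.
move=> [f1 f2] [g1 g2]; split.
  by under eq_fun do rewrite raddfD; exact: measurable_funD.
by under eq_fun do rewrite raddfD; exact: measurable_funD.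
Qed.

Lemma measurableC_M f g : measurableC f -> measurableC g ->
  measurableC (fun p => f p * g p).
Proof.
move=> [f1 f2] [g1 g2].
have E p : f p * g p =
    (complex.Re (f p) * complex.Re (g p) - complex.Im (f p) * complex.Im (g p)) +i*
    (complex.Re (f p) * complex.Im (g p) + complex.Im (f p) * complex.Re (g p)).
  by case: (f p) (g p) => ? ? [].
split; under eq_fun do rewrite E /=.
  by apply: measurable_funB; exact: measurable_funM.
by apply: measurable_funD; exact: measurable_funM.
Qed.

Lemma measurableC_id : measurableC (@complex_of_pair R).
Proof. by split; [exact: measurable_fst|exact: measurable_snd]. Qed.

Lemma measurableC_X f n : measurableC f -> measurableC (fun p => f p ^+ n).
Proof.
move=> mf; elim: n => [|n IH]; first exact: measurableC_cst.
by under eq_fun do rewrite exprS; exact: measurableC_M.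
Qed.

Lemma measurableC_sum N (f_ : nat -> T -> R[i]) :
  (forall n, measurableC (f_ n)) -> measurableC (fun p => \sum_(n < N) f_ n p).
Proof.
move=> mf; elim: N => [|N IH].
  by under eq_fun do rewrite big_ord0; exact: measurableC_cst.
by under eq_fun do rewrite big_ord_recr /=; exact: measurableC_D.
Qed.

Lemma measurableC_cabs f : measurableC f ->
  measurable_fun setT (fun p => cabs (f p) : measurableTypeR R).
Proof.
move=> [f1 f2]; under eq_fun do rewrite cabsE.
apply: (@measurableT_comp _ _ _ _ _ _ (@Num.sqrt R)).
  by apply: continuous_measurable_fun; exact: sqrt_continuous.
by apply: measurable_funD; exact: measurable_funX.
Qed.

Lemma measurableC_cvg (f_ : nat -> T -> R[i]) f :
  (forall n, measurableC (f_ n)) ->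
  (forall p, (f_ n p : R[i]^o) @[n --> \oo] --> (f p : R[i]^o)) -> measurableC f.
Proof.
move=> mf ff; split.
  apply: (@measurable_fun_cvg _ _ _ _ (fun n p => complex.Re (f_ n p))) => //.
    by move=> n; case: (mf n).
  by move=> p _; apply: continuous_cvg (ff p); exact: continuous_Re.
apply: (@measurable_fun_cvg _ _ _ _ (fun n p => complex.Im (f_ n p))) => //.
  by move=> n; case: (mf n).
by move=> p _; apply: continuous_cvg (ff p); exact: continuous_Im.
Qed.

End ComplexMeasurable.

(** * Parseval's identity for radial weights *)

Lemma fatou_le d (T : measurableType d) (R : realType)
    (mu : {measure set T -> \bar R}) (g_ : nat -> T -> \bar R) (g : T -> \bar R)
    (A : \bar R) :
  (forall n, measurable_fun setT (g_ n)) -> (forall n x, (0 <= g_ n x)%E) ->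
  (forall x, (g_ n x @[n --> \oo] --> g x)%classic) ->
  (forall n, (\int[mu]_x g_ n x <= A)%E) -> (\int[mu]_x g x <= A)%E.
Proof.
move=> mg g0 gg gA.
rewrite (eq_integral (fun x => limn_einf (g_^~ x))) => [|x _]; last first.
  by rewrite (cvg_limn_einf_sup (gg x)).1.
apply: le_trans (fatou mu measurableT mg (fun n x _ => g0 n x)) _.
rewrite limn_einf_lim; apply: lime_le; first exact: is_cvg_einfs.
apply: nearW => n; apply: le_trans (gA n).
by apply: ereal_inf_lbound; exists n => /=.
Qed.

Section WeightedNorm.
Context {R : realType}.
Local Open Scope classical_set_scope.
Local Open Scope ereal_scope.
Local Notation T := (measurableTypeR R * measurableTypeR R)%type.
Implicit Types (V : R -> R) (f g : R[i] -> R[i]) (c : nat -> R[i]).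

(** A radial weight is given by its profile [V], a function of the modulus. *)
Definition wintegrand V f (p : T) : R :=
  (cabs (f (complex_of_pair p)) ^+ 2 * V (cabs (complex_of_pair p)))%R.

Definition wnormsq V f : \bar R := \int[area R]_p (wintegrand V f p)%:E.

Definition moment V n : \bar R := wnormsq V (fun z => z ^+ n)%R.

Definition measurable_C f := measurableC (f \o @complex_of_pair R).

Lemma wintegrand_ge0 V f : (forall r, (0 <= V r)%R) ->
  forall p, 0 <= (wintegrand V f p)%:E.
Proof. by move=> V0 p; rewrite lee_fin mulr_ge0 ?sqr_ge0. Qed.

Lemma measurable_wintegrand V f : measurable_fun setT V -> measurable_C f ->
  measurable_fun setT (fun p => (wintegrand V f p)%:E).
Proof.
move=> mV mf; apply/measurable_EFinP; apply: measurable_funM.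
  by apply: measurable_funX; exact: measurableC_cabs.
by apply: measurableT_comp => //; exact: measurableC_cabs measurableC_id.
Qed.

Lemma measurable_polyC N c : measurable_C (fun z => \sum_(n < N) c n * z ^+ n)%R.
Proof.
apply: (@measurableC_sum _ N (fun n p => c n * complex_of_pair p ^+ n)%R) => n.
by apply: measurableC_M; [exact: measurableC_cst|exact/measurableC_X/measurableC_id].
Qed.

Lemma power_series_measurable f c : power_series f c -> measurable_C f.
Proof.
move=> fc; apply: (@measurableC_cvg _
  (fun N p => \sum_(n < N) c n * complex_of_pair p ^+ n)%R).
  by move=> N; exact: measurable_polyC.
by move=> p; exact: fc.
Qed.

Lemma complex_of_pairK (z : R[i]) : complex_of_pair (complex.Re z, complex.Im z) = z.
Proof. by case: z. Qed.

Lemma wnormsq_rot V f (u : R[i]) : measurable_fun setT V -> (forall r, (0 <= V r)%R) ->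
  measurable_C f -> cabs u = 1%R -> wnormsq V (fun z => f (u * z)%R) = wnormsq V f.
Proof.
move=> mV V0 mf u1.
rewrite /wnormsq -[RHS](ge0_integral_rot u1); last exact: wintegrand_ge0.
  apply: eq_integral => p _; rewrite /wintegrand /rot complex_of_pairK.
  by rewrite [cabs (u * _)%R]cabsM u1 mul1r.
exact: measurable_wintegrand.
Qed.

Section Polynomials.
Variable V : R -> R.
Hypothesis mV : measurable_fun setT V.
Hypothesis V0 : forall r, (0 <= V r)%R.

Lemma wnormsq_ge0 f : 0 <= wnormsq V f.
Proof. by apply: integral_ge0 => p _; exact: wintegrand_ge0. Qed.

Lemma integral_scale_monomial (k : R) n : (0 <= k)%R ->
  \int[area R]_p (k * wintegrand V (fun z => z ^+ n)%R p)%:E = k%:E * moment V n.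
Proof.
move=> k0; rewrite /moment /wnormsq -ge0_integralZl ?lee_fin//.
  by apply: measurable_wintegrand => //; exact/measurableC_X/measurableC_id.
by move=> p _; apply: wintegrand_ge0.
Qed.

(** Monomials are orthogonal for a radial weight. Instead of polar coordinates,
    the squared norm is averaged over the rotations by the [N]-th roots of unity,
    which do not change it; under the integral the average is computed by
    [discrete_parseval]. *)
Lemma wnormsq_poly N c : wnormsq V (fun z => \sum_(n < N) c n * z ^+ n)%R =
  \sum_(n < N) (cabs (c n) ^+ 2)%:E * moment V n.
Proof.
case: N => [|N'].
  rewrite big_ord0 /wnormsq; apply: integral0_eq => p _.
  by rewrite /wintegrand big_ord0 cabs0 expr0n mul0r.
set N := N'.+1; set P := (fun z : R[i] => _).
have [w wN winj] := @exists_unit_root R N (ltn0Sn _).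
have w1 : cabs w = 1%R.
  have : (cabs w ^+ N = 1)%R by rewrite -cabsX wN cabs1.
  by move/eqP; rewrite pexprn_eq1 ?cabs_ge0//= => /eqP.
have mP : measurable_C P by exact: measurable_polyC.
have mrot j : measurable_C (fun z => P (w ^+ j * z)%R).
  rewrite /P; under eq_fun do under eq_bigr do rewrite exprMn mulrA.
  exact: (measurable_polyC N (fun n => c n * (w ^+ j) ^+ n)%R).
have NE : (N%:R : R)%:E * wnormsq V P =
    (N%:R : R)%:E * \sum_(n < N) (cabs (c n) ^+ 2)%:E * moment V n.
  transitivity (\sum_(j < N) wnormsq V (fun z => P (w ^+ j * z)%R)).
    under eq_bigr do rewrite wnormsq_rot// ?cabsX ?w1 ?expr1n//.
    rewrite -[in LHS](card_ord N) -sumr_const -sumEFin ge0_sume_distrl//.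
    by apply: eq_bigr => j _; rewrite mul1e.
  rewrite /wnormsq -ge0_integral_sum//; last 2 first.
  - by move=> j; exact: measurable_wintegrand.
  - by move=> j p _; exact: wintegrand_ge0.
  transitivity (\int[area R]_p \sum_(n < N)
      (N%:R * cabs (c n) ^+ 2 * wintegrand V (fun z => z ^+ n)%R p)%:E).
    apply: eq_integral => p _; rewrite !sumEFin; congr (_%:E).
    set z := complex_of_pair p.
    rewrite /wintegrand -mulr_suml.
    have := discrete_parseval (fun n => c n * z ^+ n)%R (ltn0Sn _) wN winj.
    under eq_bigr do under eq_bigr do rewrite -mulrA [(z ^+ _ * _)%R]mulrC -exprMn.
    move=> ->; rewrite mulr_sumr mulr_suml; apply: eq_bigr => n _.
    by rewrite cabsM exprMn -/z !mulrA.
  rewrite ge0_integral_sum//; last 2 first.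
  - move=> n; under eq_fun do rewrite EFinM; apply: measurable_funeM.
    by apply: measurable_wintegrand => //; exact/measurableC_X/measurableC_id.
  - move=> n p _; rewrite lee_fin; apply: mulr_ge0; first by rewrite mulr_ge0 ?sqr_ge0.
    by rewrite -lee_fin; apply: wintegrand_ge0.
  rewrite ge0_sume_distrr; last first.
    by move=> n _; rewrite mule_ge0 ?lee_fin ?sqr_ge0// wnormsq_ge0.
  apply: eq_bigr => n _; rewrite integral_scale_monomial; last by apply: mulr_ge0; rewrite ?sqr_ge0.
  by rewrite EFinM muleA.
have N0 : (N%:R != 0 :> R)%R by rewrite pnatr_eq0.
have := congr1 (fun x => (N%:R^-1 : R)%:E * x) NE.
by rewrite !muleA -EFinM mulVf// !mul1e.
Qed.

End Polynomials.

Section Parseval.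
Variable V : R -> R.
Hypothesis mV : measurable_fun setT V.
Hypothesis V0 : forall r, (0 <= V r)%R.
Hypothesis V1 : forall r, (V r <= 1)%R.
Variables (f : R[i] -> R[i]) (c : nat -> R[i]).
Hypothesis fc : power_series f c.

Let S N z : R[i] := (\sum_(n < N) c n * z ^+ n)%R.

Let mf : measurable_C f. Proof. exact: power_series_measurable fc. Qed.

Let psum N : \bar R := \sum_(n < N) (cabs (c n) ^+ 2)%:E * moment V n.

Lemma power_series_wintegrand_cvg U p :
  (wintegrand U (S N) p)%:E @[N --> \oo] --> (wintegrand U f p)%:E.
Proof.
apply/fine_cvgP; split; first exact: nearW.
have H : cabs (S N (complex_of_pair p)) @[N --> \oo] --> cabs (f (complex_of_pair p)).
  exact: (cvg_cabs eventually_filter (@fc (complex_of_pair p))).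
exact: (cvgM (cvgM H H) (cvg_cst _)).
Qed.

(** The terms of the series are bounded at a point [q] of modulus at least
    twice that of [z], and so decay geometrically at [z]. *)
Lemma power_series_bounded (k : nat) : exists2 B : R, (0 <= B)%R &
  forall N z, (cabs z <= k%:R)%R -> (cabs (S N z) <= B)%R.
Proof.
pose q : R := ((k%:R + 1) *+ 2)%R.
have q0 : (0 < q)%R by rewrite pmulrn_lgt0// ltr_wpDl.
have [A A0 cA] : exists2 A : R, (0 <= A)%R & forall n, (cabs (c n) * q ^+ n <= A)%R.
  have cv := @fc q%:C.
  have [N HN] : exists N0, forall n, (N0 <= n)%N ->
      (cabs (f q%:C - S n q%:C) < 1)%R.
    have [N _ HN] := (cvg_cabsP eventually_filter _ _).1 cv 1%R ltr01.
    by exists N => n Nn; exact: HN.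
  pose A := (2 + \sum_(n < N) cabs (c n) * q ^+ n)%R.
  have s0 : (0 <= \sum_(n < N) cabs (c n) * q ^+ n)%R.
    by apply: sumr_ge0 => n _; rewrite mulr_ge0 ?cabs_ge0// exprn_ge0// ltW.
  exists A; first by rewrite addr_ge0.
  move=> n; have [nN|Nn] := ltnP n N.
    apply: le_trans (_ : \sum_(n < N) cabs (c n) * q ^+ n <= _)%R; last by rewrite lerDr.
    rewrite (bigD1 (Ordinal nN))//= lerDl; apply: sumr_ge0 => m _.
    by rewrite mulr_ge0 ?cabs_ge0// exprn_ge0// ltW.
  have -> : (cabs (c n) * q ^+ n = cabs ((f q%:C - S n q%:C) - (f q%:C - S n.+1 q%:C)))%R.
    rewrite (_ : (_ - _ = c n * q%:C ^+ n)%R); last by rewrite /S big_ord_recr /=; ring.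
    by rewrite cabsM cabsX cabs_real ger0_norm// ltW.
  apply: le_trans (cabsB _ _) _.
  apply: le_trans (_ : 2 <= _)%R; last by rewrite lerDl.
  by rewrite mulr2n lerD// ltW// HN// ltnW.
exists (A * 2)%R; first by rewrite mulr_ge0.
move=> N z zk; apply: le_trans (cabs_sum _ _ _) _.
apply: le_trans (_ : \sum_(n < N) A * 2^-1 ^+ n <= _)%R.
  apply: ler_sum => n _; rewrite cabsM cabsX.
  apply: le_trans (_ : cabs (c n) * q ^+ n * 2^-1 ^+ n <= _)%R.
    have k0 : (0 <= k%:R :> R)%R by rewrite ler0n.
    rewrite -mulrA -exprMn ler_wpM2l ?cabs_ge0// lerXn2r ?nnegrE ?cabs_ge0//.
      by rewrite /q mulr2n; lra.
    by rewrite /q mulr2n; lra.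
  by rewrite ler_wpM2r// exprn_ge0.
rewrite -mulr_sumr ler_wpM2l//.
have : ((1 - 2^-1) * \sum_(n < N) 2^-1 ^+ n = 1 - 2^-1 ^+ N :> R)%R.
  have := @subrX1 R 2^-1 N; lra.
have : (0 <= 2^-1 ^+ N :> R)%R by rewrite exprn_ge0.
lra.
Qed.

Let Vk (k : nat) r : R := (V r * (r <= k%:R)%R%:R)%R.

Let mVk k : measurable_fun setT (Vk k).
Proof.
apply: measurable_funM => //.
apply: (@measurableT_comp _ _ _ _ _ _ (fun b : bool => (b%:R : measurableTypeR R))%R) => //.
exact: measurable_fun_ler.
Qed.

Let Vk0 k r : (0 <= Vk k r)%R.
Proof. by rewrite mulr_ge0. Qed.

Let pmono U (U0 : forall r, (0 <= U r)%R) M N : (M <= N)%N ->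
  \sum_(n < M) (cabs (c n) ^+ 2)%:E * moment U n <=
  \sum_(n < N) (cabs (c n) ^+ 2)%:E * moment U n.
Proof.
move=> MN; rewrite -(big_mkord xpredT (fun n => (cabs (c n) ^+ 2)%:E * moment U n)).
rewrite -(big_mkord xpredT (fun n => (cabs (c n) ^+ 2)%:E * moment U n)).
apply: lee_sum_nneg_natr => // n _ _.
by rewrite mule_ge0 ?lee_fin ?sqr_ge0//; exact: wnormsq_ge0.
Qed.

Lemma integrable_disc k (B : R) : (0 <= B)%R -> (area R).-integrable setT
  (fun p : T => (B * (cabs (complex_of_pair p) <= k%:R)%R%:R)%:E).
Proof.
move=> B0; pose D : set (measurableTypeR R) := `[(- k%:R)%R, k%:R%R]%classic.
have mD : measurable (D `*` D) by apply: measurableX; exact: measurable_itv.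
have fD : area R (D `*` D) < +oo.
  have -> : area R (D `*` D) = lebesgue_measure D * lebesgue_measure D.
    by apply: product_measure1E; exact: measurable_itv.
  by rewrite !lebesgue_measure_itv /=; case: ifP => _; rewrite ?mule0 ?ltry// -EFinB -EFinM ltry.
have iD : (area R).-integrable setT (fun p => (B * \1_(D `*` D) p)%:E).
  under eq_fun do rewrite EFinM; apply: integrableZl => //.
  apply/integrableP; split.
    apply/measurable_EFinP; exact: measurable_indic.
  under eq_integral do rewrite gee0_abs ?lee_fin//.
  by rewrite integral_indic ?setIT.
apply: le_integrable iD => //.
  apply/measurable_EFinP; apply: measurable_funM => //.
  apply: (@measurableT_comp _ _ _ _ _ _ (fun b : bool => (b%:R : measurableTypeR R))%R) => //.
  by apply: measurable_fun_ler => //; exact: measurableC_cabs measurableC_id.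
move=> [x y] _ /=; rewrite lee_fin !normrM ler_wpM2l// !ger0_norm//.
rewrite indicE; have [xyk|_] := leP (cabs (complex_of_pair (x, y))) k%:R%R; last by rewrite ler0n.
rewrite mem_set//=; split; rewrite /D /= in_itv /=.
  by rewrite -ler_norml; apply: le_trans (ler_Re_cabs (x +i* y)) xyk.
by rewrite -ler_norml; apply: le_trans (ler_Im_cabs (x +i* y)) xyk.
Qed.

(** On a disc the partial sums are uniformly bounded: dominated convergence. *)
Lemma wnormsq_disc_cvg k : wnormsq (Vk k) (S N) @[N --> \oo] --> wnormsq (Vk k) f.
Proof.
have [B B0 SB] := power_series_bounded k.
apply: (@dominated_cvg _ _ _ (area R) _ measurableT _ _
   (fun p : T => (B ^+ 2 * (cabs (complex_of_pair p) <= k%:R)%R%:R)%:E)) => //.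
- by move=> N; apply: measurable_wintegrand => //; exact: measurable_polyC.
- by move=> p _; exact: power_series_wintegrand_cvg.
- by apply: integrable_disc; exact: sqr_ge0.
- move=> N p _; rewrite gee0_abs; last exact: wintegrand_ge0.
  rewrite lee_fin /wintegrand.
  rewrite /Vk; have [zk|_] := leP (cabs (complex_of_pair p)) k%:R%R; last by rewrite !mulr0.
  rewrite !mulr1; apply: le_trans (_ : cabs (S N (complex_of_pair p)) ^+ 2 * 1 <= _)%R.
    by rewrite ler_wpM2l ?sqr_ge0.
  by rewrite mulr1 lerXn2r ?nnegrE ?cabs_ge0//; exact: SB.
Qed.

(** On each disc the inequality is the limit of the identity for polynomials;
    the discs then exhaust the plane. *)
Lemma wnormsq_psum_le N : psum N <= wnormsq V f.
Proof.
rewrite /psum -(wnormsq_poly mV V0) -/(S N).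
have H k : wnormsq (Vk k) (S N) <= wnormsq V f.
  apply: (@le_trans _ _ (wnormsq (Vk k) f)).
    have cv := @wnormsq_disc_cvg k.
    rewrite -(cvg_lim _ cv)//; apply: lime_ge; first by apply/cvg_ex; eexists; exact: cv.
    near=> M; rewrite /S !wnormsq_poly//; apply: pmono => //.
    by near: M; exact: nbhs_infty_ge.
  apply: ge0_le_integral => //.
  - by move=> p _; exact: wintegrand_ge0.
  - exact: measurable_wintegrand.
  - exact: measurable_wintegrand.
  - move=> p _; rewrite lee_fin ler_wpM2l ?sqr_ge0// /Vk ler_piMr//.
    by rewrite lern1; case: (_ <= _)%R.
apply: (fatou_le (g_ := fun k p => (wintegrand (Vk k) (S N) p)%:E)) => //.
- by move=> k; apply: measurable_wintegrand => //; exact: measurable_polyC.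
- by move=> k p; exact: wintegrand_ge0.
- move=> p; have := truncnS_gt (cabs (complex_of_pair p)); set m := _.+1 => pm.
  apply: cvg_near_cst; near=> k; rewrite /wintegrand /Vk (_ : (_ <= _)%R = true) ?mulr1//.
  apply: le_trans (ltW pm) _; rewrite ler_nat; near: k; exact: nbhs_infty_ge.
Unshelve. all: by end_near. Qed.

(** Fatou's lemma for the partial sums. *)
Lemma wnormsq_le_psum (A : \bar R) : (forall N, psum N <= A) -> wnormsq V f <= A.
Proof.
move=> pA; apply: (fatou_le (g_ := fun N p => (wintegrand V (S N) p)%:E)).
- by move=> N; apply: measurable_wintegrand => //; exact: measurable_polyC.
- by move=> N p; exact: wintegrand_ge0.
- by move=> p; exact: power_series_wintegrand_cvg.
- by move=> N; have := pA N; rewrite /psum -(wnormsq_poly mV V0).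
Qed.

End Parseval.
End WeightedNorm.

(** * The logarithmic weight *)

Section LogWeight.
Context {R : realType}.
Variable delta : R.
Hypothesis hdelta : 0 < delta < 1.
Local Notation p := (1 + delta).
Implicit Types x y r t : R.

(** The weight as a function of the modulus. *)
Definition lphi r : R := logplus r `^ p.
Definition lweight r : R := expR (- 2 * lphi r).

Let d0 : 0 < delta. Proof. by case/andP: hdelta. Qed.
Let d1 : delta < 1. Proof. by case/andP: hdelta. Qed.
Let p0 : 0 < p. Proof. by rewrite addr_gt0. Qed.

Lemma powR_split x : 0 <= x -> x `^ p = x * x `^ delta.
Proof.
move=> x0; rewrite powRD; last by apply/implyP => /eqP E; move: p0; rewrite E ltxx.
by rewrite powRr1.
Qed.

(** The graph of [x^p] lies above its tangent at [y]; this is Young's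
    inequality with exponents [p] and [p / delta]. *)
Lemma powR_tangent x y : 0 <= x -> 0 <= y ->
  p * y `^ delta * x <= x `^ p + delta * y `^ p.
Proof.
move=> x0 y0.
have q0 : 0 < p / delta by rewrite divr_gt0.
have pq : p^-1 + (p / delta)^-1 = 1 by field; rewrite !gt_eqF.
have := conjugate_powR x0 (powR_ge0 y delta) p0 q0 pq.
rewrite -powRrM mulrC [delta * _]mulrC divfK ?gt_eqF// => H.
have := ler_wpM2l (ltW p0) H.
rewrite mulrDr mulrC [p * (x `^ p / p)]mulrC divfK ?gt_eqF//.
rewrite (_ : p * (y `^ p / (p / delta)) = delta * y `^ p); last by field; rewrite !gt_eqF.
by rewrite [p * _ * _]mulrAC [x * _]mulrC mulrA mulrAC; move=> h; apply: le_trans h; rewrite mulrAC.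
Qed.

(** Concavity of [x^delta]: an increment of [x] by 1 raises it by at most 1. *)
Lemma powR_sub_le1 x y : 0 <= x -> 0 <= y -> x <= y + 1 -> x `^ delta <= y `^ delta + 1.
Proof.
move=> x0 y0 xy; have [x1|x1] := leP x 1.
  apply: le_trans (_ : 1 <= _); last by rewrite lerDr powR_ge0.
  have := @ge0_ler_powR R delta (ltW d0) x 1; rewrite !nnegrE powR1; apply=> //.
have yx : 0 <= x - 1 by rewrite subr_ge0 ltW.
have xs : x `^ delta = x * x `^ (delta - 1).
  have := @powRD R x 1 (delta - 1); rewrite addrC subrK powRr1//; apply.
  by apply/implyP => _; rewrite gt_eqF// (lt_trans ltr01).
have H1 : x `^ (delta - 1) <= 1.
  have := @ler_powR R x (ltW x1) (delta - 1) 0; rewrite powRr0; apply.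
  by rewrite subr_le0 ltW.
have H2 : (x - 1) * x `^ (delta - 1) <= (x - 1) `^ delta.
  have [x1'|x1'] := eqVneq (x - 1) 0; first by rewrite x1' mul0r powR_ge0.
  have x10 : 0 < x - 1 by rewrite lt_def x1'.
  have -> : (x - 1) `^ delta = (x - 1) * (x - 1) `^ (delta - 1).
    have := @powRD R (x - 1) 1 (delta - 1); rewrite addrC subrK powRr1//; apply.
    by rewrite x1' implybT.
  rewrite ler_wpM2l// -[delta - 1]opprB !powRN lef_pV2 ?posrE ?powR_gt0//; last first.
    exact: lt_trans x1.
  apply: ge0_ler_powR; rewrite ?nnegrE ?(ltW x10)//.
    by rewrite subr_ge0 ltW.
  by rewrite gerBl.
have H3 : (x - 1) `^ delta <= y `^ delta.
  by apply: ge0_ler_powR; rewrite ?nnegrE ?(ltW d0)// lerBlDr.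
by rewrite xs; lra.
Qed.

Lemma logplus_ge0 r : 0 <= logplus r :> R.
Proof. by rewrite /logplus le_max lexx orbT. Qed.

Lemma lphi_ge0 r : 0 <= lphi r. Proof. exact: powR_ge0. Qed.

(** In the variable [t = log r] the weight is [max(t, 0)^p], and the statement
    bounds its second difference with step [1/2]. With [a] and [c]
    the values of [max(t, 0)] at [t + 1/2] and [t - 1/2], [powR_tangent] bounds the
    right first difference above by [p/2 * a^delta] and the left one below by
    [p/2 * c^delta], and these two powers differ by at most 1. *)
Lemma lphi_second_difference r : 0 <= r ->
  lphi (expR (1 / 2) * r) + lphi (expR (- (1 / 2)) * r) <= 2 * lphi r + p / 2.
Proof.
rewrite le_eqVlt => /predU1P[<-|r0].
  rewrite !mulr0; have -> : lphi 0 = 0.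
    by rewrite /lphi /logplus ln0// maxxx powR0// gt_eqF.
  by rewrite mulr0 !add0r divr_ge0// ltW.
rewrite /lphi /logplus !lnM ?posrE ?expR_gt0// !expRK.
set t := ln r; set a := Num.max _ _; set c := Num.max _ _; set b := Num.max _ _.
have a0 : 0 <= a by rewrite /a le_max lexx orbT.
have b0 : 0 <= b by rewrite /b le_max lexx orbT.
have c0 : 0 <= c by rewrite /c le_max lexx orbT.
have ab : a - b <= 1 / 2.
  by rewrite /a /b /Num.max; case: ifP => //; case: ifP => //; lra.
have ac : a <= c + 1.
  by rewrite /a /c /Num.max; case: ifP => //; case: ifP => //; lra.
have b_le_a : b <= a.
  by rewrite /a /b /Num.max; case: ifP => //; case: ifP => //; lra.
(* Either [t <= 1/2], so that [c] vanishes, or the maxima [b] and [c] are both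
   attained by the logarithms. *)
have cbc : c = 0 /\ a <= 1 \/ b - c = 1 / 2.
  rewrite /a /b /c /Num.max; case: ifP => //; case: ifP => //; case: ifP => //; lra.
have Ha : a `^ p - b `^ p <= p * a `^ delta * (a - b).
  have := powR_tangent b0 a0; have := powR_split a0 => ->; lra.
have ad0 := powR_ge0 a delta.
have Hab : p * a `^ delta * (a - b) <= p * a `^ delta * (1 / 2).
  by rewrite ler_wpM2l// mulr_ge0// ltW.
have bp0 := powR_ge0 b p.
case: cbc => [[-> a1]|bc].
  rewrite powR0 ?gt_eqF//.
  have : a `^ delta <= 1.
    have := @ge0_ler_powR R delta (ltW d0) a 1; rewrite !nnegrE powR1; exact.
  move=> h; have := ler_wpM2l (ltW p0) h; lra.
have Hc : p * c `^ delta * (b - c) <= b `^ p - c `^ p.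
  have := powR_tangent b0 c0; have := powR_split c0 => ->; lra.
have := ler_wpM2l (ltW p0) (powR_sub_le1 a0 c0 ac); move: Hc; rewrite bc; lra.
Qed.

Lemma lweight_gt0 r : 0 < lweight r. Proof. exact: expR_gt0. Qed.

Lemma lweight_ge0 r : 0 <= lweight r. Proof. exact: ltW (lweight_gt0 r). Qed.

Lemma lweight_le1 r : lweight r <= 1.
Proof. by rewrite /lweight -expR0 ler_expR mulNr oppr_le0 mulr_ge0// lphi_ge0. Qed.

Lemma lweight1 r : r <= 1 -> lweight r = 1.
Proof.
move=> r1; rewrite /lweight /lphi /logplus (_ : Num.max _ _ = 0); last first.
  by apply/max_idPr; exact: ln_le0.
by rewrite powR0 ?gt_eqF// mulr0 expR0.
Qed.

Lemma measurable_lweight : measurable_fun [set: R] lweight.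
Proof.
apply: measurableT_comp => //; apply: measurable_funM => //.
apply: (@measurableT_comp _ _ _ _ _ _ (fun x : R => x `^ p)).
  exact: measurable_powR.
apply: (@measurableT_comp _ _ _ _ _ _ (fun x : R => Num.max x 0) _ (@ln R)) => //.
by apply: measurable_maxr.
Qed.

Lemma lweight_geometric_mean r : 0 <= r ->
  lweight r * expR (- (p / 2)) <=
  expR (- lphi (expR (1 / 2) * r)) * expR (- lphi (expR (- (1 / 2)) * r)).
Proof.
move=> r0; rewrite /lweight -!expRD ler_expR.
move: (lphi_second_difference r0).
move: (lphi r) (lphi (expR (1 / 2) * r)) (lphi (expR (- (1 / 2)) * r)) => u v w.
lra.
Qed.

(** The weight decreases faster than any power, because [t^(1 + delta)]
    dominates [m t] once [t^delta > m]. The factor [1 + r^2] squared is chosen to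
    dominate [(1 + x^2) (1 + y^2)], which splits the integral over the plane. *)
Lemma lweight_decay n : exists2 C : R, 0 <= C &
  forall r, 0 <= r -> r ^+ (n *2) * lweight r * (1 + r ^+ 2) ^+ 2 <= C.
Proof.
pose m : R := n%:R + 2.
have m0 : 0 < m by rewrite ltr_wpDl.
pose C := expR (2 * m * m `^ delta^-1).
have C1 : 1 <= C.
  rewrite /C -expR0 ler_expR !mulr_ge0// ?powR_ge0// ltW//.
exists (4 * C); first by rewrite mulr_ge0// (le_trans ler01).
move=> r r0; have [r1|r1] := leP r 1.
  rewrite lweight1// mulr1.
  have : (1 + r ^+ 2) ^+ 2 <= 4.
    have r2 : r ^+ 2 <= 1 by rewrite exprn_ile1.
    have : 0 <= r ^+ 2 by rewrite sqr_ge0.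
    by move=> ?; rewrite expr2; nra.
  have : r ^+ (n * 2) <= 1 by rewrite exprn_ile1.
  have : 0 <= r ^+ (n * 2) by rewrite exprn_ge0.
  by move=> *; nra.
have r00 : 0 < r by exact: lt_trans r1.
have H1 : (1 + r ^+ 2) ^+ 2 <= 4 * r ^+ 4.
  have r2 : 1 <= r ^+ 2 by rewrite exprn_ege1// ltW.
  rewrite (_ : 4 * r ^+ 4 = (2 * r ^+ 2) ^+ 2); last by rewrite exprMn -exprM -natrX.
  by rewrite lerXn2r ?nnegrE; lra.
apply: le_trans (_ : r ^+ (n * 2) * lweight r * (4 * r ^+ 4) <= _).
  by rewrite ler_wpM2l// mulr_ge0 ?lweight_ge0// exprn_ge0.
rewrite (_ : _ * _ = 4 * (r ^+ (n * 2 + 4) * lweight r)); last by rewrite exprD; ring.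
rewrite ler_pM2l// /lweight /lphi /logplus.
set t := ln r; have t0 : 0 < t by rewrite ln_gt0.
have -> : Num.max t 0 = t by apply/max_idPl; exact: ltW.
have -> : r = expR t by rewrite lnK.
rewrite -expRM_natl -expRD /C ler_expR powR_split ?(ltW t0)//.
have -> : (n * 2 + 4)%:R = 2 * m :> R by rewrite /m natrD natrM; ring.
have [tm|tm] := leP m (t `^ delta).
  apply: le_trans (_ : 0 <= _); last by rewrite !mulr_ge0 ?powR_ge0// ltW.
  rewrite (_ : _ + _ = - (2 * t * (t `^ delta - m))); last by ring.
  by rewrite oppr_le0 !mulr_ge0 ?subr_ge0// ltW.
have tM : t <= m `^ delta^-1.
  have -> : t = (t `^ delta) `^ delta^-1 by rewrite -powRrM divff ?gt_eqF// powRr1// ltW.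
  by apply: ge0_ler_powR; rewrite ?nnegrE ?powR_ge0 ?invr_ge0 ?(ltW d0) ?(ltW m0) ?(ltW tm).
have : 2 * m * t <= 2 * m * m `^ delta^-1 by rewrite ler_pM2l// mulr_gt0.
have : 0 <= 2 * (t * t `^ delta) by rewrite !mulr_ge0 ?powR_ge0// ltW.
lra.
Qed.

End LogWeight.

(** * Moments and their log-convexity *)

Lemma integral_lincomb_le d (T : measurableType d) (R : realType)
    (mu : {measure set T -> \bar R}) (W A B : T -> R) (k s t w a b : R) :
  measurable_fun setT (fun x => (W x)%:E) ->
  measurable_fun setT A -> measurable_fun setT B ->
  (forall x, 0 <= W x) -> (forall x, 0 <= A x) -> (forall x, 0 <= B x) ->
  (\int[mu]_x (W x)%:E = w%:E)%E -> (\int[mu]_x (A x)%:E = a%:E)%E ->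
  (\int[mu]_x (B x)%:E = b%:E)%E ->
  0 <= k -> 0 <= s -> 0 <= t ->
  (forall x, k * W x <= s * A x + t * B x) -> k * w <= s * a + t * b.
Proof.
move=> mW mA mB W0 A0 B0 IW IA IB k0 s0 t0 H.
have Zl (c : R) (g : T -> R) : 0 <= c -> (forall x, 0 <= g x) ->
    measurable_fun setT (fun x => (g x)%:E) ->
    (\int[mu]_x (c%:E * (g x)%:E) = c%:E * \int[mu]_x (g x)%:E)%E.
  by move=> c0 g0 mg; apply: ge0_integralZl_EFin => // x _; rewrite lee_fin.
have mA' : measurable_fun setT (fun x => (A x)%:E) by exact/measurable_EFinP.
have mB' : measurable_fun setT (fun x => (B x)%:E) by exact/measurable_EFinP.
suff : ((k * w)%:E <= (s * a + t * b)%:E)%E by rewrite lee_fin.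
rewrite EFinD !EFinM -IW -IA -IB -!Zl// -ge0_integralD//.
- apply: ge0_le_integral => //.
  + by move=> x _; rewrite -EFinM lee_fin mulr_ge0.
  + exact: measurable_funeM.
  + by apply: emeasurable_funD; exact: measurable_funeM.
  + by move=> x _; rewrite -!EFinM -EFinD lee_fin.
- by move=> x _; rewrite -EFinM lee_fin mulr_ge0.
- exact: measurable_funeM.
- by move=> x _; rewrite -EFinM lee_fin mulr_ge0.
- exact: measurable_funeM.
Qed.

Section Moments.
Context {R : realType}.
Variable delta : R.
Hypothesis hdelta : 0 < delta < 1.
Local Open Scope classical_set_scope.
Local Notation mu := (@lebesgue_measure R).
Local Notation T := (measurableTypeR R * measurableTypeR R)%type.
Local Notation V := (lweight delta).
Local Notation wpow n := (wintegrand V (fun z : R[i] => z ^+ n)).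

Let mV := measurable_lweight delta.
Let V0 := @lweight_ge0 R delta.

Lemma measurable_powC n : measurable_C (fun z : R[i] => z ^+ n).
Proof. exact/measurableC_X/measurableC_id. Qed.

Lemma measurable_wpow n : measurable_fun setT (fun p => (wpow n p)%:E).
Proof. by apply: measurable_wintegrand => //; exact: measurable_powC. Qed.

Lemma integral_oneDsqrV : (\int[mu]_x ((oneDsqr x)^-1)%:E = pi%:E)%E.
Proof.
have o0 (x : R) : 0 <= (oneDsqr x)^-1 by rewrite invr_ge0 (le_trans ler01)// oneDsqr_ge1.
rewrite (@ge0_symfun_integralT R (fun x => (oneDsqr x)^-1))//.
- rewrite (_ : [set x : R | 0 <= x] = `[0%R, +oo[); last first.
    by apply/seteqP; split => x /=; rewrite in_itv /= andbT.
  by rewrite integral0y_oneDsqr -EFinM; congr (_%:E); field.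
- exact: continuous_oneDsqrV.
- by move=> x /=; rewrite /oneDsqr sqrrN.
Qed.

Lemma moment_lty n : (moment V n < +oo)%E.
Proof.
have [C C0 HC] := lweight_decay hdelta n.
pose o (x : R) : R := (oneDsqr x)^-1.
have o0 x : 0 <= o x by rewrite invr_ge0 (le_trans ler01)// oneDsqr_ge1.
have mo : measurable_fun [set: measurableTypeR R] (o : measurableTypeR R -> measurableTypeR R).
  by apply: continuous_measurable_fun; exact: continuous_oneDsqrV.
have mF : measurable_fun setT (fun p : T => (C * (o p.1 * o p.2))%:E).
  apply/measurable_EFinP; apply: measurable_funM => //; apply: measurable_funM.
    by apply: measurableT_comp mo _; exact: measurable_fst.
  by apply: measurableT_comp mo _; exact: measurable_snd.
apply: le_lt_trans (_ : (\int[area R]_p (C * (o p.1 * o p.2))%:E < +oo)%E).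
  apply: ge0_le_integral => //.
  - by move=> p _; exact: wintegrand_ge0.
  - exact: measurable_wpow.
  - move=> [x y] _; rewrite lee_fin /wintegrand cabsX /o /oneDsqr /=.
    set r := cabs _; have r0 : 0 <= r by exact: cabs_ge0.
    have rE : r ^+ 2 = x ^+ 2 + y ^+ 2 by rewrite sqr_cabs.
    have X : 0 < 1 + x ^+ 2 by rewrite ltr_wpDr ?sqr_ge0.
    have Y : 0 < 1 + y ^+ 2 by rewrite ltr_wpDr ?sqr_ge0.
    rewrite -invfM ler_pdivlMr ?mulr_gt0//.
    apply: le_trans (HC r r0); rewrite -exprM.
    apply: ler_wpM2l; first by rewrite mulr_ge0 ?exprn_ge0.
    rewrite rE; have := sqr_ge0 x; have := sqr_ge0 y.
    by move: (x ^+ 2) (y ^+ 2) => a b *; rewrite expr2; nra.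
rewrite area_tonelli1//; last first.
  by move=> p; rewrite lee_fin mulr_ge0 ?mulr_ge0.
rewrite (eq_integral (fun x : measurableTypeR R => ((C * pi)%:E * (o x)%:E)%E)); last first.
  move=> x _ /=.
  under eq_integral do rewrite mulrA EFinM.
  rewrite ge0_integralZl ?lee_fin ?mulr_ge0//.
  - by rewrite integral_oneDsqrV -!EFinM mulrAC.
  - exact/measurable_EFinP.
  - by move=> y _; rewrite lee_fin.
rewrite ge0_integralZl ?lee_fin ?mulr_ge0 ?pi_ge0//.
- by rewrite integral_oneDsqrV -!EFinM ltry.
- exact/measurable_EFinP.
- by move=> y _; rewrite lee_fin.
Qed.

Definition hmoment n : R := fine (moment V n).

Lemma momentE n : moment V n = (hmoment n)%:E.
Proof.
rewrite /hmoment fineK// ge0_fin_numE; first exact: moment_lty.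
exact: wnormsq_ge0.
Qed.

(** The integrand is bounded below on a rectangle inside the unit disc, where
    the weight is 1. *)
Lemma hmoment_gt0 n : 0 < hmoment n.
Proof.
rewrite -lte_fin -momentE.
pose D1 : set (measurableTypeR R) := `[1 / 2, 3 / 5].
pose D2 : set (measurableTypeR R) := `[0, 1 / 2].
pose c : R := (1 / 2) ^+ (n * 2).
have c0 : 0 < c by rewrite exprn_gt0// divr_gt0.
have mD1 : measurable D1 by exact: measurable_itv.
have mD2 : measurable D2 by exact: measurable_itv.
have mD : measurable (D1 `*` D2) by exact: measurableX.
apply: (@lt_le_trans _ _ (\int[area R]_p (c%:E * (\1_(D1 `*` D2) p)%:E))%E).
  rewrite ge0_integralZl ?lee_fin ?(ltW c0)//; last first.
    by apply/measurable_EFinP; exact: measurable_indic.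
  rewrite integral_indic// setIT mule_gt0 ?lte_fin//.
  have -> : (area R (D1 `*` D2) = mu D1 * mu D2)%E by exact: product_measure1E.
  rewrite !lebesgue_measure_itv /= !lte_fin.
  rewrite (_ : (1 / 2 < 3 / 5 :> R) = true); last by lra.
  rewrite (_ : (0 < 1 / 2 :> R) = true); last by lra.
  by rewrite -!EFinB -EFinM lte_fin mulr_gt0//; lra.
apply: ge0_le_integral => //.
- by move=> p _; rewrite -EFinM lee_fin mulr_ge0// ltW.
- apply/measurable_EFinP; apply: measurable_funM => //; exact: measurable_indic.
- exact: measurable_wpow.
- move=> [x y] _; rewrite -EFinM lee_fin indicE.
  have [|_] := boolP (_ \in _); last by rewrite mulr0 -lee_fin wintegrand_ge0.
  rewrite inE => -[]; rewrite /D1 /D2 /= !in_itv /= => /andP[x1 x2] /andP[y1 y2].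
  rewrite mulr1 /wintegrand cabsX; set r := cabs _.
  have r0 : 0 <= r by exact: cabs_ge0.
  have r1 : r <= 1.
    rewrite -(@ler_pXn2r _ 2)// ?nnegrE// expr1n /r sqr_cabs /=.
    by rewrite !expr2; nra.
  rewrite lweight1// mulr1 -exprM /c lerXn2r ?nnegrE// ?divr_ge0//.
  apply: le_trans x1 _; apply: le_trans (ler_norm _) _.
  exact: (ler_Re_cabs (x +i* y)).
Qed.

Lemma integral_wpow_dilate n (s : R) : 0 < s ->
  (\int[area R]_p ((s * cabs (complex_of_pair p)) ^+ (n * 2) *
       V (s * cabs (complex_of_pair p)))%:E = (s ^- 2 * hmoment n)%:E)%E.
Proof.
move=> s0; rewrite EFinM -momentE /moment /wnormsq.
have F0 (p : T) : (0 <= (wpow n p)%:E)%E by exact: wintegrand_ge0.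
rewrite -(ge0_integral_dilate s0 (measurable_wpow n) F0).
apply: eq_integral => -[x y] _; rewrite /wintegrand /=.
have -> : complex_of_pair (s * x, s * y) = s%:C * complex_of_pair (x, y).
  by apply/eqP; rewrite eq_complex /= !mul0r subr0 addr0 !eqxx.
by rewrite cabsX -exprM cabsM cabs_real ger0_norm// ltW.
Qed.

(** Dilating the integrals of [h_(n+2)] and [h_n] by [s = e^(1/2)] and [1/s]
    makes the two powers of [s] and the two weights combine, in the
    arithmetic-geometric mean inequality, into [s^2 * kappa] times the integrand
    of [h_(n+1)], where [kappa] is the loss from [lweight_geometric_mean]. The
    gain is [(s^2 * kappa)^2 = e^(1 - delta)], larger than the factor 1 of the
    Cauchy-Schwarz inequality; all the geometric decay below comes from it. *)
Lemma hmoment_log_convex n :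
  expR (1 - delta) * hmoment n.+1 ^+ 2 <= hmoment n.+2 * hmoment n.
Proof.
pose s : R := expR (1 / 2); have s0 : 0 < s by exact: expR_gt0.
pose kappa := expR (- ((1 + delta) / 2)).
have k0 : 0 < kappa by exact: expR_gt0.
pose a := s ^- 2 * hmoment n.+2; pose b := s ^+ 2 * hmoment n.
pose c := s ^+ 2 * kappa * hmoment n.+1.
have a0 : 0 < a by rewrite mulr_gt0 ?hmoment_gt0// invr_gt0 exprn_gt0.
have c0 : 0 < c by rewrite mulr_gt0 ?hmoment_gt0// mulr_gt0// exprn_gt0.
have H tau : 0 < tau -> 2 * (s ^+ 2 * kappa) * hmoment n.+1 <= tau * a + tau^-1 * b.
  move=> t0; pose A (p : T) := (s * cabs (complex_of_pair p)) ^+ (n.+2 * 2) *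
     V (s * cabs (complex_of_pair p)).
  pose B (p : T) := (s^-1 * cabs (complex_of_pair p)) ^+ (n * 2) *
     V (s^-1 * cabs (complex_of_pair p)).
  have mcabs (k : R) : measurable_fun setT (fun p : T => k * cabs (complex_of_pair p)).
    by apply: measurable_funM => //; exact: measurableC_cabs measurableC_id.
  have mg m (k : R) : measurable_fun setT (fun p : T =>
      (k * cabs (complex_of_pair p)) ^+ m * V (k * cabs (complex_of_pair p))).
    apply: measurable_funM; first exact: measurable_funX.
    exact: (measurableT_comp mV).
  have A0 p : 0 <= A p.
    by rewrite mulr_ge0// exprn_ge0// mulr_ge0 ?cabs_ge0// ltW.
  have B0 p : 0 <= B p.
    by rewrite mulr_ge0// exprn_ge0// mulr_ge0 ?cabs_ge0// invr_ge0 ltW.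
  have IA : (\int[area R]_p (A p)%:E = a%:E)%E by rewrite /A integral_wpow_dilate.
  have IB : (\int[area R]_p (B p)%:E = b%:E)%E.
    by rewrite /B integral_wpow_dilate ?invr_gt0// exprVn invrK.
  have HP p : 2 * (s ^+ 2 * kappa) * wpow n.+1 p <= tau * A p + tau^-1 * B p.
    rewrite /A /B /wintegrand cabsX.
    set r := cabs _; have r0 : 0 <= r by exact: cabs_ge0.
    have sV : s^-1 = expR (- (1 / 2)) by rewrite expRN.
    pose E1 := expR (- lphi delta (s * r)); pose E2 := expR (- lphi delta (s^-1 * r)).
    have VE x : V x = expR (- lphi delta x) ^+ 2.
      by rewrite /lweight -expRM_natl mulrN mulNr.
    have gm : V r * kappa <= E1 * E2.
      by rewrite /E1 /E2 sV; exact: lweight_geometric_mean.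
    have -> : V (s * r) = E1 ^+ 2 by exact: VE.
    have -> : V (s^-1 * r) = E2 ^+ 2 by exact: VE.
    pose u := (s * r) ^+ n.+2 * E1; pose v := (s^-1 * r) ^+ n * E2.
    have -> : (s * r) ^+ (n.+2 * 2) * E1 ^+ 2 = u ^+ 2 by rewrite exprM -exprMn.
    have -> : (s^-1 * r) ^+ (n * 2) * E2 ^+ 2 = v ^+ 2 by rewrite exprM -exprMn.
    have uv : u * v = s ^+ 2 * (r ^+ n.+1) ^+ 2 * (E1 * E2).
      rewrite /u /v -[n.+2]addn2 exprD.
      have E : (s * r) ^+ n * (s^-1 * r) ^+ n = (r ^+ 2) ^+ n.
        by rewrite -exprMn mulrACA divff ?gt_eqF// mul1r.
      transitivity ((s * r) ^+ 2 * ((s * r) ^+ n * (s^-1 * r) ^+ n) * (E1 * E2)).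
        by ring.
      have E' : r ^+ 2 * (r ^+ 2) ^+ n = (r ^+ n.+1) ^+ 2.
        by rewrite -exprS -!exprM mulnC.
      by rewrite E exprMn -E'; ring.
    apply: le_trans (_ : 2 * (u * v) <= _).
      rewrite uv; have K0 : 0 <= 2 * (s ^+ 2 * (r ^+ n.+1) ^+ 2).
        by apply: mulr_ge0 => //; apply: mulr_ge0; exact: sqr_ge0.
      rewrite [X in _ <= X]mulrA; apply: le_trans (ler_wpM2l K0 gm).
      by rewrite le_eqVlt; apply/orP; left; apply/eqP; ring.
    have sq : 0 <= tau^-1 * (tau * u - v) ^+ 2.
      by apply: mulr_ge0; [rewrite invr_ge0 ltW|exact: sqr_ge0].
    rewrite (_ : tau^-1 * (tau * u - v) ^+ 2 =
        tau * u ^+ 2 + tau^-1 * v ^+ 2 - 2 * (u * v)) in sq; last first.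
      by field; rewrite gt_eqF.
    by rewrite subr_ge0 in sq.
  have mA : measurable_fun setT A by exact: (mg (n.+2 * 2)%N s).
  have mB : measurable_fun setT B by exact: (mg (n * 2)%N s^-1).
  clearbody A B.
  have W0 (p : T) : 0 <= wpow n.+1 p by rewrite -lee_fin; exact: wintegrand_ge0.
  have K0 : 0 <= 2 * (s ^+ 2 * kappa).
    by rewrite mulr_ge0// mulr_ge0 ?(ltW k0)// exprn_ge0// ltW.
  have ti : 0 <= tau^-1 by rewrite invr_ge0 ltW.
  exact: (integral_lincomb_le (measurable_wpow n.+1) mA mB W0 A0 B0
    (momentE n.+1) IA IB K0 (ltW t0) ti HP).
(* With this [tau] the first term on the right is half of the left-hand
   side. *)
have {}H := H (c / a) (divr_gt0 c0 a0).
have ab : c ^+ 2 <= a * b.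
  move: H; rewrite divfK ?gt_eqF// invf_div => H.
  have : c <= a / c * b by move: H; rewrite -mulrA -/c; lra.
  by rewrite mulrAC ler_pdivlMr// -expr2.
move: ab; rewrite /a /b /c.
have -> : s ^- 2 * hmoment n.+2 * (s ^+ 2 * hmoment n) = hmoment n.+2 * hmoment n.
  by field; rewrite gt_eqF.
apply: le_trans; rewrite exprMn ler_wpM2r ?sqr_ge0// exprMn -exprM.
rewrite /s /kappa -!expRM_natl -expRD ler_expR; lra.
Qed.

End Moments.

(** * Geometric decay and the Schur test *)

Section GeometricSums.
Context {R : realType}.

Definition gap (m n : nat) : nat := ((m - n) + (n - m))%N.

Lemma gapC m n : gap m n = gap n m.
Proof. by rewrite /gap addnC. Qed.

Lemma gapl m j : gap (m + j) m = j.
Proof. by rewrite /gap addKn; lia. Qed.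

Lemma gapr m j : gap m (m + j) = j.
Proof. by rewrite gapC gapl. Qed.

Lemma sum_geometric_le (x : R) N : 0 <= x < 1 -> \sum_(k < N) x ^+ k <= (1 - x)^-1.
Proof.
case/andP => x0 x1; rewrite -[leRHS]mul1r ler_pdivlMr ?subr_gt0//.
have := @subrX1 R x N; have : 0 <= x ^+ N by rewrite exprn_ge0.
move=> h1 h2; rewrite mulrC; lra.
Qed.

Lemma sum_gap_le (x : R) N m : 0 <= x < 1 ->
  \sum_(k < N) x ^+ gap k m <= 2 / (1 - x).
Proof.
move=> x01; have S0 := sum_geometric_le _ x01; have := x01 => /andP[x0 x1].
have le_sub M : (M <= N + m.+1)%N -> \sum_(k < N) x ^+ gap k m <=
  \sum_(k < N + m.+1) x ^+ gap k m.
  move=> _; rewrite big_split_ord /= lerDl; apply: sumr_ge0 => k _.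
  by rewrite exprn_ge0.
apply: le_trans (le_sub 0%N isT) _; rewrite addnC big_split_ord /=.
rewrite -[2]/(1 + 1) mulrDl mul1r lerD//.
  rewrite (reindex_inj rev_ord_inj) /=.
  rewrite (eq_bigr (fun k : 'I_m.+1 => x ^+ k)) => [|k _]; first exact: S0.
  by congr (_ ^+ _); rewrite /gap; have := ltn_ord k; lia.
apply: le_trans (S0 N); apply: ler_sum => k _.
rewrite (_ : gap _ _ = k.+1); last by rewrite /gap; lia.
by rewrite exprS ler_piMl ?exprn_ge0// ltW.
Qed.

Lemma weighted_cauchy_schwarz N (p b : nat -> R) : (forall i, 0 <= p i) ->
  (\sum_(i < N) p i * b i) ^+ 2 <=
  (\sum_(i < N) p i) * (\sum_(i < N) p i * b i ^+ 2).
Proof.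
move=> p0; have H : 0 <= \sum_(i < N) \sum_(j < N) p i * p j * (b i - b j) ^+ 2.
  by apply: sumr_ge0 => i _; apply: sumr_ge0 => j _; rewrite mulr_ge0 ?sqr_ge0// mulr_ge0.
have E : \sum_(i < N) \sum_(j < N) p i * p j * (b i - b j) ^+ 2 =
    2 * ((\sum_(i < N) p i) * (\sum_(i < N) p i * b i ^+ 2)) -
    2 * (\sum_(i < N) p i * b i) ^+ 2.
  transitivity (\sum_(i < N) \sum_(j < N) (p j * (p i * b i ^+ 2) +
      p i * (p j * b j ^+ 2) - 2 * ((p i * b i) * (p j * b j)))).
    by apply: eq_bigr => i _; apply: eq_bigr => j _; ring.
  under eq_bigr do rewrite sumrB big_split /= -mulr_suml -!mulr_sumr.
  rewrite sumrB big_split /= -mulr_sumr -mulr_suml -mulr_sumr -mulr_suml expr2; ring.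
lra.
Qed.

(** Cauchy-Schwarz with the weights [cabs (v n m)], of total mass at most
    [A]. *)
Lemma schur_test N M (v : nat -> nat -> R[i]) (a : nat -> R[i]) (A : R) : 0 <= A ->
  (forall m, (m < M)%N -> \sum_(n < N) cabs (v n m) <= A) ->
  (forall n, (n < N)%N -> \sum_(m < M) cabs (v n m) <= A) ->
  \sum_(m < M) cabs (\sum_(n < N) a n * v n m) ^+ 2 <=
  A ^+ 2 * \sum_(n < N) cabs (a n) ^+ 2.
Proof.
move=> A0 col row.
apply: (@le_trans _ _ (\sum_(m < M) A * \sum_(n < N) cabs (v n m) * cabs (a n) ^+ 2)).
  apply: ler_sum => m _.
  apply: le_trans (_ : (\sum_(n < N) cabs (v n m) * cabs (a n)) ^+ 2 <= _).
    rewrite lerXn2r ?nnegrE ?cabs_ge0//.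
      by apply: sumr_ge0 => n _; rewrite mulr_ge0 ?cabs_ge0.
    apply: le_trans (cabs_sum _ _ _) _.
    by apply: ler_sum => n _; rewrite cabsM mulrC.
  apply: le_trans (@weighted_cauchy_schwarz N (fun n => cabs (v n m))
    (fun n => cabs (a n)) (fun n => cabs_ge0 (v n m))) _.
  rewrite ler_wpM2r ?col//; apply: sumr_ge0 => n _.
  by rewrite mulr_ge0 ?cabs_ge0 ?sqr_ge0.
rewrite -mulr_sumr exchange_big /= expr2 -mulrA ler_wpM2l// mulr_sumr.
apply: ler_sum => n _; rewrite -mulr_suml ler_wpM2r ?sqr_ge0//.
exact: row.
Qed.

End GeometricSums.

(** * Lagrange interpolation *)

Section Interpolation.
Context {R : realType}.
Implicit Types (mu : nat -> R[i]).

(** The sum of the moduli of the coefficients, weighted by the powers of [rho],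
    is submultiplicative under multiplication by linear factors. *)
Lemma sum_coef_prod_le (I : Type) (s : seq I) (P : pred I) (z : I -> R[i]) (rho : R) :
  0 <= rho ->
  \sum_(m < size (\prod_(k <- s | P k) ('X - (z k)%:P)))
    cabs (\prod_(k <- s | P k) ('X - (z k)%:P))`_m * rho ^+ m <=
  \prod_(k <- s | P k) (rho + cabs (z k)).
Proof.
move=> rho0.
pose nrm (p : {poly R[i]}) := \sum_(m < size p) cabs p`_m * rho ^+ m.
have nrmE (p : {poly R[i]}) N : (size p <= N)%N -> nrm p = \sum_(m < N) cabs p`_m * rho ^+ m.
  move=> pN; rewrite /nrm -(subnKC pN) [RHS]big_split_ord /=.
  rewrite [X in _ = _ + X]big1 ?addr0// => i _.
  by rewrite nth_default ?cabs0 ?mul0r// leq_addr.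
have nrmX p w : nrm (('X - w%:P) * p) <= (rho + cabs w) * nrm p.
  have [->|p0] := eqVneq p 0.
    by rewrite mulr0 /nrm size_poly0 !big_ord0 mulr0.
  have sz : (size (('X - w%:P) * p)%R <= (size p).+1)%N.
    by apply: leq_trans (size_polyMleq _ _) _; rewrite size_XsubC.
  rewrite (nrmE _ _ sz) [leRHS]mulrDl.
  have -> : rho * nrm p = \sum_(m < (size p).+1) cabs ('X * p)%R`_m * rho ^+ m.
    rewrite big_ord_recl /= coefXM /= cabs0 mul0r add0r /nrm mulr_sumr.
    by apply: eq_bigr => i _; rewrite coefXM /= exprS mulrCA.
  have -> : cabs w * nrm p = \sum_(m < (size p).+1) cabs (w * p`_m) * rho ^+ m.
    rewrite (nrmE p (size p).+1)// mulr_sumr; apply: eq_bigr => i _.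
    by rewrite cabsM mulrA.
  rewrite -big_split /=; apply: ler_sum => m _.
  rewrite -mulrDl ler_wpM2r ?exprn_ge0// mulrBl coefB coefCM.
  exact: cabsB.
rewrite -/(nrm _); elim/big_rec2: _ => [|k y p Pk IH].
  by rewrite /nrm size_poly1 big_ord1 coef1 cabs1 expr0 mulr1.
apply: le_trans (nrmX p (z k)) _.
by rewrite ler_wpM2l// addr_ge0 ?cabs_ge0.
Qed.

Lemma coef_prod_le (I : Type) (s : seq I) (P : pred I) (z : I -> R[i]) (rho : R) m :
  0 <= rho ->
  cabs (\prod_(k <- s | P k) ('X - (z k)%:P))`_m * rho ^+ m <=
  \prod_(k <- s | P k) (rho + cabs (z k)).
Proof.
move=> rho0; set p := \prod_(k <- s | P k) _.
apply: le_trans (sum_coef_prod_le s P z rho0); rewrite -/p.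
have [mp|pm] := ltnP m (size p); last first.
  rewrite nth_default// cabs0 mul0r; apply: sumr_ge0 => i _.
  by rewrite mulr_ge0 ?cabs_ge0// exprn_ge0.
rewrite (bigD1 (Ordinal mp))//= lerDl; apply: sumr_ge0 => i _.
by rewrite mulr_ge0 ?cabs_ge0// exprn_ge0.
Qed.

Variables (mu : nat -> R[i]) (N : nat).
Hypothesis mu_inj : forall n m, mu n = mu m -> n = m.

Definition lagrange_poly (n : nat) : {poly R[i]} :=
  (\prod_(k < N | k != n :> nat) (mu n - mu k))^-1 *:
  \prod_(k < N | k != n :> nat) ('X - (mu k)%:P).

(** Row [n] lists the coefficients of the polynomial of degree less than [N]
    that is 1 at [mu n] and 0 at the other nodes: these rows form the inverse of
    the Vandermonde matrix of the nodes. *)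
Definition lagrange_coef n m : R[i] := (lagrange_poly n)`_m.

Lemma lagrange_prod_neq0 n : \prod_(k < N | k != n :> nat) (mu n - mu k) != 0.
Proof.
apply/prodf_neq0 => k kn; rewrite subr_eq0; apply: contraNneq kn => /mu_inj ->.
exact: eqxx.
Qed.

Lemma size_lagrange_poly n : (n < N)%N -> (size (lagrange_poly n) <= N)%N.
Proof.
move=> nN; apply: leq_trans (size_scale_leq _ _) _.
rewrite -big_filter size_prod_XsubC -(@size_map _ _ (@nat_of_ord N)).
set s := map _ _.
have us : uniq (n :: s).
  rewrite /= map_inj_uniq; last exact: val_inj.
  rewrite filter_uniq ?index_enum_uniq// andbT.
  by apply/mapP => -[k]; rewrite mem_filter => /andP[/eqP kn _] nk; exact: kn.
rewrite -[(size s).+1]/(size (n :: s)) -[leqRHS](size_iota 0).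
apply: uniq_leq_size us _ => k; rewrite inE mem_iota add0n /= => /predU1P[->//|].
by case/mapP => i _ ->.
Qed.

Lemma lagrange_polyE n j : (n < N)%N -> (j < N)%N ->
  (lagrange_poly n).[mu j] = (n == j)%:R.
Proof.
move=> nN jN; rewrite /lagrange_poly hornerZ horner_prod.
under eq_bigr do rewrite hornerXsubC.
have [->|nj] := eqVneq n j; first by rewrite mulVf// lagrange_prod_neq0.
rewrite [X in _ * X](bigD1 (Ordinal jN)) /=; last by rewrite eq_sym.
by rewrite subrr mul0r mulr0.
Qed.

Lemma sum_lagrange_coef n j : (n < N)%N -> (j < N)%N ->
  \sum_(m < N) lagrange_coef n m * mu j ^+ m = (n == j)%:R.
Proof.
move=> nN jN; rewrite -lagrange_polyE// (@horner_coef_wide _ N)//.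
exact: size_lagrange_poly.
Qed.

(** For square matrices a one-sided inverse is two-sided. *)
Lemma sum_lagrange_coefC m m' : (m < N)%N -> (m' < N)%N ->
  \sum_(n < N) lagrange_coef n m * mu n ^+ m' = (m == m')%:R.
Proof.
move=> mN m'N.
pose A : 'M[R[i]]_N := \matrix_(n, k) lagrange_coef n k.
pose B : 'M[R[i]]_N := \matrix_(k, j) mu j ^+ k.
have AB : A *m B = 1%:M.
  apply/matrixP => n j; rewrite !mxE -[n == j]/(n == j :> nat).
  rewrite -(sum_lagrange_coef (ltn_ord n) (ltn_ord j)).
  by apply: eq_bigr => k _; rewrite !mxE.
have := mulmx1C AB => /matrixP/(_ (Ordinal m'N) (Ordinal mN)).
rewrite !mxE -[Ordinal m'N == Ordinal mN]/(m' == m) eq_sym => <-.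
by apply: eq_bigr => n _; rewrite !mxE mulrC.
Qed.

Lemma lagrange_coef_le n m (rho : R) : 0 <= rho ->
  cabs (lagrange_coef n m) * rho ^+ m <=
  \prod_(k < N | k != n :> nat) ((rho + cabs (mu k)) / cabs (mu n - mu k)).
Proof.
move=> rho0; rewrite prodf_div mulrC ler_pdivlMr; last first.
  by rewrite -cabs_prod cabs_gt0 lagrange_prod_neq0.
rewrite -cabs_prod /lagrange_coef /lagrange_poly coefZ cabsM cabsV.
rewrite mulrCA mulrAC mulVf ?mul1r; last first.
  by rewrite cabs_eq0 lagrange_prod_neq0.
rewrite mulrC; exact: (coef_prod_le _ _ (fun k : 'I_N => mu k)).
Qed.

End Interpolation.

(** * Inverse of a nearly diagonal Vandermonde matrix *)

(** The two inequalities between consecutive [alpha] say that the entry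
    [r_n^m / alpha_m] of row [n] decreases at least at rate [q] as [m] moves away from the
    diagonal. Together they force the radii to grow at least geometrically, with
    ratio [q^-2]. *)
Section NearlyDiagonal.
Context {R : realType}.
Variables (alpha r : nat -> R) (q : R) (mu : nat -> R[i]).
Hypothesis q01 : 0 < q < 1.
Hypothesis alpha_gt0 : forall n, 0 < alpha n.
Hypothesis r0 : r 0%N = 0.
Hypothesis r_gt0 : forall n, 0 < r n.+1.
Hypothesis alpha_succ_le : forall k, alpha k.+1 <= q * r k.+1 * alpha k.
Hypothesis alpha_le_succ : forall k, r k * alpha k <= q * alpha k.+1.
Hypothesis cabs_mu : forall n, cabs (mu n) = r n.

Let q0 : 0 < q. Proof. by case/andP: q01. Qed.
Let q1 : q < 1. Proof. by case/andP: q01. Qed.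
Let x : R := q ^+ 2.
Let x0 : 0 < x. Proof. by rewrite exprn_gt0. Qed.
Let x1 : x < 1. Proof. by rewrite exprn_ilt1// ltW. Qed.

Let xX_ge0 j : 0 <= x ^+ j. Proof. by rewrite exprn_ge0// ltW. Qed.
Let xX_le1 j : x ^+ j <= 1. Proof. by rewrite exprn_ile1// ltW. Qed.
Let xX_lt1 j : (0 < j)%N -> x ^+ j < 1.
Proof. by move=> j0; rewrite exprn_ilt1 ?(ltW x0) ?x1// -lt0n. Qed.

Lemma radius_ge0 n : 0 <= r n.
Proof. by case: n => [|n]; rewrite ?r0// ltW. Qed.

Let rX_gt0 n : 0 < r n ^+ n.
Proof. by case: n => [|n]; rewrite ?expr0// exprn_gt0. Qed.

Let r_succ k : r k <= x * r k.+1.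
Proof.
rewrite -(ler_pM2r (alpha_gt0 k)); apply: le_trans (alpha_le_succ k) _.
rewrite /x expr2 -!mulrA ler_pM2l// mulrA; exact: alpha_succ_le.
Qed.

Let r_gap k j : r k <= x ^+ j * r (k + j)%N.
Proof.
elim: j => [|j IH]; first by rewrite addn0 expr0 mul1r.
by apply: le_trans IH _; rewrite addnS exprSr -mulrA ler_wpM2l ?xX_ge0.
Qed.

Let r_mono k l : (k <= l)%N -> r k <= r l.
Proof.
move=> /subnKC <-; apply: le_trans (r_gap k (l - k)) _.
by rewrite ler_piMl ?radius_ge0.
Qed.

Lemma r_gap_le k l : (k <= l)%N -> r k <= x ^+ gap k l * r l.
Proof. by move=> kl; have := r_gap k (l - k); rewrite subnKC// /gap (eqP kl) add0n. Qed.

Let r_lt k l : (k < l)%N -> r k < r l.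
Proof.
move=> kl; have rl : 0 < r l by case: l kl.
apply: le_lt_trans (r_gap_le (ltnW kl)) _.
by rewrite gtr_pMl// xX_lt1// /gap; lia.
Qed.

Lemma node_inj n m : mu n = mu m -> n = m.
Proof.
move=> /(congr1 (@cabs R)); rewrite !cabs_mu => E; apply/eqP; rewrite eqn_leq.
by apply/andP; split; rewrite leqNgt; apply/negP => /r_lt; rewrite E ltxx.
Qed.

Definition row_entry n m : R := r n ^+ m / alpha m.

Lemma row_entry_ge0 n m : 0 <= row_entry n m.
Proof. by rewrite divr_ge0 ?exprn_ge0 ?radius_ge0 ?ltW. Qed.

Lemma row_diag_gt0 n : 0 < row_entry n n.
Proof. by rewrite divr_gt0. Qed.

Lemma row_entry_decay n m : row_entry n m <= q ^+ gap n m * row_entry n n.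
Proof.
have [nm|mn] := leqP n m.
  rewrite -(subnKC nm); move: (m - n)%N => j {nm}; rewrite gapr.
  elim: j => [|j IH]; first by rewrite addn0 expr0 mul1r.
  rewrite addnS exprS -mulrA; apply: le_trans (_ : q * row_entry n (n + j) <= _).
    rewrite /row_entry exprS ler_pdivrMr// mulrAC -mulrA.
    rewrite [leRHS](_ : _ = r n ^+ (n + j) * (q * alpha (n + j).+1 / alpha (n + j))); last by ring.
    rewrite [leLHS]mulrC ler_wpM2l ?exprn_ge0 ?radius_ge0// ler_pdivlMr//.
    apply: le_trans (alpha_le_succ (n + j)); rewrite ler_wpM2r ?(ltW (alpha_gt0 _))//.
    by apply: r_mono; rewrite leq_addr.
  by rewrite ler_pM2l.
rewrite -(subnK (ltnW mn)); set j := (n - m)%N; have nE : n = (j + m)%N by rewrite subnK// ltnW.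
have -> : gap (j + m) m = j by rewrite addnC gapl.
have H i : (i <= j)%N -> row_entry n m <= q ^+ i * row_entry n (m + i).
  elim: i => [|i IH] ij; first by rewrite addn0 expr0 mul1r.
  apply: le_trans (IH (ltnW ij)) _; rewrite exprSr -mulrA ler_wpM2l ?exprn_ge0 ?(ltW q0)//.
  rewrite /row_entry addnS ler_pdivrMr// exprS.
  rewrite [leRHS](_ : _ = r n ^+ (m + i) *
    ((q * r n * alpha (m + i)) / alpha (m + i).+1)); last by ring.
  rewrite ler_peMr ?exprn_ge0 ?radius_ge0// ler_pdivlMr// mul1r.
  apply: le_trans (alpha_succ_le _) _; rewrite ler_wpM2r ?(ltW (alpha_gt0 _))//.
  by rewrite ler_wpM2l ?(ltW q0)//; apply: r_mono; rewrite nE; lia.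
by have := H j (leqnn j); rewrite addnC -nE.
Qed.

Let K : R := expR (2 / (1 - x) + 2 / (1 - x) / (1 - x)).

(** Radii are so lacunary that a sum [r_m + r_k] and a difference
    [mu_n - mu_k] have the size of the larger term, up to factors whose product
    over all [k] stays bounded. *)
Let factor_le n m k : k != n -> 
  (r m + r k) / cabs (mu n - mu k) <=
  (Num.max (r m) (r k) / Num.max (r n) (r k)) *
  expR (x ^+ gap k m + x ^+ gap k n / (1 - x)).
Proof.
move=> kn.
have big0 a b : a != b -> 0 < Num.max (r a) (r b).
  by case: a b => [|a] [|b] // _; rewrite lt_max ?r_gt0 ?orbT.
have gap1 a b : a != b -> x ^+ gap a b <= x.
  move=> ab; have : (0 < gap a b)%N by rewrite /gap; lia.
  by case: (gap a b) => // j _; rewrite exprS ler_piMr ?xX_le1 ?(ltW x0).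
have minmax a b : r a + r b <= Num.max (r a) (r b) * (1 + x ^+ gap b a).
  wlog ab : a b / (a <= b)%N.
    by move=> H; have [/H//|/ltnW/H] := leqP a b; rewrite addrC maxC gapC.
  rewrite (max_idPr (r_mono ab)) mulrDr mulr1 addrC lerD2l mulrC gapC.
  exact: r_gap_le.
have diff a b : Num.max (r a) (r b) * (1 - x ^+ gap b a) <= cabs (mu a - mu b).
  wlog ab : a b / (a <= b)%N.
    by move=> H; have [/H//|/ltnW/H] := leqP a b; rewrite cabs_distC maxC gapC.
  rewrite (max_idPr (r_mono ab)) mulrBr mulr1 cabs_distC.
  apply: le_trans (_ : r b - r a <= _).
    by rewrite lerD2l lerN2 mulrC gapC; exact: r_gap_le.
  by rewrite -!cabs_mu; apply: le_trans (ler_norm _) (cabs_dist _ _).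
set y := x ^+ gap k m; set z := x ^+ gap k n.
have y0 : 0 <= y by exact: xX_ge0.
have z0 : 0 <= z by exact: xX_ge0.
have zx : z <= x by exact: gap1.
have nk0 : 0 < Num.max (r n) (r k) by apply: big0; rewrite eq_sym.
have oz : 0 < 1 - z by rewrite subr_gt0; apply: le_lt_trans x1.
have D0 : 0 < cabs (mu n - mu k).
  by rewrite cabs_gt0 subr_eq0; apply: contraNneq kn => /node_inj ->.
have ox : 0 < 1 - x by rewrite subr_gt0.
have E1 : 1 + y <= expR y by exact: expR_ge1Dx.
have E2 : (1 - z)^-1 <= expR (z / (1 - x)).
  apply: le_trans (expR_ge1Dx _).
  have -> : (1 - z)^-1 = 1 + z / (1 - z) by field; rewrite gt_eqF.
  rewrite lerD2l ler_wpM2l// lef_pV2 ?posrE//; lra.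
apply: le_trans (_ : (Num.max (r m) (r k) * (1 + y)) /
   (Num.max (r n) (r k) * (1 - z)) <= _).
  apply: ler_pM; rewrite ?addr_ge0 ?radius_ge0 ?invr_ge0 ?cabs_ge0//.
  by rewrite lef_pV2 ?posrE// ?mulr_gt0//; exact: diff.
rewrite -mulf_div expRD ler_wpM2l//.
  by rewrite divr_ge0 ?(ltW nk0)// le_max radius_ge0.
by apply: ler_pM => //; rewrite ?addr_ge0// invr_ge0 ltW.
Qed.

Let tailprod N m : R := \prod_(m.+1 <= k < N) r k.

Let tailprod_gt0 N m : 0 < tailprod N m.
Proof.
rewrite /tailprod big_nat_cond; apply: prodr_gt0 => k /andP[/andP[mk _] _].
by case: k mk.
Qed.

Let tailprod_rec N m : (m.+1 < N)%N -> tailprod N m = r m.+1 * tailprod N m.+1.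
Proof. by move=> mN; rewrite /tailprod big_ltn. Qed.

Let prod_max N m : (m < N)%N ->
  \prod_(k < N | k != m :> nat) Num.max (r m) (r k) = r m ^+ m * tailprod N m.
Proof.
move=> mN.
transitivity (\prod_(0 <= k < N | k != m) Num.max (r m) (r k)); first by rewrite big_mkord.
rewrite (big_cat_nat (n := m)) ?(ltnW mN)//=; congr (_ * _).
  rewrite big_nat_cond (eq_bigl (fun k => (0 <= k < m)%N)); last by move=> k; lia.
  rewrite (eq_bigr (fun=> r m)) => [|k km]; last by apply/max_idPl/r_mono; lia.
  by rewrite -big_nat prodr_const_nat subn0.
rewrite big_ltn_cond// eqxx /= /tailprod big_nat_cond [RHS]big_nat_cond.
apply: eq_big => [k|k kN]; first by lia.
by apply/max_idPr/r_mono; lia.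
Qed.

(** The bound for the scaled inverse matrix in which each sum and difference is
    replaced by the larger of its two terms. *)
Let inv_bound N n m : R :=
  alpha m * r m ^- m * (r n ^+ n / alpha n) *
  \prod_(k < N | k != n :> nat) (Num.max (r m) (r k) / Num.max (r n) (r k)).

(** The products telescope: up to the position relative to the diagonal,
    [inv_bound] is the ratio of the values at [m] and at [n] of the sequence
    [G k = alpha_k * prod_(k < j < N) r_j], whose consecutive ratios are controlled
    by the two hypotheses on [alpha]. *)
Let inv_bound_le N n m : (n < N)%N -> (m < N)%N -> inv_bound N n m <= q ^+ gap n m.
Proof.
move=> nN mN.
pose G k := alpha k * tailprod N k.
have G0 k : 0 < G k by rewrite mulr_gt0.
have [<-|nm] := eqVneq n m.
  rewrite /inv_bound big1 => [|k kn]; last first.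
    rewrite divff// gt_eqF//; case: (n) (nat_of_ord k) kn => [|a] [|b] // _;
    by rewrite lt_max ?r_gt0 ?orbT.
  rewrite /gap subnn expr0 mulr1 le_eqVlt; apply/orP; left; apply/eqP.
  by field; rewrite !gt_eqF.
have max0 : 0 < Num.max (r m) (r n).
  by case: (n) (m) nm => [|a] [|b] // _; rewrite lt_max ?r_gt0 ?orbT.
have E : inv_bound N n m = G m / G n * (r m / Num.max (r m) (r n)).
  rewrite /inv_bound prodf_div (prod_max nN).
  have -> : \prod_(k < N | k != n :> nat) Num.max (r m) (r k) =
      r m * (r m ^+ m * tailprod N m) / Num.max (r m) (r n).
    rewrite -(prod_max mN); apply: (canRL (mulfK (lt0r_neq0 max0))).
    have D l (lN : (l < N)%N) : \prod_(k < N) Num.max (r m) (r k) =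
        Num.max (r m) (r l) * \prod_(k < N | k != l :> nat) Num.max (r m) (r k).
      by rewrite (bigD1 (Ordinal lN)).
    have := etrans (esym (D n nN)) (D m mN); rewrite maxxx => <-; exact: mulrC.
  rewrite /G; field; rewrite !gt_eqF//=.
rewrite E; have [mn|nm'] := leqP m n.
  rewrite (max_idPr (r_mono mn)).
  have H j : (m + j < N)%N -> r m * G m <= q ^+ j * (r (m + j)%N * G (m + j)%N).
    elim: j => [|j IH] jN; first by rewrite addn0 expr0 mul1r.
    have jN' : (m + j < N)%N by rewrite addnS in jN; exact: ltnW.
    apply: le_trans (IH jN') _; rewrite exprSr -mulrA ler_wpM2l ?exprn_ge0 ?(ltW q0)//.
    rewrite /G addnS (@tailprod_rec N (m + j)); last by rewrite -addnS.
    set S := tailprod N (m + j).+1; have S0 : 0 < S by exact: tailprod_gt0.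
    have h := ler_wpM2l (ltW (mulr_gt0 (r_gt0 (m + j)) S0)) (alpha_le_succ (m + j)).
    by apply: le_trans (le_trans _ h) _; rewrite le_eqVlt; apply/orP; left;
      apply/eqP; ring.
  have nE : n = (m + (n - m))%N by rewrite subnKC.
  have := H (n - m)%N; rewrite -nE => /(_ nN) h.
  rewrite (_ : gap n m = (n - m)%N); last by rewrite /gap; lia.
  have rn : 0 < r n by case: (n) (m) nm mn => [|a] [|b].
  rewrite mulf_div ler_pdivrMr ?mulr_gt0// mulrC [G n * _]mulrC; exact: h.
rewrite (max_idPl (r_mono (ltnW nm'))).
have rm : 0 < r m by case: (m) nm'.
rewrite divff ?gt_eqF// mulr1 ler_pdivrMr//.
have H j : (n + j < N)%N -> G (n + j)%N <= q ^+ j * G n.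
  elim: j => [|j IH] jN; first by rewrite addn0 expr0 mul1r.
  have jN' : (n + j < N)%N by rewrite addnS in jN; exact: ltnW.
  rewrite exprS -mulrA; apply: le_trans (_ : q * G (n + j)%N <= _); last first.
    by rewrite ler_pM2l//; exact: IH.
  rewrite /G addnS [tailprod N (n + j)]tailprod_rec; last by rewrite -addnS.
  rewrite !mulrA ler_pM2r// mulrAC; exact: alpha_succ_le.
have mE : m = (n + (m - n))%N by rewrite subnKC// ltnW.
have := H (m - n)%N; rewrite -mE (_ : gap n m = (m - n)%N); last by rewrite /gap; lia.
by apply.
Qed.

(** The Lagrange coefficient is estimated by [lagrange_coef_le] with [rho = r m],
    the radius that matches the column. The constant does not depend on [N]. *)
Lemma lagrange_coef_decay N n m : (n < N)%N -> (m < N)%N ->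
  cabs (lagrange_coef mu N n m) * alpha m * row_entry n n <= K * q ^+ gap n m.
Proof.
move=> nN mN.
have H := lagrange_coef_le N node_inj n m (radius_ge0 m).
have P0 k : 0 <= Num.max (r m) (r k) / Num.max (r n) (r k).
  by rewrite divr_ge0// le_max radius_ge0.
have H2 : \prod_(k < N | k != n :> nat) ((r m + cabs (mu k)) / cabs (mu n - mu k)) <=
    \prod_(k < N | k != n :> nat) (Num.max (r m) (r k) / Num.max (r n) (r k)) * K.
  apply: le_trans (_ : \prod_(k < N | k != n :> nat)
     ((Num.max (r m) (r k) / Num.max (r n) (r k)) *
      expR (x ^+ gap k m + x ^+ gap k n / (1 - x))) <= _).
    apply: ler_prod => k kn; rewrite cabs_mu divr_ge0 ?cabs_ge0 ?addr_ge0 ?radius_ge0//=.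
    exact: factor_le.
  rewrite big_split /= ler_wpM2l ?prodr_ge0// -expR_sum ler_expR.
  apply: le_trans (_ : \sum_(k < N) (x ^+ gap k m + x ^+ gap k n / (1 - x)) <= _).
    rewrite [leRHS](bigID (fun k : 'I_N => k != n :> nat)) /= lerDl.
    apply: sumr_ge0 => k _; rewrite addr_ge0 ?divr_ge0 ?xX_ge0//.
    by rewrite subr_ge0 ltW.
  rewrite big_split /= -mulr_suml.
  have x01 : 0 <= x < 1 by rewrite (ltW x0) x1.
  by rewrite lerD ?sum_gap_le// ler_wpM2r ?sum_gap_le// invr_ge0 subr_ge0 ltW.
have {}H := le_trans H H2.
rewrite -(ler_pM2r (rX_gt0 m)).
apply: le_trans (_ : K * (inv_bound N n m) * r m ^+ m <= _); last first.
  by rewrite ler_pM2r// ler_pM2l ?expR_gt0//; exact: inv_bound_le.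
have ab : 0 <= alpha m * row_entry n n by rewrite mulr_ge0 ?row_entry_ge0 ?ltW.
have := ler_wpM2l ab H.
rewrite /inv_bound /row_entry; set P := \prod_(_ < _ | _) _; set c := cabs _.
have rm : r m ^+ m != 0 by rewrite gt_eqF.
have -> : c * alpha m * (r n ^+ n / alpha n) * r m ^+ m =
  alpha m * (r n ^+ n / alpha n) * (c * r m ^+ m) by ring.
move=> h; apply: le_trans h _; rewrite le_eqVlt; apply/orP; left; apply/eqP.
by field; rewrite rm gt_eqF.
Qed.

End NearlyDiagonal.

(** * The matrix of normalized kernels *)

Section RieszMatrix.
Context {R : realType}.
Variables (alpha r : nat -> R) (q : R) (mu : nat -> R[i]).
Hypothesis q01 : 0 < q < 1.
Hypothesis alpha_gt0 : forall n, 0 < alpha n.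
Hypothesis r0 : r 0%N = 0.
Hypothesis r_gt0 : forall n, 0 < r n.+1.
Hypothesis alpha_succ_le : forall k, alpha k.+1 <= q * r k.+1 * alpha k.
Hypothesis alpha_le_succ : forall k, r k * alpha k <= q * alpha k.+1.
Hypothesis cabs_mu : forall n, cabs (mu n) = r n.
Variables (nu : nat -> R) (L : R).
Hypothesis nu_ge : forall n, row_entry alpha r n n <= nu n.
Hypothesis nu_le : forall n, nu n <= L * row_entry alpha r n n.

Let q0 : 0 < q. Proof. by case/andP: q01. Qed.
Let q1 : q < 1. Proof. by case/andP: q01. Qed.
Let q_ge0_lt1 : 0 <= q < 1. Proof. by rewrite (ltW q0). Qed.
Let diag0 n : 0 < row_entry alpha r n n. Proof. exact: row_diag_gt0. Qed.
Let nu0 n : 0 < nu n. Proof. exact: lt_le_trans (nu_ge n). Qed.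
Let L0 : 0 < L.
Proof.
have := lt_le_trans (nu0 0%N) (nu_le 0%N).
by rewrite pmulr_lgt0.
Qed.

(** The coordinates, in the orthonormal basis of normalized monomials, of the
    kernel at [conj mu_n] divided by a number [nu_n] comparable with its
    norm. *)
Definition kernel_entry n m : R[i] := mu n ^+ m / (alpha m * nu n)%:C.

Let v := kernel_entry.

Lemma kernel_entry_decay n m : cabs (v n m) <= q ^+ gap n m.
Proof.
rewrite /v /kernel_entry cabsM cabsX cabsV cabs_real cabs_mu.
rewrite ger0_norm ?mulr_ge0 ?(ltW (alpha_gt0 _)) ?(ltW (nu0 _))// invfM mulrA.
rewrite ler_pdivrMr//.
apply: le_trans (row_entry_decay q01 alpha_gt0 r0 r_gt0 alpha_succ_le alpha_le_succ n m) _.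
by rewrite ler_wpM2l// exprn_ge0// ltW.
Qed.

(** The inverse of the leading [N] by [N] block of [kernel_entry], up to
    transposition. *)
Let t N n m : R[i] := lagrange_coef mu N n m * (alpha m * nu n)%:C.

Let inj : forall n m, mu n = mu m -> n = m :=
  node_inj q01 alpha_gt0 r_gt0 alpha_succ_le alpha_le_succ cabs_mu.

Let t_bound : exists2 K : R, 0 < K & forall N n m, (n < N)%N -> (m < N)%N ->
  cabs (t N n m) <= K * q ^+ gap n m.
Proof.
have D := lagrange_coef_decay q01 alpha_gt0 r0 r_gt0 alpha_succ_le alpha_le_succ cabs_mu.
set K := expR _ in D; have K0 : 0 < K by exact: expR_gt0.
exists (L * K) => [|N n m nN mN]; first exact: mulr_gt0.
rewrite /t cabsM cabs_real ger0_norm ?mulr_ge0 ?(ltW (alpha_gt0 _)) ?(ltW (nu0 _))//.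
rewrite -[leRHS]mulrA mulrA; apply: le_trans (ler_wpM2l (ltW L0) (D _ _ _ nN mN)).
rewrite [leRHS]mulrCA ler_wpM2l// mulr_ge0 ?cabs_ge0//; exact: ltW.
Qed.

Let nuC_neq0 n : (nu n)%:C != 0 :> R[i].
Proof. by rewrite eq_complex /= negb_and gt_eqF. Qed.

Let alphaC_neq0 m : (alpha m)%:C != 0 :> R[i].
Proof. by rewrite eq_complex /= negb_and gt_eqF. Qed.

Let t_row N n j : (n < N)%N -> (j < N)%N ->
  \sum_(m < N) t N n m * v j m = (n == j)%:R.
Proof.
move=> nN jN.
have E m : t N n m * v j m =
    (nu n)%:C / (nu j)%:C * (lagrange_coef mu N n m * mu j ^+ m).
  rewrite /t /v /kernel_entry !rmorphM /=; field.
  by rewrite nuC_neq0 alphaC_neq0.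
under eq_bigr do rewrite E.
rewrite -mulr_sumr sum_lagrange_coef//.
by have [->|_] := eqVneq n j; rewrite ?mulr0// divff// mul1r.
Qed.

Let t_col N m m' : (m < N)%N -> (m' < N)%N ->
  \sum_(n < N) t N n m * v n m' = (m == m')%:R.
Proof.
move=> mN m'N.
have E n : t N n m * v n m' =
    (alpha m)%:C / (alpha m')%:C * (lagrange_coef mu N n m * mu n ^+ m').
  rewrite /t /v /kernel_entry !rmorphM /=; field.
  by rewrite nuC_neq0 alphaC_neq0.
under eq_bigr do rewrite E.
rewrite -mulr_sumr sum_lagrange_coefC//.
by have [->|_] := eqVneq m m'; rewrite ?mulr0// divff// mul1r.
Qed.

Let sum_scaled_gap_le N m (K : R) : 0 <= K -> \sum_(k < N) K * q ^+ gap k m <= K * (2 / (1 - q)).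
Proof. by move=> K0; rewrite -mulr_sumr ler_wpM2l// sum_gap_le. Qed.

Lemma kernel_matrix_upper : exists2 C : R, 0 < C & forall N M (a : nat -> R[i]),
  \sum_(m < M) cabs (\sum_(n < N) a n * v n m) ^+ 2 <=
  C * \sum_(n < N) cabs (a n) ^+ 2.
Proof.
have A0 : 0 < 2 / (1 - q) by rewrite divr_gt0// subr_gt0.
exists ((2 / (1 - q)) ^+ 2) => [|N M a]; first by rewrite exprn_gt0.
apply: schur_test; first exact: ltW.
- move=> m _; apply: le_trans (sum_gap_le N m q_ge0_lt1).
  by apply: ler_sum => n _; exact: kernel_entry_decay.
- move=> n _; apply: le_trans (sum_gap_le M n q_ge0_lt1).
  by apply: ler_sum => m _; rewrite gapC; exact: kernel_entry_decay.
Qed.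

(** Schur's test for the inverse of the leading block, uniformly in the size of
    the block. *)
Lemma kernel_matrix_lower : exists2 C : R, 0 < C & forall N (a : nat -> R[i]),
  \sum_(n < N) cabs (a n) ^+ 2 <=
  C * \sum_(m < N) cabs (\sum_(n < N) a n * v n m) ^+ 2.
Proof.
have [K K0 tK] := t_bound.
have A0 : 0 < K * (2 / (1 - q)) by rewrite mulr_gt0// divr_gt0// subr_gt0.
exists ((K * (2 / (1 - q))) ^+ 2) => [|N a]; first by rewrite exprn_gt0.
pose S m := \sum_(n < N) a n * v n m.
have aE (j : 'I_N) : a j = \sum_(m < N) S m * t N j m.
  under eq_bigr do rewrite /S mulr_suml.
  rewrite exchange_big /=.
  transitivity (\sum_(n < N) a n * (j == n :> nat)%:R).
    rewrite (bigD1 j)//= eqxx mulr1 big1 ?addr0// => n nj.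
    by rewrite (_ : (j == n :> nat) = false) ?mulr0// eq_sym; exact/negbTE.
  apply: eq_bigr => n _; rewrite -(@t_row N)// mulr_sumr.
  apply: eq_bigr => m _; ring.
have -> : \sum_(n < N) cabs (a n) ^+ 2 =
    \sum_(n < N) cabs (\sum_(m < N) S m * t N n m) ^+ 2.
  by apply: eq_bigr => j _; rewrite aE.
apply: (@schur_test _ N N (fun m n => t N n m) S); first exact: ltW.
- move=> n nN; apply: le_trans (sum_scaled_gap_le N n (ltW K0)).
  by apply: ler_sum => m _; rewrite gapC; exact: tK.
- move=> m mN; apply: le_trans (sum_scaled_gap_le N m (ltW K0)).
  by apply: ler_sum => n _; exact: tK.
Qed.

Let p : R := Num.sqrt q.
Let p0 : 0 < p. Proof. by rewrite sqrtr_gt0. Qed.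
Let p1 : p < 1. Proof. by rewrite -sqrtr1 ltr_sqrt. Qed.

(** The finite combination of rows that reproduces a finitely supported [s] in
    the columns below [N], by inverting the leading block. In the columns beyond
    [N] both the inverse and the matrix have decayed; one square root of the
    decay pays for the sum over the rows, the other gives [B * sqrt q ^ m] with [B]
    independent of [N]. *)
Lemma kernel_matrix_finite_section (s : nat -> R[i]) M : exists2 B : R, 0 <= B &
  forall N, (M <= N)%N -> exists a : nat -> R[i],
    (forall m, (m < N)%N ->
       \sum_(n < N) a n * v n m = if (m < M)%N then s m else 0) /\
    (forall m, (N <= m)%N -> cabs (\sum_(n < N) a n * v n m) <= B * p ^+ m).
Proof.
have [K K0 tK] := t_bound.
have p01 : 0 <= p < 1 by rewrite (ltW p0).
have pX j : 0 < p ^+ j by rewrite exprn_gt0.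
exists (\sum_(m < M) cabs (s m) * K / p ^+ m * (2 / (1 - p))).
  apply: sumr_ge0 => m _; rewrite mulr_ge0//.
    by rewrite divr_ge0 ?(ltW (pX _))// mulr_ge0 ?cabs_ge0// ltW.
  by rewrite divr_ge0// subr_ge0 ltW.
move=> N MN; exists (fun n => \sum_(m < M) s m * t N n m).
have E m' : \sum_(n < N) (\sum_(m < M) s m * t N n m) * v n m' =
    \sum_(m < M) s m * \sum_(n < N) t N n m * v n m'.
  under eq_bigr do rewrite mulr_suml.
  rewrite exchange_big /=; apply: eq_bigr => m _; rewrite mulr_sumr.
  by apply: eq_bigr => n _; rewrite mulrA.
split=> m' m'N; rewrite E.
  transitivity (\sum_(m < M) s m * (m == m' :> nat)%:R).
    apply: eq_bigr => m _; rewrite t_col//; exact: leq_trans MN.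
  case: ifPn => [m'M|]; last first.
    rewrite -leqNgt => Mm'; rewrite big1// => m _.
    by rewrite (_ : (m == m' :> nat) = false) ?mulr0//; have := ltn_ord m; lia.
  rewrite (bigD1 (Ordinal m'M))//= eqxx mulr1 big1 ?addr0// => m.
  by rewrite -val_eqE /= => /negPf ->; rewrite mulr0.
apply: le_trans (cabs_sum _ _ _) _; rewrite mulr_suml; apply: ler_sum => m _.
have mN : (m < N)%N by exact: leq_trans MN.
rewrite cabsM -!mulrA ler_wpM2l ?cabs_ge0//.
apply: le_trans (cabs_sum _ _ _) _.
apply: le_trans (_ : \sum_(n < N) K * (p ^+ m' / p ^+ m) * p ^+ gap n m' <= _).
  apply: ler_sum => n _; rewrite cabsM.
  apply: le_trans (ler_pM (cabs_ge0 _) (cabs_ge0 _) (tK _ _ _ (ltn_ord n) mN)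
    (kernel_entry_decay n m')) _.
  rewrite -!mulrA ler_pM2l//.
  rewrite (_ : p ^+ m' = p ^+ (m' - m) * p ^+ m); last first.
    by rewrite -exprD subnK// ltnW// (leq_trans mN).
  rewrite -mulrA [p ^+ m * _]mulrA divff ?gt_eqF// mul1r.
  rewrite -!exprD (_ : q = p ^+ 2); last by rewrite sqr_sqrtr// ltW.
  rewrite -exprM; apply: ler_wiXn2l; rewrite ?(ltW p0) ?(ltW p1)//.
  by rewrite /gap; have := ltn_ord n; lia.
rewrite -mulr_sumr [leRHS](_ : _ = K * (p ^+ m' / p ^+ m) * (2 / (1 - p))); last by ring.
rewrite ler_wpM2l ?sum_gap_le// mulr_ge0 ?(ltW K0)// divr_ge0 ?ltW//.
Qed.

End RieszMatrix.

(** * Power series in the weighted space *)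

Section PowerSeriesAlgebra.
Context {R : realType}.
Implicit Types (f g : R[i] -> R[i]) (c d : nat -> R[i]).

Lemma power_seriesD f g c d : power_series f c -> power_series g d ->
  power_series (fun z => f z + g z) (fun n => c n + d n).
Proof.
move=> fc gd z.
under eq_fun do (under eq_bigr do rewrite mulrDl; rewrite big_split /=).
exact: cvgD (@fc z) (@gd z).
Qed.

Lemma power_seriesZ (a : R[i]) f c : power_series f c ->
  power_series (fun z => a * f z) (fun n => a * c n).
Proof.
move=> fc z.
under eq_fun do (under eq_bigr do rewrite -mulrA; rewrite -mulr_sumr).
by apply: cvgMl_tmp (@fc z).
Qed.

Lemma power_seriesB f g c d : power_series f c -> power_series g d ->
  power_series (fun z => f z - g z) (fun n => c n - d n).
Proof.
move=> fc gd' z; have gd := power_seriesZ (a := -1) gd'; have := power_seriesD fc gd.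
under eq_fun do rewrite mulN1r.
by move=> /(_ z); under eq_fun do under eq_bigr do rewrite mulN1r.
Qed.

Lemma power_seriesX m :
  power_series (fun z : R[i] => z ^+ m) (fun n => (n == m)%:R).
Proof.
move=> z; apply: cvg_near_cst; near=> N.
have mN : (m < N)%N by near: N; exact: nbhs_infty_gt.
rewrite (bigD1 (Ordinal mN))//= eqxx mul1r big1 ?addr0// => n.
by rewrite -val_eqE /= => /negPf ->; rewrite mul0r.
Unshelve. all: by end_near. Qed.

Lemma power_series_lincomb (e : nat -> R[i] -> R[i]) (ce : nat -> nat -> R[i]) N a :
  (forall n, power_series (e n) (ce n)) ->
  power_series (lincomb e N a) (fun m => \sum_(n < N) a n * ce n m).
Proof.
move=> ec; elim: N => [|N IH].
  move=> z; rewrite /lincomb big_ord0; apply: cvg_near_cst; apply: nearW => N.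
  by rewrite big1// => n _; rewrite big_ord0 mul0r.
have := power_seriesD IH (power_seriesZ (a := a N) (ec N)).
move=> H z; rewrite /lincomb big_ord_recr /=.
under eq_fun do under eq_bigr do rewrite big_ord_recr /=.
exact: (H z).
Qed.

End PowerSeriesAlgebra.

Section WeightedCoefficients.
Context {R : realType}.
Variables (V : R -> R) (h : nat -> R).
Hypothesis mV : measurable_fun setT V.
Hypothesis V0 : forall r, 0 <= V r.
Hypothesis V1 : forall r, V r <= 1.
Hypothesis hE : forall n, moment V n = (h n)%:E.
Implicit Types (f g : R[i] -> R[i]) (c d : nat -> R[i]).

Definition coef_normsq c N : R := \sum_(n < N) cabs (c n) ^+ 2 * h n.

Let coef_normsqE c N :
  (\sum_(n < N) (cabs (c n) ^+ 2)%:E * moment V n = (coef_normsq c N)%:E)%E.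
Proof. by rewrite /coef_normsq -sumEFin; apply: eq_bigr => n _; rewrite hE. Qed.

Lemma moment_coef_ge0 n : 0 <= h n.
Proof. by rewrite -lee_fin -hE; exact: wnormsq_ge0. Qed.

Lemma coef_normsq_le f c : power_series f c -> (wnormsq V f < +oo)%E ->
  forall N, coef_normsq c N <= fine (wnormsq V f).
Proof.
move=> fc foo N; rewrite -lee_fin fineK ?ge0_fin_numE ?wnormsq_ge0//.
by rewrite -coef_normsqE; exact: (wnormsq_psum_le mV V0 V1 fc).
Qed.

Lemma wnormsq_le_coef f c (A : R) : power_series f c ->
  (forall N, coef_normsq c N <= A) -> (wnormsq V f <= A%:E)%E.
Proof.
move=> fc cA; apply: (wnormsq_le_psum mV V0 fc) => N.
by rewrite coef_normsqE lee_fin.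
Qed.

Lemma coef_normsq_homo c : {homo coef_normsq c : N M / (N <= M)%N >-> N <= M}.
Proof.
move=> N M /subnKC <-; rewrite /coef_normsq big_split_ord /= lerDl.
by apply: sumr_ge0 => n _; rewrite mulr_ge0 ?sqr_ge0 ?moment_coef_ge0.
Qed.

(** By Parseval's identity only the coefficient of index [m] contributes to the
    difference. Together with the case of the perturbation by [- w * z^m] this
    becomes the equality of [fine_wnormsqD_monomial]. *)
Lemma wnormsqD_monomial f c m w : power_series f c -> (wnormsq V f < +oo)%E ->
  (wnormsq V (fun z => f z + w * z ^+ m)%R <=
   (fine (wnormsq V f) + (cabs (c m + w) ^+ 2 - cabs (c m) ^+ 2) * h m)%:E)%E.
Proof.
move=> fc foo.
have gd := power_seriesD fc (power_seriesZ (a := w) (@power_seriesX R m)).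
apply: (wnormsq_le_coef gd) => N.
pose M := maxn N m.+1.
apply: le_trans (coef_normsq_homo _ (leq_maxl N m.+1)) _.
have mM : (m < maxn N m.+1)%N by rewrite leq_max leqnn orbT.
apply: le_trans (lerD (coef_normsq_le fc foo (maxn N m.+1)) (lexx _)).
rewrite /coef_normsq (bigD1 (Ordinal mM))//= [in leRHS](bigD1 (Ordinal mM))//=.
rewrite eqxx mulr1 (eq_bigr (fun n : 'I_(maxn N m.+1) => cabs (c n) ^+ 2 * h n)); last first.
  by move=> n; rewrite -val_eqE /= => /negPf ->; rewrite mulr0 addr0.
by rewrite le_eqVlt; apply/orP; left; apply/eqP; ring.
Qed.

Lemma fine_wnormsqD_monomial f c m w : power_series f c -> (wnormsq V f < +oo)%E ->
  (wnormsq V (fun z => f z + w * z ^+ m)%R < +oo)%E /\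
  fine (wnormsq V (fun z => f z + w * z ^+ m)%R) =
  fine (wnormsq V f) + (cabs (c m + w) ^+ 2 - cabs (c m) ^+ 2) * h m.
Proof.
move=> fc foo; have le1 := wnormsqD_monomial m w fc foo.
have goo := le_lt_trans le1 (ltry _); split=> //.
have gd := power_seriesD fc (power_seriesZ (a := w) (@power_seriesX R m)).
have le2 := wnormsqD_monomial m (- w) gd goo.
apply/eqP; rewrite eq_le -lee_fin fineK ?ge0_fin_numE ?wnormsq_ge0// le1 /=.
rewrite -lerBrDr.
have fE : (fun z => f z + w * z ^+ m + - w * z ^+ m) = f.
  by apply/funext => z; rewrite mulNr addrK.
move: le2; rewrite fE -[wnormsq V f]fineK ?ge0_fin_numE ?wnormsq_ge0//.
rewrite lee_fin eqxx mulr1 addrK => le2.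
by apply: le_trans le2 _; rewrite le_eqVlt; apply/orP; left; apply/eqP; ring.
Qed.

End WeightedCoefficients.

(** * Inner products with monomials *)

Section InnerProduct.
Context {R : realType}.
Variables (V : R -> R) (h : nat -> R).
Hypothesis mV : measurable_fun setT V.
Hypothesis V0 : forall r, 0 <= V r.
Hypothesis V1 : forall r, V r <= 1.
Hypothesis hE : forall n, moment V n = (h n)%:E.
Local Notation T := (measurableTypeR R * measurableTypeR R)%type.

Lemma integrable_wintegrand f c : power_series f c -> (wnormsq V f < +oo)%E ->
  (area R).-integrable setT (EFin \o wintegrand V f).
Proof.
move=> fc foo; apply/integrableP; split.
  by apply: measurable_wintegrand => //; exact: power_series_measurable fc.
apply: le_lt_trans foo; rewrite le_eqVlt; apply/orP; left; apply/eqP.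
by apply: eq_integral => p _ /=; rewrite ger0_norm// -lee_fin wintegrand_ge0.
Qed.

Lemma wnormsq_monomial m : wnormsq V (fun z => z ^+ m) = (h m)%:E.
Proof. exact: hE. Qed.

(** Polarization: [g] is a multiple of the cross term of the squared modulus of
    [k + w z^m]. Parseval's identity for this sum replaces a product formula for
    inner products. *)
Lemma Rintegral_polarization k c m (w : R[i]) (g : T -> R) (s : R) :
  power_series k c -> (wnormsq V k < +oo)%E ->
  (forall p, g p = s * (wintegrand V (fun z => k z + w * z ^+ m) p -
     wintegrand V k p - wintegrand V (fun z => z ^+ m) p)) ->
  Rintegral (area R) setT g = s * (cabs (c m + w) ^+ 2 - cabs (c m) ^+ 2 - 1) * h m.
Proof.
move=> kc koo gE.
have [woo wE] := fine_wnormsqD_monomial mV V0 V1 hE m w kc koo.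
have zoo : (wnormsq V (fun z : R[i] => z ^+ m)%R < +oo)%E.
  by rewrite wnormsq_monomial ltry.
have Iw := integrable_wintegrand
  (power_seriesD kc (power_seriesZ (a := w) (@power_seriesX R m))) woo.
have Ik := integrable_wintegrand kc koo.
have Iz := integrable_wintegrand (@power_seriesX R m) zoo.
rewrite (_ : g = fun p => s * (wintegrand V (fun z => k z + w * z ^+ m) p -
     wintegrand V k p - wintegrand V (fun z => z ^+ m) p)); last exact/funext.
have Iwk : (area R).-integrable setT (EFin \o (fun p =>
    wintegrand V (fun z => k z + w * z ^+ m) p - wintegrand V k p)).
  exact: (integrableB measurableT Iw Ik).
have I3 : (area R).-integrable setT (EFin \o (fun p =>
    wintegrand V (fun z => k z + w * z ^+ m) p - wintegrand V k p -
    wintegrand V (fun z => z ^+ m) p)).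
  exact: (integrableB measurableT Iwk Iz).
rewrite RintegralZl// -mulrA; congr (_ * _).
rewrite RintegralB// RintegralB//.
have -> : Rintegral (area R) setT (wintegrand V (fun z => z ^+ m)) = h m.
  by rewrite /Rintegral -/(wnormsq V _) wnormsq_monomial.
rewrite /Rintegral -!/(wnormsq V _) wE; ring.
Qed.

Variable phi : R[i] -> R.
Hypothesis phiE : forall z, expR (- 2 * phi z) = V (cabs z).

(** The choices [w = 1] and [w = i] give the real and the imaginary part. *)
Lemma fock_inner_monomial k c m : power_series k c -> (wnormsq V k < +oo)%E ->
  fock_inner phi (fun z => z ^+ m) k = conjc (c m) * (h m)%:C.
Proof.
move=> kc koo; rewrite /fock_inner.
rewrite (@Rintegral_polarization k c m 1 _ (1 / 2) kc koo); last first.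
  move=> p; rewrite phiE /wintegrand.
  move: (complex_of_pair p) => z; case: (z ^+ m) (k z) (V (cabs z)) => [a b] [x y] v.
  by rewrite !sqr_cabs /=; field.
rewrite (@Rintegral_polarization k c m 'i _ (- (1 / 2)) kc koo); last first.
  move=> p; rewrite phiE /wintegrand.
  move: (complex_of_pair p) => z; case: (z ^+ m) (k z) (V (cabs z)) => [a b] [x y] v.
  by rewrite !sqr_cabs /=; field.
case: (c m) => x y; rewrite !sqr_cabs /=.
by apply/eqP; rewrite eq_complex /=; apply/andP; split; apply/eqP; field.
Qed.

End InnerProduct.

(** * The basis of normalized kernels *)

Section KernelBasis.
Context {R : realType}.
Variable delta : R.
Hypothesis hdelta : 0 < delta < 1.
Local Notation V := (lweight delta).
Local Notation h := (hmoment delta).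
Local Notation phi := (log_weight delta).
Local Notation r := (fock_radius phi).

Let mV := measurable_lweight delta.
Let V0 := @lweight_ge0 R delta.
Let V1 := @lweight_le1 R delta.
Let hE := momentE hdelta.
Let h0 := hmoment_gt0 hdelta.

(** The fourth power appears in the log-convexity of the moments, because the
    radii are fourth roots of ratios of moments and the [alpha] square roots. *)
Definition decay_ratio : R := expR (- ((1 - delta) / 4)).
Local Notation q := decay_ratio.
Local Notation alpha := (fun n => Num.sqrt (h n)).

Lemma decay_ratio01 : 0 < q < 1.
Proof. by rewrite /q expR_gt0 expR_lt1; move: hdelta => /andP[]; lra. Qed.

Let q0 : 0 < q. Proof. by case/andP: decay_ratio01. Qed.

Let alpha_gt0 n : 0 < alpha n. Proof. by rewrite sqrtr_gt0. Qed.

Let sqr_alpha n : alpha n ^+ 2 = h n. Proof. by rewrite sqr_sqrtr// ltW. Qed.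

Let alphaX4 n : alpha n ^+ 4 = h n ^+ 2.
Proof. by rewrite -[4%N]/(2 * 2)%N exprM sqr_alpha. Qed.

Let r_gt0 n : 0 < r n.+1. Proof. exact: expR_gt0. Qed.

Let r_ge0 n : 0 <= r n. Proof. by case: n => // n; exact: ltW. Qed.

Let rX4 n : r n.+1 ^+ 4 = h n.+2 / h n.
Proof.
rewrite -expRM_natl /log_moment -/(hmoment delta n.+2) -/(hmoment delta n).
rewrite mulrC divfK ?pnatr_eq0// expRD expRN !lnK ?posrE//.
Qed.

Let qX4 : q ^+ 4 = expR (- (1 - delta)).
Proof. by rewrite -expRM_natl; congr expR; field. Qed.

Let h_convex n : h n.+1 ^+ 2 <= q ^+ 4 * (h n.+2 * h n).
Proof.
rewrite qX4 expRN ler_pdivlMl ?expR_gt0//; exact: hmoment_log_convex.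
Qed.

Lemma moment_root_succ_le k : alpha k.+1 <= q * r k.+1 * alpha k.
Proof.
rewrite -(@ler_pXn2r _ 4)// ?nnegrE ?mulr_ge0 ?(ltW (alpha_gt0 _)) ?r_ge0 ?(ltW q0)//.
rewrite !exprMn !alphaX4 rX4; apply: le_trans (h_convex k) _.
by rewrite le_eqVlt; apply/orP; left; apply/eqP; field; rewrite gt_eqF.
Qed.

Lemma moment_root_le_succ k : r k * alpha k <= q * alpha k.+1.
Proof.
case: k => [|k]; first by rewrite mul0r mulr_ge0 ?(ltW (alpha_gt0 _)) ?(ltW q0).
rewrite -(@ler_pXn2r _ 4)// ?nnegrE ?mulr_ge0 ?(ltW (alpha_gt0 _)) ?r_ge0 ?(ltW q0)//.
rewrite !exprMn !alphaX4 rX4 mulrAC ler_pdivrMr//.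
by have := ler_wpM2l (ltW (h0 k.+2)) (h_convex k); rewrite !expr2; lra.
Qed.

Lemma fock_monomial m : fock phi (fun z => z ^+ m).
Proof.
split; last by rewrite -[fock_normsq _ _]/(moment V m) hE ltry.
by move=> z; apply: exprn_derivable.
Qed.

(** The reproducing property at the monomials determines the coefficients. *)
Lemma kernel_power_series lam k : is_reproducing_kernel phi lam k ->
  power_series k (fun m => conjc lam ^+ m / (h m)%:C).
Proof.
move=> [[ke koo] krep]; have [c kc] := entire_power_series ke.
rewrite (_ : (fun m => _) = c)//; apply/funext => m.
have hC : (h m)%:C != 0 :> R[i] by rewrite eq_complex /= negb_and gt_eqF.
have := krep _ (fock_monomial m).
rewrite (@fock_inner_monomial _ V h mV V0 V1 hE phi (fun=> erefl) k c m kc koo).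
move=> /(congr1 (@conjc R)); rewrite rmorphXn rmorphM /= conjcK => ->.
by rewrite oppr0 mulfK.
Qed.

Variables (k : R[i] -> R[i] -> R[i]) (theta : nat -> R).
Hypothesis hk : forall lam, is_reproducing_kernel phi lam (k lam).

Local Notation node n := (cpolar (r n) (theta n)).
Local Notation mu := (fun n => conjc (node n)).
Local Notation nu := (fun n => fock_norm phi (k (node n))).
Local Notation e := (fun n => fock_normalized phi (k (node n))).

Let cabs_mu n : cabs (mu n) = r n.
Proof. by rewrite cabs_conj cabs_cpolar// ger0_norm. Qed.

Let coef_mu n m :
  cabs (mu n ^+ m / (h m)%:C) ^+ 2 * h m = row_entry alpha r n m ^+ 2.
Proof.
rewrite cabsM cabsX cabsV cabs_mu cabs_real ger0_norm ?(ltW (h0 m))// /row_entry.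
by rewrite !exprMn !exprVn sqr_alpha; field; rewrite gt_eqF.
Qed.

Let kernel_sum n N : coef_normsq h (fun m => mu n ^+ m / (h m)%:C) N =
  \sum_(m < N) row_entry alpha r n m ^+ 2.
Proof. by apply: eq_bigr => m _; exact: coef_mu. Qed.

Let sqr_nu n : nu n ^+ 2 = fine (wnormsq V (k (node n))).
Proof. by rewrite sqr_sqrtr//; apply: fine_ge0; exact: (wnormsq_ge0 V0). Qed.

Lemma kernel_norm_ge n : row_entry alpha r n n <= nu n.
Proof.
have [[_ koo] _] := hk (node n).
have H := coef_normsq_le mV V0 V1 hE (kernel_power_series (hk (node n))) koo n.+1.
rewrite -(@ler_pXn2r _ 2)// ?nnegrE ?sqrtr_ge0//; last first.
  by rewrite ltW// (row_diag_gt0 alpha_gt0 r_gt0).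
rewrite sqr_nu; apply: le_trans H; rewrite kernel_sum big_ord_recr /= lerDr.
by apply: sumr_ge0 => m _; exact: sqr_ge0.
Qed.

(** The coordinates of the kernel at the node [n] decay geometrically away from
    the one of index [n]; Parseval's identity sums a geometric series. *)
Lemma kernel_norm_le n :
  nu n <= Num.sqrt (2 / (1 - q ^+ 2)) * row_entry alpha r n n.
Proof.
have q2 : 0 <= q ^+ 2 < 1.
  by rewrite exprn_ge0 ?(ltW q0)// exprn_ilt1 ?(ltW q0)//; case/andP: decay_ratio01.
have L0 : 0 <= 2 / (1 - q ^+ 2).
  by rewrite divr_ge0// subr_ge0 ltW//; case/andP: q2.
have row0 := row_diag_gt0 alpha_gt0 r_gt0 n.
rewrite -(@ler_pXn2r _ 2)// ?nnegrE ?sqrtr_ge0//; last first.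
  by apply: mulr_ge0; [exact: sqrtr_ge0|exact: ltW].
rewrite sqr_nu exprMn sqr_sqrtr//.
have [[_ koo] _] := hk (node n).
rewrite -lee_fin fineK ?ge0_fin_numE ?wnormsq_ge0//.
apply: (wnormsq_le_coef mV V0 hE (kernel_power_series (hk (node n)))) => N.
rewrite kernel_sum; apply: le_trans (_ : \sum_(m < N)
    (q ^+ 2) ^+ gap m n * row_entry alpha r n n ^+ 2 <= _); last first.
  by rewrite -mulr_suml ler_wpM2r ?sqr_ge0// sum_gap_le.
apply: ler_sum => m _; rewrite exprAC -exprMn gapC.
have nm0 := row_entry_ge0 alpha_gt0 erefl r_gt0 n m.
have rhs0 : 0 <= q ^+ gap n m * row_entry alpha r n n.
  by apply: mulr_ge0; [rewrite exprn_ge0 ?(ltW q0)|exact: ltW].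
rewrite ler_pXn2r//.
exact: (row_entry_decay decay_ratio01 alpha_gt0 erefl r_gt0
  moment_root_succ_le moment_root_le_succ).
Qed.

Let nu_gt0 n : 0 < nu n.
Proof. exact: lt_le_trans (row_diag_gt0 alpha_gt0 r_gt0 n) (kernel_norm_ge n). Qed.

Let ecoef n m : R[i] := (nu n)%:C^-1 * (mu n ^+ m / (h m)%:C).

Let e_series n : power_series (e n) (ecoef n).
Proof.
move=> z; have := power_seriesZ (a := (nu n)%:C^-1) (kernel_power_series (hk (node n))).
by move=> /(_ z); rewrite /fock_normalized [k _ _ / _]mulrC.
Qed.

Let alphaC_neq0 m : (alpha m)%:C != 0 :> R[i].
Proof. by rewrite eq_complex /= negb_and gt_eqF. Qed.

Let nuC_neq0 m : (nu m)%:C != 0 :> R[i].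
Proof. by rewrite eq_complex /= negb_and gt_eqF. Qed.

Let ecoefE n m : ecoef n m * (alpha m)%:C = kernel_entry alpha mu nu n m.
Proof.
have hC : (h m)%:C = (alpha m)%:C ^+ 2 :> R[i] by rewrite -rmorphXn /= sqr_alpha.
rewrite /ecoef /kernel_entry hC rmorphM /=.
by field; rewrite nuC_neq0 alphaC_neq0.
Qed.

Let coef_normsqE c N :
  coef_normsq h c N = \sum_(m < N) cabs (c m * (alpha m)%:C) ^+ 2.
Proof.
apply: eq_bigr => m _; rewrite cabsM cabs_real ger0_norm ?(ltW (alpha_gt0 m))//.
by rewrite exprMn sqr_alpha.
Qed.

Let lincomb_coefE (a : nat -> R[i]) N m : (\sum_(n < N) a n * ecoef n m) * (alpha m)%:C =
  \sum_(n < N) a n * kernel_entry alpha mu nu n m.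
Proof.
by rewrite mulr_suml; apply: eq_bigr => n _; rewrite -mulrA ecoefE.
Qed.

Lemma fock_normalized_kernel n : fock phi (e n).
Proof.
have [[ke koo] _] := hk (node n); split.
  move=> z; rewrite (_ : e n = (nu n)%:C^-1 \*: k (node n)); last first.
    by apply/funext => w; rewrite /fock_normalized mulrC.
  exact: derivableZ (ke z).
have cE m : cabs (ecoef n m) ^+ 2 * h m =
    nu n ^- 2 * (cabs (mu n ^+ m / (h m)%:C) ^+ 2 * h m).
  rewrite /ecoef; move: (mu n ^+ m / (h m)%:C) => X.
  rewrite cabsM cabsV cabs_real ger0_norm ?(ltW (nu_gt0 n))//.
  by rewrite exprMn exprVn -mulrA.
apply: (@le_lt_trans _ _ (1%R)%:E); last exact: ltry.
rewrite -[fock_normsq _ _]/(wnormsq V (e n)).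
apply: (wnormsq_le_coef mV V0 hE (@e_series n)) => N.
rewrite /coef_normsq; under eq_bigr do rewrite cE.
rewrite -mulr_sumr mulrC ler_pdivrMr ?exprn_gt0// mul1r sqr_nu.
exact: (coef_normsq_le mV V0 V1 hE (kernel_power_series (hk (node n))) koo).
Qed.

Let nu_ge := kernel_norm_ge.
Let nu_le := kernel_norm_le.

Lemma kernel_basis_upper : exists2 C : R, 0 < C & forall N (a : nat -> R[i]),
  (fock_normsq phi (lincomb e N a) <= (C * \sum_(n < N) cabs (a n) ^+ 2)%:E)%E.
Proof.
have [C C0 HC] := kernel_matrix_upper decay_ratio01 alpha_gt0 erefl r_gt0
  moment_root_succ_le moment_root_le_succ cabs_mu nu_ge.
exists C => // N a.
apply: (wnormsq_le_coef mV V0 hE (@power_series_lincomb _ e ecoef N a e_series)) => M.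
rewrite coef_normsqE; under eq_bigr do rewrite lincomb_coefE.
exact: HC.
Qed.

Lemma kernel_basis_lower : exists2 c : R, 0 < c & forall N (a : nat -> R[i]),
  ((c * \sum_(n < N) cabs (a n) ^+ 2)%:E <= fock_normsq phi (lincomb e N a))%E.
Proof.
have [C C0 HC] := kernel_matrix_lower decay_ratio01 alpha_gt0 erefl r_gt0
  moment_root_succ_le moment_root_le_succ cabs_mu nu_ge nu_le.
have [D D0 HD] := kernel_basis_upper.
exists C^-1; first by rewrite invr_gt0.
move=> N a; have foo := le_lt_trans (HD N a) (ltry _).
have := coef_normsq_le mV V0 V1 hE (@power_series_lincomb _ e ecoef N a e_series) foo N.
rewrite -[X in (_ <= X)%E]fineK ?ge0_fin_numE ?(wnormsq_ge0 V0)// lee_fin.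
apply: le_trans; rewrite mulrC ler_pdivrMr// mulrC coef_normsqE.
under [in leRHS]eq_bigr do rewrite lincomb_coefE.
exact: HC.
Qed.

Let coef_tail f c : power_series f c -> (wnormsq V f < +oo)%E ->
  forall eta : R, 0 < eta -> exists M, forall N,
    coef_normsq h c N - coef_normsq h c M <= eta.
Proof.
move=> fc foo eta eta0; set u := coef_normsq h c.
have und : nondecreasing_seq u by exact: (coef_normsq_homo V0 hE).
have ub : has_ubound (range u).
  by exists (fine (wnormsq V f)) => _ [N _ <-]; exact: (coef_normsq_le mV V0 V1 hE fc foo).
have uc : cvgn u := nondecreasing_is_cvgn und ub.
have /cvgrPdist_lt/(_ _ eta0)[M _ HM] := uc.
exists M => N; have := HM M (leqnn M).
have := nondecreasing_cvgn_le und uc N; have := ler_norm (limn u - u M).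
lra.
Qed.

Let sqr_cabsB_le (x y : R[i]) :
  cabs (x - y) ^+ 2 <= 2 * cabs x ^+ 2 + 2 * cabs y ^+ 2.
Proof.
have h1 : cabs (x - y) ^+ 2 <= (cabs x + cabs y) ^+ 2.
  by rewrite lerXn2r ?nnegrE ?addr_ge0 ?cabs_ge0// cabsB.
have h2 := sqr_ge0 (cabs x - cabs y); apply: le_trans h1 _.
by move: (cabs x) (cabs y) h2 => a b; rewrite !expr2; lra.
Qed.

(** The coefficients of [f] beyond a large [M] are discarded, and the others are
    reproduced exactly in the columns below a much larger [N]. The error consists
    of the tail of [f] and of the overflow beyond [N]. *)
Lemma kernel_basis_complete : complete_system phi e.
Proof.
move=> f [fe foo] eps eps0; have [c fc] := entire_power_series fe.
have q1 : q < 1 by case/andP: decay_ratio01.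
have oq : 0 < 1 - q by rewrite subr_gt0.
pose s m := c m * (alpha m)%:C.
have eta0 : 0 < eps ^+ 2 / 8 by rewrite divr_gt0// exprn_gt0.
have [M HM] := coef_tail fc foo eta0.
have [B B0 HB] := kernel_matrix_finite_section decay_ratio01 alpha_gt0 erefl r_gt0
  moment_root_succ_le moment_root_le_succ cabs_mu nu_ge nu_le s M.
have [N MN qN] : exists2 N, (M <= N)%N & 2 * B ^+ 2 * (q ^+ N / (1 - q)) <= eps ^+ 2 / 4.
  have D0 : 0 < B ^+ 2 + 1 by rewrite ltr_wpDl ?sqr_ge0.
  have z0 : 0 < eps ^+ 2 / 8 * (1 - q) / (B ^+ 2 + 1).
    by rewrite divr_gt0// mulr_gt0.
  have aq1 : `|q| < 1 by rewrite gtr0_norm.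
  have /cvgr0Pnorm_lt/(_ _ z0)[K _ HK] := cvg_expr aq1.
  exists (maxn M K); first exact: leq_maxl.
  have := HK _ (leq_maxr M K); rewrite /= ger0_norm ?exprn_ge0 ?(ltW q0)//.
  rewrite ltr_pdivlMr// => H.
  rewrite mulrA ler_pdivrMr//; move: H.
  have : 0 <= q ^+ maxn M K by rewrite exprn_ge0 ?(ltW q0).
  by move: (B ^+ 2) (eps ^+ 2) (q ^+ _) => b t x x0 H; lra.
have [a [Hlt Hge]] := HB N MN.
exists N, a.
have gd := power_seriesB fc (@power_series_lincomb _ e ecoef N a e_series).
pose d m := c m - \sum_(n < N) a n * ecoef n m.
pose x m := \sum_(n < N) a n * kernel_entry alpha mu nu n m.
have dE m : d m * (alpha m)%:C = s m - x m.
  by rewrite mulrBl lincomb_coefE.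
have dle m : cabs (d m * (alpha m)%:C) ^+ 2 <=
    2 * (cabs (s m) ^+ 2 - (m < M)%:R * cabs (s m) ^+ 2) +
    2 * B ^+ 2 * ((N <= m)%:R * q ^+ m).
  rewrite dE; have [Nm|mN] := leqP N m.
    have -> : (m < M)%N = false by apply/negbTE; rewrite -leqNgt (leq_trans MN).
    rewrite mul0r subr0 mul1r; apply: le_trans (sqr_cabsB_le _ _) _.
    rewrite lerD2l -mulrA ler_pM2l//.
    rewrite (_ : B ^+ 2 * q ^+ m = (B * Num.sqrt q ^+ m) ^+ 2); last first.
      by rewrite exprMn exprAC sqr_sqrtr// ltW.
    by rewrite lerXn2r ?nnegrE ?cabs_ge0 ?mulr_ge0 ?exprn_ge0 ?sqrtr_ge0//; exact: Hge.
  rewrite mul0r mulr0 addr0 /x Hlt//; case: ifP => mM.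
    by rewrite subrr cabs0 mul1r subrr expr0n mulr0.
  by rewrite subr0 mul0r subr0 ler_peMl ?sqr_ge0// ler1n.
apply: (@le_lt_trans _ _ ((eps ^+ 2 / 2)%:E)); last first.
  by rewrite lte_fin ltr_pdivrMr// ltr_pMr ?exprn_gt0// ltr1n.
apply: (wnormsq_le_coef mV V0 hE gd) => K; rewrite -/d.
apply: le_trans (coef_normsq_homo V0 hE d (leq_addl N K)) _.
rewrite coef_normsqE.
have dsum := @ler_sum R _ (index_enum 'I_(N + K)) predT _ _ (fun m _ => dle m).
apply: le_trans dsum _.
rewrite big_split /= -!mulr_sumr sumrB.
have -> : \sum_(m < N + K) cabs (s m) ^+ 2 = coef_normsq h c (N + K).
  by rewrite coef_normsqE.
have -> : \sum_(m < N + K) (m < M)%:R * cabs (s m) ^+ 2 = coef_normsq h c M.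
  rewrite coef_normsqE (big_ord_widen (N + K) (fun m => cabs (s m) ^+ 2)); last first.
    exact: leq_trans MN (leq_addr _ _).
  rewrite [RHS]big_mkcond; apply: eq_bigr => m _.
  by case: ifP; rewrite ?mul1r ?mul0r.
have t1 := HM (N + K)%N.
have t2 : \sum_(m < N + K) (N <= m)%:R * q ^+ m <= q ^+ N / (1 - q).
  rewrite big_split_ord /= big1 ?add0r => [|m _]; last first.
    by rewrite leqNgt ltn_ord mul0r.
  under eq_bigr do rewrite leq_addr mul1r exprD.
  rewrite -mulr_sumr ler_wpM2l ?exprn_ge0 ?(ltW q0)// sum_geometric_le//.
  by rewrite (ltW q0).
have B2 : 0 <= 2 * B ^+ 2 by rewrite mulr_ge0 ?sqr_ge0.
have t3 := le_trans (ler_wpM2l B2 t2) qN.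
by apply: le_trans (lerD (ler_wpM2l (ler0n R 2) t1) t3) _; lra.
Qed.

End KernelBasis.

Theorem theorem2p10 (R : realType) (delta : R) (hdelta : 0 < delta < 1)
    (k : R[i] -> R[i] -> R[i])
    (hk : forall lam : R[i],
        is_reproducing_kernel (log_weight delta) lam (k lam))
    (theta : nat -> R) :
  riesz_basis (log_weight delta)
    (fun n => fock_normalized (log_weight delta)
                (k (cpolar (fock_radius (log_weight delta) n) (theta n)))).
Proof.
  (* your proof *)
Proof.
have [c c0 Hc] := kernel_basis_lower hdelta theta hk.
have [C C0 HC] := kernel_basis_upper hdelta theta hk.
split.
- exact: (fock_normalized_kernel hdelta theta hk).
- exact: (kernel_basis_complete hdelta theta hk).
- by exists c, C; split=> // N a; rewrite Hc HC.
Qed.
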